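(* Let $p\ge q\ge2$ and let $\mathcal T$ be any IPVT, $\mathrm{IPVT}_\xi(\mathrm{DL}(p,q))$, of the (vertex-measured) Diestel--Leader graph $\mathrm{DL}(p,q)$. The pairwise intersections of its cells satisfy the following almost surely: (i) Two cells of different type have finite or empty intersection (resp. adjacency). (ii) Two distinct cells of the same type have infinite or empty intersection (resp. adjacency). (iii) In addition, every cell attains each of these intersection/adjacency types infinitely often: for every cell $C$ there are infinitely many other cells of the same type whose intersection with $C$ is infinite, infinitely many of the same type whose intersection with $C$ is empty, and, when $p=q$ (so that cells of both types exist), infinitely many cells of the other type whose intersection with $C$ is finite and nonempty, and infinitely many of the other type whose intersection with $C$ is empty; and likewise with adjacency in place of intersection.
   Context: Diestel--Leader graph. $T,T'$ are the $(p+1)$-regular and $(q+1)$-regular trees, with fixed vertices $o,o'$ and fixed ends $\omega_0,\omega'_0$. $u\wedge v$ is the common vertex of the geodesics $uv$, $u\omega_0$, $v\omega_0$ in $T$, and $h(u)=d(u,u\wedge o)-d(o,u\wedge o)$; $h'$ on $T'$ is defined similarly. $\mathrm{DL}(p,q)$ has vertex set $V=\{(v,v')\in T\times T':h(v)+h'(v')=0\}$ and $(v,v')\sim(w,w')$ iff $v\sim w$ and $v'\sim w'$. It carries the graph distance and the counting measure. For an end $\omega\in\partial T$ let $d_\omega(y)=\lim_{x\to\omega}(d(y,x)-d(o,x))$ and $\rho_\omega(y,y')=d_\omega(y)$; for $\omega'\in\partial T'$ define $d_{\omega'}$ similarly and $\rho'_{\omega'}(y,y')=d_{\omega'}(y')$.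 These are horofunctions of $\mathrm{DL}(p,q)$, giving embeddings of $\partial T$ and $\partial T'$ into the horoboundary $\partial\,\mathrm{DL}(p,q)$. Let $\eta,\eta'$ be the harmonic measures on $\partial T,\partial T'$ (limit laws of simple random walk from $o$, resp. $o'$). IPVT. Every IPVT of $\mathrm{DL}(p,q)$ (weak limit as $\lambda_n\to0$ of Voronoi diagrams of Poisson point processes on $V$ of intensity $\lambda_n$) is of the form $\mathrm{IPVT}_\xi(\mathrm{DL}(p,q))=\mathrm{Vor}(\Phi)$ for some $\xi\in\mathbb R$, where $\Phi=(\Theta_i,\Delta_i)_i$ is the Poisson point process on $\partial\,\mathrm{DL}(p,q)\times\mathbb Z$ with intensity $\nu_0\otimes\beta^{(\xi)}$, $\beta^{(\xi)}(i)=(p-1)p^{i-1+\xi}$, $\nu_0=\eta$ if $p>q$ and $\nu_0=(\eta+\eta')/2$ if $p=q$. With $f_i$ equal to $\Delta_i$ plus the horofunction ($\rho_\omega$ or $\rho'_{\omega'}$) of $\Theta_i$, the cells are $C_i=\{z\in V:f_i(z)\le f_j(z)\ \forall j\}$; $\Theta_i$ is the nucleus of $C_i$. A cell is of the first type if its nucleus is in $\partial T$, and of the second type if its nucleus is in $\partial T'$. The adjacency of cells $C,C'$ is the set of pairs $(x,y)\in C\times C'$ with $x\sim y$. *)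

(* Defs.v *)
From HB Require Import structures.
From mathcomp Require Import all_boot all_order all_algebra.
From mathcomp Require Import all_classical all_reals all_analysis.
From mathcomp Require Import measurable_realfun.
Set Implicit Arguments.
Unset Strict Implicit.
Unset Printing Implicit Defensive.
Import Order.TTheory GRing.Theory Num.Theory.
Import numFieldNormedType.Exports.
Local Open Scope classical_set_scope.
Local Open Scope ring_scope.

Section GraphDistance.
Context {T : choiceType} (e : rel T).

Definition walk (x y : T) (n : nat) : Prop :=
  exists s : seq T, [/\ path e x s, last x s = y & size s = n].

(* 0 when x and y are not connected; only used on connected graphs *)
Definition gdist (x y : T) : nat :=
  xget 0%N [set n | walk x y n /\ forall m, walk x y m -> (n <= m)%N].

Definition geodesic_ray (x : T) (r : nat -> T) : Prop :=
  r 0%N = x /\ forall m n : nat, (m <= n)%N -> gdist (r m) (r n) = (n - m)%N.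

End GraphDistance.

(* The d-regular tree with a fixed vertex and a fixed end; the end is given by
   its geodesic ray issued from the fixed vertex. *)
Record marked_tree (d : nat) := MarkedTree {
  vertex :> choiceType ;
  adj : rel vertex ;
  root : vertex ;
  base_ray : nat -> vertex ;
  adj_sym : symmetric adj ;
  adj_irr : irreflexive adj ;
  adj_connected : forall x y, exists n, walk adj x y n ;
  adj_acyclic : forall c : seq vertex, ucycle adj c -> (size c <= 2)%N ;
  adj_regular : forall x, ([set y | adj x y] #= `I_d)%card ;
  base_rayP : geodesic_ray adj root base_ray }.
Arguments adj {d} _.
Arguments root {d} _.
Arguments base_ray {d} _.

Notation dist T := (gdist (adj T)).

(* In a tree every end contains exactly one geodesic ray issued from the root,
   so the boundary is encoded as the set of these rays. *)
Record end_of (d : nat) (T : marked_tree d) := EndOf {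
  ray :> nat -> T ;
  rayP : geodesic_ray (adj T) (root T) ray }.

Section Ends.
Context {d : nat} {T : marked_tree d}.
Implicit Types (w : end_of T) (u v x y : T).

Definition base_end : end_of T := EndOf (base_rayP T).

HB.instance Definition _ := gen_eqMixin (end_of T).
HB.instance Definition _ := gen_choiceMixin (end_of T).
HB.instance Definition _ := isPointed.Build (end_of T) base_end.

Definition cylinder (v : T) : set (end_of T) := [set w | exists n, w n = v].

Definition end_measurable : set (set (end_of T)) := <<s range cylinder >>.

Lemma end_measurableC A : end_measurable A -> end_measurable (~` A).
Proof. exact: sigma_algebraC. Qed.

(* Borel sigma-algebra of the boundary *)
HB.instance Definition _ := @isMeasurable.Build default_measure_display
  (end_of T) end_measurable (@sigma_algebra0 _ setT _) end_measurableC
  (@sigma_algebra_bigcup _ setT _).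

(* trace on the vertices of the neighbourhoods of the end w:
   the n-th basic one consists of the x whose geodesic from the root
   passes through w n *)
Definition end_nbhs (w : end_of T) : set_system T :=
  filter_from [set: nat] (fun n =>
    [set x | dist T (root T) x
           = (dist T (root T) (w n) + dist T (w n) x)%N]).

Definition on_geodesic (u v x : T) : Prop :=
  dist T u v = (dist T u x + dist T x v)%N.

Definition on_ray_to (u : T) (w : end_of T) (x : T) : Prop :=
  \forall n \near \oo, on_geodesic u (w n) x.

Definition meet (u v : T) : T :=
  xget (root T) [set x | [/\ on_geodesic u v x, on_ray_to u base_end x
                           & on_ray_to v base_end x]].

Definition height (u : T) : int :=
  (dist T u (meet u (root T)))%:Z - (dist T (root T) (meet u (root T)))%:Z.

Definition busemann (R : realType) (w : end_of T) (y : T) : R :=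
  lim ((fun x => (dist T y x)%:R - (dist T (root T) x)%:R : R) @ end_nbhs w).

Section Harmonic.
Context {R : realType}.

Definition simple_random_walk dO (Omega : measurableType dO)
    (P : probability Omega R) (X : nat -> Omega -> T) : Prop :=
  [/\ forall n v, measurable [set o | X n o = v],
      P [set o | X 0%N o = root T] = 1%E
    & forall n (x : nat -> T),
        P [set o | forall k, (k <= n.+1)%N -> X k o = x k]
        = (P [set o | forall k, (k <= n)%N -> X k o = x k]
           * (if adj T (x n) (x n.+1) then d%:R^-1 else 0)%:E)%E].

Definition harmonic_measure (eta : set (end_of T) -> \bar R) : Prop :=
  exists dO (Omega : measurableType dO) (P : probability Omega R)
    (X : nat -> Omega -> T) (Xoo : Omega -> end_of T),
  [/\ simple_random_walk P X, measurable_fun setT Xoo,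
      {ae P, forall o, end_nbhs (Xoo o) `<=` (X ^~ o @ \oo)}
    & forall A, measurable A -> eta A = P (Xoo @^-1` A)].

End Harmonic.
End Ends.

Section PoissonPointProcess.
Context {R : realType} {dO : measure_display} {Omega : measurableType dO}
  {dX : measure_display} {X : measurableType dX}.
Implicit Types (Phi : nat -> Omega -> X) (A : set X).

Definition npoints Phi A (o : Omega) : \bar R := counting [set i | A (Phi i o)].

(* Poisson point process enumerated by nat, hence for an intensity mu of
   infinite total mass; points are counted with multiplicity. *)
Definition poisson_point_process (P : probability Omega R) Phi
    (mu : set X -> \bar R) : Prop :=
  [/\ forall i, measurable_fun setT (Phi i),
      forall A, measurable A -> mu A \is a fin_num -> forall k : nat,
        P [set o | npoints Phi A o = k%:R%:E]
        = (fine (mu A) ^+ k / k`!%:R * expR (- fine (mu A)))%:E,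
      forall A, measurable A -> mu A = +oo%E ->
        P [set o | npoints Phi A o = +oo%E] = 1%E
    & forall n (A : 'I_n -> set X) (B : 'I_n -> set (\bar R)),
        (forall i, measurable (A i)) -> trivIset setT A ->
        (forall i, measurable (B i)) ->
        P (\bigcap_(i in setT) [set o | B i (npoints Phi (A i) o)])
        = (\prod_(i < n) P [set o | B i (npoints Phi (A i) o)])%E].

End PoissonPointProcess.

HB.instance Definition _ := isPointed.Build int 0.

HB.instance Definition _ := @isMeasurable.Build default_measure_display
  int discrete_measurable discrete_measurable0
  discrete_measurableC discrete_measurableU.

Section Beta.
Context {R : realType} (p : nat) (xi : R).

Definition beta_weight (i : int) : R :=
  p.-1%:R * p%:R `^ (i%:~R - 1 + xi).

Definition beta (B : set int) : \bar R := \esum_(i in B) (beta_weight i)%:E.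

Let beta_weight_ge0 i : (0 <= (beta_weight i)%:E)%E.
Proof. by rewrite lee_fin mulr_ge0// powR_ge0. Qed.

Let beta0 : beta set0 = 0%E.
Proof. exact: esum_set0. Qed.

Let beta_ge0 B : (0 <= beta B)%E.
Proof. exact: esum_ge0. Qed.

Let beta_sigma_additive : semi_sigma_additive beta.
Proof.
move=> F mF tF mUF; apply: cvg_toP.
  by apply: ereal_nondecreasing_is_cvgn => a b ab; exact: lee_sum_nneg_natr.
by rewrite nneseries_esumT// /beta -esum_bigcupT.
Qed.

HB.instance Definition _ := isMeasure.Build _ _ _ beta
  beta0 beta_ge0 beta_sigma_additive.

Let beta_sigma_finite : sigma_finite [set: int] beta.
Proof.
pose F (n : nat) := [set i : int | (`|i| <= n)%N].
have fF n : finite_set (F n).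
  apply: (@sub_finite_set _ _
    ((fun k : nat => k%:Z) @` `I_n.+1 `|` (fun k : nat => - k%:Z) @` `I_n.+1)).
    case=> k; rewrite /F /= => kn; first by left; exists k.
    by right; exists k.+1; rewrite ?NegzE.
  by rewrite finite_setU; split; apply/finite_image/finite_II.
exists F; first by apply/seteqP; split=> // i _; exists `|i|%N => //=; rewrite /F/=.
move=> n; split=> //; rewrite /beta esum_fset// fsbig_finite//=.
by rewrite sumEFin ltry.
Qed.

HB.instance Definition _ := @Measure_isSigmaFinite.Build _ _ _ beta beta_sigma_finite.

End Beta.
Arguments beta {R}.

(* The disjoint union of the boundaries of the two trees. It is identified with
   its image in the horoboundary of the Diestel--Leader graph under the
   horofunctions rho_w and rho'_w' below; this image carries nu0. *)
Definition dl_boundary d d' (T : marked_tree d) (T' : marked_tree d') : Type :=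
  (end_of T + end_of T')%type.

Section BoundaryMeasurable.
Context {d d' : nat} {T : marked_tree d} {T' : marked_tree d'}.
Local Notation bdry := (dl_boundary T T').

Definition bdry_inl (w : end_of T) : bdry := inl w.
Definition bdry_inr (w : end_of T') : bdry := inr w.

HB.instance Definition _ := gen_eqMixin bdry.
HB.instance Definition _ := gen_choiceMixin bdry.
HB.instance Definition _ := isPointed.Build bdry (bdry_inl base_end).

Definition bdry_measurable : set (set bdry) :=
  [set A | measurable (bdry_inl @^-1` A) /\ measurable (bdry_inr @^-1` A)].

Lemma bdry_measurable0 : bdry_measurable set0.
Proof. by split; rewrite preimage_set0. Qed.

Lemma bdry_measurableC A : bdry_measurable A -> bdry_measurable (~` A).
Proof. by move=> [mA mA']; split; rewrite preimage_setC; exact: measurableC. Qed.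

Lemma bdry_measurable_bigcup (F : (set bdry)^nat) :
  (forall i, bdry_measurable (F i)) -> bdry_measurable (\bigcup_i F i).
Proof.
by move=> mF; split; rewrite preimage_bigcup; apply: bigcupT_measurable => i;
  case: (mF i).
Qed.

HB.instance Definition _ := @isMeasurable.Build default_measure_display
  bdry bdry_measurable bdry_measurable0 bdry_measurableC bdry_measurable_bigcup.

Lemma measurable_bdry_inl : measurable_fun setT bdry_inl.
Proof. by move=> _ A [mA _]; rewrite setTI. Qed.

Lemma measurable_bdry_inr : measurable_fun setT bdry_inr.
Proof. by move=> _ A [_ mA]; rewrite setTI. Qed.

End BoundaryMeasurable.

Section DiestelLeader.
Context {p q : nat} {T : marked_tree p.+1} {T' : marked_tree q.+1}.
Local Notation bdry := (dl_boundary T T').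

Section Intensity.
Context {R : realType} (eta : {measure set (end_of T) -> \bar R})
  (eta' : {measure set (end_of T') -> \bar R}).

Definition nu0 (A : set bdry) : \bar R :=
  (if (q < p)%N then eta (bdry_inl @^-1` A)
   else (2^-1)%:E * (eta (bdry_inl @^-1` A) + eta' (bdry_inr @^-1` A)))%E.

Let nu00 : nu0 set0 = 0%E.
Proof. by rewrite /nu0 !preimage_set0 !measure0 adde0 mule0 if_same. Qed.

Let nu0_ge0 A : (0 <= nu0 A)%E.
Proof.
by rewrite /nu0; case: ifP => // _; rewrite mule_ge0 ?adde_ge0// lee_fin.
Qed.

Let nu0_sigma_additive : semi_sigma_additive nu0.
Proof.
move=> F mF tF mUF.
have add1 : \sum_(0 <= k < n) eta (bdry_inl @^-1` F k) @[n --> \oo] -->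
    eta (bdry_inl @^-1` \bigcup_n F n).
  rewrite preimage_bigcup; apply: measure_semi_sigma_additive.
  - by move=> k; case: (mF k).
  - move=> a b _ _ [z [Fa Fb]]; apply: tF => //.
    by eexists; split; [exact: Fa|exact: Fb].
  - by rewrite -preimage_bigcup; case: mUF.
have add2 : \sum_(0 <= k < n) eta' (bdry_inr @^-1` F k) @[n --> \oo] -->
    eta' (bdry_inr @^-1` \bigcup_n F n).
  rewrite preimage_bigcup; apply: measure_semi_sigma_additive.
  - by move=> k; case: (mF k).
  - move=> a b _ _ [z [Fa Fb]]; apply: tF => //.
    by eexists; split; [exact: Fa|exact: Fb].
  - by rewrite -preimage_bigcup; case: mUF.
rewrite /nu0; case: ifP => _ //.
rewrite [X in X @ _ --> _](_ : _ = fun n => (2^-1)%:E *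
  (\sum_(0 <= k < n) eta (bdry_inl @^-1` F k) +
   \sum_(0 <= k < n) eta' (bdry_inr @^-1` F k)))%E; last first.
  apply/funext => n; rewrite -big_split/= ge0_sume_distrr// => k _.
  exact: adde_ge0.
apply: cvgeZl => //; apply: cvgeD => //.
by apply: ge0_adde_def; rewrite inE measure_ge0.
Qed.

HB.instance Definition _ := isMeasure.Build _ _ _ nu0
  nu00 nu0_ge0 nu0_sigma_additive.

Definition ipvt_intensity (xi : R) : set (bdry * int) -> \bar R :=
  (nu0 \x beta p xi)%E.

HB.instance Definition _ (xi : R) := Measure.copy (ipvt_intensity xi)
  (nu0 \x beta p xi)%E.

End Intensity.

Definition dl_vertex : set (T * T') := [set z | height z.1 + height z.2 = 0].

Definition dl_adj : rel (T * T') :=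
  fun z w => adj T z.1 w.1 && adj T' z.2 w.2.

Definition horofunction (R : realType) (theta : bdry) (z : T * T') : R :=
  match theta with
  | inl w => busemann R w z.1
  | inr w' => busemann R w' z.2
  end.

Definition of_first_type (theta : bdry) : bool :=
  if theta is inl _ then true else false.

Definition same_type (theta theta' : bdry) : bool :=
  of_first_type theta == of_first_type theta'.

Definition voronoi_cell (R : realType) (phi : nat -> bdry * int) (i : nat)
    : set (T * T') :=
  let f j z : R := (phi j).2%:~R + horofunction R (phi j).1 z in
  [set z | dl_vertex z /\ forall j, f i z <= f j z].

Definition adjacency (C C' : set (T * T')) : set ((T * T') * (T * T')) :=
  [set xy | [/\ C xy.1, C' xy.2 & dl_adj xy.1 xy.2]].

End DiestelLeader.

(* Main.v *)
(* Both horofunctions are governed by levels in rooted trees: with the end w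
   sharing c edges with the geodesic from the root to y, d_w(y) = |y| - 2c.

   Harmonic measure: the number of walks of length n from the root ending in the
   cone of v depends only on the level of v, so by Fatou eta of a cylinder is at
   most, hence exactly, the inverse of the number of vertices of its level. Thus
   the number of points (w, D) of the process with w through v and D = i is
   Poisson with mean c p^(i - |v|).

   Almost sure properties of the points of one tree: (a) finitely many delays lie
   below any level, no nucleus is the fixed end, and nuclei with different delays
   differ; (b) for all B, the minimum F of the delayed horofunctions satisfies
   F(v) <= |v| - B for all but finitely many v (Borel--Cantelli); (c) along the ray
   of every point i there are infinitely many side branches whose minimal delay has
   the parity of the delay of i (first moment over the vertices of a level, using
   independence of disjoint branches); (d) if p = q, on each horosphere F takes each
   value infinitely often.

   The rest is deterministic. The side branches of (c) give infinitely many cells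
   of the same type meeting a given one in the tree; a vertex outside two cells and
   between their nuclei separates them. By (d), or trivially if p > q, each pair of
   tree vertices realizing a contact lifts to infinitely many contacts in DL(p,q).
   If a point z of a cell of the first type is (almost) at equal delayed distance
   from a nucleus of the second type, then opposite heights force the common value
   to be at least |z| - B for a constant B, contradicting (b) for all but finitely
   many z. *)
Require Import Defs.
From mathcomp Require Import all_boot all_order all_algebra.
From mathcomp Require Import all_classical all_reals all_analysis.
From mathcomp Require Import measurable_realfun.
From mathcomp Require Import zify ring lra.
Set Implicit Arguments.
Unset Strict Implicit.
Unset Printing Implicit Defensive.
Import Order.TTheory GRing.Theory Num.Theory.
Import numFieldNormedType.Exports.
Local Open Scope classical_set_scope.
Local Open Scope ring_scope.

(** * Levels and distances in a tree *)

(** The ray in (c) is itself random. Instead of conditioning on a point of the process, one sums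
    over all vertices of a level: level n has at most 2 p^n vertices, and a given one lies on the
    ray of a point of delay D with probability at most c0 p^(D - n). This sum stays bounded in n, so
    any further factor tending to 0 makes the exceptional event null. In (c) and (d) this factor is
    a power of 1 - c: many disjoint regions each carry an event of the same kind, one set empty and
    another occupied, with means bounded above for the first and below for the second, so that c
    does not depend on the level.

    The intensity is not symmetric in the two trees: [beta] is built from p and fits the growth of
    T' only if q = p. Hence the deterministic part is written for a vertex set with two abstract
    projections, and is used a second time, with the factors exchanged, only when p = q.

    The process is enumerated by indices, whereas the theorem counts cells as sets. Finiteness of
    the delays below a level shows that a vertex lies in finitely many cells, which bridges the
    two. *)

Section GraphDistance.
Context {T : choiceType} (e : rel T).
Hypotheses (e_sym : symmetric e) (e_conn : forall x y, exists n, walk e x y n).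
Local Open Scope nat_scope.

Lemma gdistP x y : walk e x y (gdist e x y) /\
  forall m, walk e x y m -> gdist e x y <= m.
Proof.
have ex : exists n, `[< walk e x y n >].
  by have [n xyn] := e_conn x y; exists n; exact/asboolP.
have [n /asboolP xyn nmin] := ex_minnP ex.
apply: (@xgetPex nat 0 [set n | walk e x y n /\ forall m, walk e x y m -> n <= m]).
by exists n; split => // m xym; apply: nmin; exact/asboolP.
Qed.

Lemma walk_gdist x y : walk e x y (gdist e x y).
Proof. by have [] := gdistP x y. Qed.

Lemma gdist_le x y m : walk e x y m -> gdist e x y <= m.
Proof. by have [_] := gdistP x y; exact. Qed.

Lemma walk_cat x y z m n : walk e x y m -> walk e y z n -> walk e x z (m + n).
Proof.
move=> [s [xs sy sm]] [t [yt tz tn]]; exists (s ++ t).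
by rewrite cat_path last_cat sy xs yt size_cat sm tn.
Qed.

Lemma walk_rev x y n : walk e x y n -> walk e y x n.
Proof.
move=> [s [xs sy sn]]; exists (rev (belast x s)); split.
- by rewrite -sy rev_path; under eq_path do rewrite e_sym.
- by case: s {xs sn} sy => //= a s _; rewrite rev_cons last_rcons.
- by rewrite size_rev size_belast.
Qed.

Lemma gdistC x y : gdist e x y = gdist e y x.
Proof.
by apply/eqP; rewrite eqn_leq; apply/andP; split; apply/gdist_le/walk_rev/walk_gdist.
Qed.

Lemma walk_adj x y : e x y -> walk e x y 1.
Proof. by move=> exy; exists [:: y]; rewrite /= exy. Qed.

Lemma gdistxx x : gdist e x x = 0.
Proof. by apply/eqP; rewrite -leqn0; apply: gdist_le; exists [::]. Qed.

Lemma gdist_eq0 x y : gdist e x y = 0 -> x = y.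
Proof. by have [s [_ sy ss]] := walk_gdist x y => d0; move: ss sy; rewrite d0; case: s. Qed.

Lemma gdist_eq1 x y : gdist e x y = 1 -> e x y.
Proof.
have [s [xs sy ss]] := walk_gdist x y => d1; move: ss sy xs; rewrite d1.
by case: s => [//|a [|//]] _ /= <-; rewrite andbT.
Qed.

Lemma gdist_leS x y z : e x y -> gdist e z y <= (gdist e z x).+1.
Proof.
by move=> exy; rewrite -addn1; exact: gdist_le (walk_cat (walk_gdist _ _) (walk_adj exy)).
Qed.

Lemma gdist_first_step x y : x != y ->
  exists z, e x z /\ (gdist e z y).+1 = gdist e x y.
Proof.
move=> xy; have [s [xs sy ss]] := walk_gdist x y.
case: s xs sy ss => [_ /= exy|z s /= /andP[exz zs] sy ss]; first by rewrite exy eqxx in xy.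
exists z; split => //; apply/eqP; rewrite eqn_leq -{1}ss ltnS; apply/andP; split.
  by apply: gdist_le; exists s.
by rewrite ![gdist e _ y]gdistC; apply: gdist_leS; rewrite e_sym.
Qed.

End GraphDistance.

Section MarkedTree.
Context {d : nat} {T : marked_tree d}.
Implicit Types x y z v : T.
Local Open Scope nat_scope.

Local Notation e := (adj T).

Definition lvl x := dist T (Defs.root T) x.

Lemma lvl_root : lvl (Defs.root T) = 0.
Proof. exact/gdistxx/adj_connected. Qed.

Lemma lvl_eq0 x : lvl x = 0 -> x = Defs.root T.
Proof. by move=> /gdist_eq0 ->//; exact: adj_connected. Qed.

Lemma adj_neq x y : e x y -> x != y.
Proof. by apply: contraTneq => ->; rewrite adj_irr. Qed.

Lemma lvl_adj_le x y : e x y -> lvl y <= (lvl x).+1.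
Proof. exact/gdist_leS/adj_connected. Qed.

(* Otherwise a loop-free version of the path would close up to a cycle
   through x. *)
Lemma path_through x y z s : e x y -> e x z -> y != z ->
  path e y s -> last y s = z -> x \in y :: s.
Proof.
move=> xy xz yz ys sz; apply/negPn/negP => xNs.
case/shortenP: ys sz => t yt ut ts tz.
have xNt : x \notin y :: t.
  apply: contraNN xNs; rewrite !inE => /predU1P[->|xt]; first by rewrite eqxx.
  by rewrite (ts _ xt) orbT.
have /(@adj_acyclic _ T) : ucycle e (x :: y :: t).
  rewrite /ucycle /= xNt /= -/(uniq (y :: t)) ut andbT xy /= rcons_path yt tz.
  by rewrite (@adj_sym _ T).
by case: t tz {yt ut ts xNt} => [/= yz'|//]; rewrite yz' eqxx in yz.
Qed.

(** Strict decrease keeps the path off every vertex at the level of [x] or above;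
    [lower_neighbor_unique] splices two such paths at the root. *)
Lemma path_down x : exists s, [/\ path e x s, last x s = Defs.root T
  & all (fun y => lvl y < lvl x) s].
Proof.
move hn : (lvl x) => n; elim: n x hn => [|n IH] x xn.
  by exists [::]; split => //; exact: lvl_eq0.
have xroot : x != Defs.root T by apply/eqP => xr; rewrite xr lvl_root in xn.
have [y [xy yx]] := gdist_first_step (@adj_sym _ T) (@adj_connected _ T) xroot.
have yn : lvl y = n.
  apply: succn_inj; rewrite -xn /lvl -[dist T _ x](gdistC (@adj_sym _ T) (@adj_connected _ T)).
  by rewrite -yx (gdistC (@adj_sym _ T) (@adj_connected _ T)).
have [s [ys sr sn]] := IH y yn.
exists (y :: s); split => //=; first by rewrite xy.
by rewrite yn ltnSn; apply: sub_all sn => z; rewrite -yn yn => /ltn_trans; apply.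
Qed.

(** The descending paths from [y] and [z], joined at the root, would avoid [x], against
    [path_through]. The inequalities are not strict, so that [adjP] can also exclude edges inside a
    level. *)
Lemma lower_neighbor_unique x y z : e x y -> e x z ->
  lvl y <= lvl x -> lvl z <= lvl x -> y = z.
Proof.
move=> xy xz yx zx; apply/eqP/negPn/negP => yz.
have [s [ys sr sl]] := path_down y; have [t [zt tr tl]] := path_down z.
have /walk_rev : walk e z (Defs.root T) (size t) by exists t.
move=> /(_ (@adj_sym _ T))[t' _].
pose u := rev (belast z t).
have ru : path e (Defs.root T) u.
  by rewrite -tr rev_path; under eq_path do rewrite (@adj_sym _ T).
have uz : last (Defs.root T) u = z.
  rewrite /u; case: (t) tr => //= a t0 _; by rewrite rev_cons last_rcons.
have /(path_through xy xz yz) : path e y (s ++ u) by rewrite cat_path ys sr.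
rewrite last_cat sr => /(_ uz).
rewrite -cat_cons mem_cat => /orP[|]; rewrite ?inE.
  move=> /predU1P[xe|/(allP sl)]; last by rewrite ltnNge yx.
  by move: xy; rewrite xe adj_irr.
rewrite mem_rev => /mem_belast; rewrite inE => /predU1P[xe|/(allP tl)].
  by move: xz; rewrite xe adj_irr.
by rewrite ltnNge zx.
Qed.

(** The default value makes the root its own parent, so [par] can be iterated past level 0. *)
Definition par x : T := xget x [set y | e x y /\ lvl y < lvl x].

Lemma par_root : par (Defs.root T) = Defs.root T.
Proof. by apply: xgetPN => y [_]; rewrite lvl_root. Qed.

Lemma parP x : 0 < lvl x -> e x (par x) /\ (lvl (par x)).+1 = lvl x.
Proof.
move=> x0.
have xroot : x != Defs.root T by apply: contraTneq x0 => ->; rewrite lvl_root.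
have [y [xy yx]] := gdist_first_step (@adj_sym _ T) (@adj_connected _ T) xroot.
have yx' : (lvl y).+1 = lvl x.
  by rewrite /lvl -![dist T (Defs.root T) _](gdistC (@adj_sym _ T) (@adj_connected _ T)).
have [xp px] : e x (par x) /\ lvl (par x) < lvl x.
  by apply: (@xgetPex T x [set y | e x y /\ lvl y < lvl x]); exists y; rewrite -yx'.
split => //; apply/eqP; rewrite eqn_leq px /=.
by apply: lvl_adj_le; rewrite (@adj_sym _ T).
Qed.

Lemma lvl_par x : lvl (par x) = (lvl x).-1.
Proof.
have [/lvl_eq0 ->|/parP[_ <-]//] := posnP (lvl x).
by rewrite par_root lvl_root.
Qed.

Lemma adj_par x : 0 < lvl x -> e x (par x).
Proof. by move=> /parP[]. Qed.

Lemma adjP x y : e x y ->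
  (par x = y /\ lvl x = (lvl y).+1) \/ (par y = x /\ lvl y = (lvl x).+1).
Proof.
move=> xy.
have yx : e y x by rewrite (@adj_sym _ T).
have one u v : e u v -> lvl v <= lvl u -> par u = v /\ lvl u = (lvl v).+1.
  move=> uv vu; have u0 : 0 < lvl u.
    rewrite lt0n; apply/eqP => u0; have /eqP := adj_neq uv; apply.
    have v0 : lvl v = 0 by lia.
    by rewrite (lvl_eq0 u0) (lvl_eq0 v0).
  have [up pu] := parP u0; have -> : v = par u.
    by apply: (lower_neighbor_unique uv up vu); rewrite -pu.
  by rewrite pu.
have [xley|/ltnW ylex] := leqP (lvl x) (lvl y); [right|left]; exact: one.
Qed.

(** The ancestor of [x] at level [k]; truncated subtraction makes it [x] itself when [k] is too
    large. *)
Definition anc k x := iter (lvl x - k) par x.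

Lemma lvl_iter_par k x : lvl (iter k par x) = lvl x - k.
Proof. by elim: k => [|k IH] /=; rewrite ?subn0// lvl_par IH; lia. Qed.

Lemma lvl_anc k x : k <= lvl x -> lvl (anc k x) = k.
Proof. by move=> kx; rewrite lvl_iter_par; lia. Qed.

Lemma anc_id k x : lvl x <= k -> anc k x = x.
Proof. by rewrite /anc -subn_eq0 => /eqP->. Qed.

Lemma anc_par k x : k < lvl x -> anc k (par x) = anc k x.
Proof.
by move=> kx; rewrite /anc lvl_par -iterSr; congr (iter _ par x); lia.
Qed.

Lemma anc_anc k l x : k <= l -> anc k (anc l x) = anc k x.
Proof.
move=> kl; have [xl|lx] := leqP (lvl x) l; first by rewrite (anc_id xl).
by rewrite {1}/anc lvl_anc 1?ltnW// -iterD; congr (iter _ par x); lia.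
Qed.

Lemma par_anc k x : k < lvl x -> par (anc k.+1 x) = anc k x.
Proof. by move=> kx; rewrite -iterS; congr (iter _ par x); lia. Qed.

Lemma anc0 x : anc 0 x = Defs.root T.
Proof. by apply: lvl_eq0; rewrite lvl_anc. Qed.

(** The Gromov product based at the root. It is handled through [le_cpl], equalities being obtained
    with [eq_by_le]. *)
Definition cpl x y :=
  \max_(k < (minn (lvl x) (lvl y)).+1 | anc k x == anc k y) k.

Lemma le_cpl k x y :
  (k <= cpl x y) = [&& k <= lvl x, k <= lvl y & anc k x == anc k y].
Proof.
apply/idP/idP => [kc|/and3P[kx ky kxy]]; last first.
  have kk : k < (minn (lvl x) (lvl y)).+1 by rewrite ltnS leq_min kx.
  exact: (@leq_bigmax_cond _ _ (fun i : 'I__ => val i) (Ordinal kk)).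
have [i ixy ci] : {i : 'I_(minn (lvl x) (lvl y)).+1 | anc i x == anc i y & cpl x y = i}.
  by apply: eq_bigmax_cond; apply/card_gt0P; exists ord0; apply/eqP; rewrite !anc0.
have := ltn_ord i; rewrite -ci ltnS leq_min => /andP[cx cy].
rewrite (leq_trans kc cx) (leq_trans kc cy)/=.
by rewrite -(anc_anc x kc) -(anc_anc y kc) ci (eqP ixy).
Qed.

Lemma cpl_le x y : cpl x y <= lvl x.
Proof. by have := leqnn (cpl x y); rewrite le_cpl => /and3P[]. Qed.

Lemma cpl_le2 x y : cpl x y <= lvl y.
Proof. by have := leqnn (cpl x y); rewrite le_cpl => /and3P[]. Qed.

Lemma eq_by_le m n : (forall k, (k <= m) = (k <= n)) -> m = n.
Proof. by move=> mn; apply/eqP; rewrite eqn_leq mn leqnn -mn leqnn. Qed.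

Lemma cplC x y : cpl x y = cpl y x.
Proof. by apply: eq_by_le => k; rewrite !le_cpl andbCA [anc k x == _]eq_sym. Qed.

Lemma cplxx x : cpl x x = lvl x.
Proof. by apply: eq_by_le => k; rewrite le_cpl eqxx andbT andbb. Qed.

Lemma cpl_child x z : 0 < lvl x -> cpl (par x) z <= cpl x z <= (cpl (par x) z).+1.
Proof.
move=> x0; apply/andP; split.
  have := leqnn (cpl (par x) z); rewrite {1}le_cpl lvl_par le_cpl.
  move=> /and3P[cx cz /eqP cc]; apply/and3P; split; [lia|lia|].
  by rewrite -cc anc_par//; lia.
case: (posnP (cpl x z)) => [->//|c0].
have := leqnn (cpl x z); rewrite {1}le_cpl => /and3P[cx cz /eqP cc].
rewrite -(prednK c0) ltnS le_cpl lvl_par; apply/and3P; split; [lia|lia|].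
have cl : (cpl x z).-1 <= cpl x z by lia.
rewrite anc_par; last lia.
by rewrite -(anc_anc x cl) -(anc_anc z cl) cc.
Qed.

(** For fixed [z], level minus twice [cpl] varies by at most one along an edge. Summed along a walk,
    this is the lower bound in [tree_dist]. *)
Lemma cpl_adj x y z : e x y ->
  lvl y + (cpl x z).*2 <= (lvl x + (cpl y z).*2).+1.
Proof.
move=> /adjP[[<- xy]|[<- yx]].
  by have x0 : 0 < lvl x by [lia]; have := cpl_child z x0; rewrite lvl_par; lia.
by have y0 : 0 < lvl y by [lia]; have := cpl_child z y0; rewrite lvl_par; lia.
Qed.

Lemma walk_anc k x : k <= lvl x -> walk e x (anc k x) (lvl x - k).
Proof.
rewrite /anc; have [n] := ubnP (lvl x - k); elim: n x => // n IH x; rewrite ltnS => xn kx.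
have [xk|xk] := posnP (lvl x - k); first by rewrite xk; exists [::].
have x0 : 0 < lvl x by lia.
have -> : lvl x - k = 1 + (lvl (par x) - k) by rewrite lvl_par; lia.
rewrite add1n iterSr -add1n; apply: walk_cat; first exact/walk_adj/adj_par.
by apply: IH; rewrite lvl_par; lia.
Qed.

Lemma tree_dist x y : dist T x y = lvl x + lvl y - (cpl x y).*2.
Proof.
have sym := @adj_sym _ T; have conn := @adj_connected _ T.
apply/eqP; rewrite eqn_leq; apply/andP; split.
  have := leqnn (cpl x y); rewrite le_cpl => /and3P[cx cy /eqP cc].
  apply: gdist_le => //.
  have -> : lvl x + lvl y - (cpl x y).*2 = (lvl x - cpl x y) + (lvl y - cpl x y).
    by lia.
  apply: walk_cat; first exact: walk_anc.
  by rewrite cc; apply: walk_rev => //; exact: walk_anc.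
have [s [xs sy <-]] := walk_gdist conn x y.
rewrite leq_subLR; move: (cpl_le2 x y).
elim: s x xs sy => [|z s IH] x /=; first by move=> _ -> _; rewrite cplxx; lia.
move=> /andP[xz zs] sy cxy; have := IH z zs sy (cpl_le2 _ _).
have zx : e z x by rewrite sym.
by have := cpl_adj y zx; lia.
Qed.

End MarkedTree.

Section Neighbors.
Context {d : nat} {T : marked_tree d}.
Implicit Types x y z v : T.
Local Open Scope nat_scope.

Definition nbrs x : seq T := finmap.enum_fset (fset_set [set y | adj T x y]).

Lemma finite_nbrs x : finite_set [set y | adj T x y].
Proof. by apply/finite_setP; exists d; exact: adj_regular. Qed.

Lemma mem_nbrs x y : (y \in nbrs x) = adj T x y.
Proof.
have h : _ = (y \in [set y | adj T x y]) := in_fset_set (finite_nbrs x) y.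
apply/idP/idP => [yx|xy].
  have /set_mem// : y \in [set z | adj T x z] by rewrite -h; exact: yx.
have : y \in [set z | adj T x z] by exact: mem_set.
by rewrite -h; apply.
Qed.

Lemma size_nbrs x : size (nbrs x) = d.
Proof. exact/card_fset_set/adj_regular. Qed.

Lemma uniq_nbrs x : uniq (nbrs x).
Proof. exact: finmap.fset_uniq. Qed.

Definition kids x := [seq y <- nbrs x | lvl x < lvl y].

Lemma uniq_kids x : uniq (kids x).
Proof. exact/filter_uniq/uniq_nbrs. Qed.

Lemma mem_kids x y : (y \in kids x) = (0 < lvl y) && (par y == x).
Proof.
rewrite mem_filter mem_nbrs; apply/andP/andP => [[xy /adjP[|]]|].
- by move=> [_ h]; rewrite h ltnNge leqnSn in xy.
- by move=> [-> ->].
move=> [y0 /eqP <-]; have [yp py] := parP y0.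
by rewrite (@adj_sym _ T) -{1}py.
Qed.

Lemma kid_par x y : y \in kids x -> par y = x.
Proof. by rewrite mem_kids => /andP[_ /eqP]. Qed.

Lemma lvl_kid x y : y \in kids x -> lvl y = (lvl x).+1.
Proof. by rewrite mem_kids => /andP[y0 /eqP <-]; rewrite lvl_par prednK. Qed.

Lemma size_kids x : size (kids x) = d - (0 < lvl x).
Proof.
have := count_predC (fun y => lvl x < lvl y) (nbrs x).
rewrite size_nbrs size_filter.
suff -> : count (predC (fun y => lvl x < lvl y)) (nbrs x) = (0 < lvl x) by lia.
rewrite -size_filter; have [x0|x0] := posnP (lvl x).
  apply/eqP; rewrite size_eq0 -(negbK (_ == _)) -has_filter; apply/hasPn => y.
  rewrite mem_nbrs /= negbK x0 => xy; rewrite lt0n; apply/eqP => y0.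
  by have := adj_neq xy; rewrite (lvl_eq0 x0) (lvl_eq0 y0) eqxx.
rewrite (@perm_size _ _ [:: par x])// uniq_perm// ?filter_uniq ?uniq_nbrs// => y.
rewrite mem_filter mem_nbrs mem_seq1 /= -leqNgt; apply/andP/eqP => [[yx xy]|->].
  apply: (lower_neighbor_unique xy (adj_par x0)) => //.
  by rewrite lvl_par leq_pred.
by rewrite adj_par// lvl_par leq_pred.
Qed.

Fixpoint sphere n : seq T :=
  if n is m.+1 then [seq y | x <- sphere m, y <- kids x] else [:: Defs.root T].

Lemma mem_sphere n x : (x \in sphere n) = (lvl x == n).
Proof.
elim: n x => [|n IH] x.
  by rewrite mem_seq1; apply/eqP/eqP => [->|/lvl_eq0//]; exact: lvl_root.
apply/allpairsPdep/eqP => [[y [z [yn zy ->]]]|xn].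
  by rewrite (lvl_kid zy); move: yn; rewrite IH => /eqP->.
exists (par x), x; split => //; first by rewrite IH lvl_par xn.
by rewrite mem_kids xn /=.
Qed.

Lemma uniq_sphere n : uniq (sphere n).
Proof.
elim: n => // n IH; apply: allpairs_uniq_dep => // [x _|]; first exact: uniq_kids.
move=> [x y] [x' y'] /allpairsPdep[a [b [_ ba [-> ->]]]]
  /allpairsPdep[a' [b' [_ ba' [-> ->]]]] /= bb'.
by rewrite -(kid_par ba) -(kid_par ba') bb'.
Qed.

Lemma size_sphereS n : size (sphere n.+1) = d * d.-1 ^ n.
Proof.
elim: n => [|n IH].
  by rewrite /= cats0 size_map size_kids lvl_root subn0 expn0 muln1.
rewrite [sphere _]/= size_allpairs_dep -/(sphere n.+1).
have -> : [seq size (kids x) | x <- sphere n.+1] = [seq d.-1 | x <- sphere n.+1].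
  apply/eq_in_map => x; rewrite mem_sphere => /eqP xn.
  by rewrite size_kids xn subn1.
by rewrite sumnE big_map big_const_seq count_predT iter_addn_0 IH mulnC expnS; lia.
Qed.

Lemma finite_ball n : finite_set [set x : T | lvl x <= n].
Proof.
apply: (@sub_finite_set _ _ (\bigcup_(k in `I_n.+1) [set` sphere k])).
  by move=> x xn; exists (lvl x) => //=; rewrite mem_sphere.
by apply: bigcup_finite => // k _; exact: finite_seq.
Qed.

Lemma countable_tree : countable [set: T].
Proof.
rewrite (_ : setT = \bigcup_k [set` sphere k]); last first.
  by apply/seteqP; split => // x _; exists (lvl x) => //=; rewrite mem_sphere.
by apply: bigcup_countable => // k _; exact/finite_set_countable/finite_seq.
Qed.

Definition in_cone v x := anc (lvl v) x == v.

Lemma in_cone_lvl v x : in_cone v x -> lvl v <= lvl x.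
Proof.
move=> /eqP vx; rewrite leqNgt; apply/negP => xv.
have xe : x = v by rewrite -vx anc_id// ltnW.
by rewrite xe ltnn in xv.
Qed.

Lemma in_conexx v : in_cone v v.
Proof. by rewrite /in_cone anc_id. Qed.

Lemma in_cone_anc k x : in_cone (anc k x) x.
Proof.
rewrite /in_cone; have [kx|xk] := leqP k (lvl x); first by rewrite lvl_anc.
by rewrite (anc_id (ltnW xk)) anc_id.
Qed.

Lemma in_cone_par v x : v != x -> 0 < lvl x -> in_cone v (par x) = in_cone v x.
Proof.
move=> vx x0; rewrite /in_cone.
have [/anc_par->//|] := ltnP (lvl v) (lvl x).
move=> xv; rewrite !anc_id// ?lvl_par; last by lia.
rewrite [RHS]eq_sym (negbTE vx); apply/eqP => pxv.
by move: xv; rewrite -pxv lvl_par; lia.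
Qed.

End Neighbors.

(** * Ends and Busemann functions *)

Section Rays.
Context {d : nat} {T : marked_tree d}.
Implicit Types (x y z v : T) (w : end_of T).
Local Open Scope nat_scope.

Lemma lvl_ray w n : lvl (w n) = n.
Proof. by have [w0 /(_ 0 n isT)] := rayP w; rewrite w0 subn0. Qed.

Lemma adj_ray w n : adj T (w n) (w n.+1).
Proof.
have [_ /(_ n n.+1 (leqnSn n))] := rayP w; rewrite subSnn.
by apply: gdist_eq1; exact: adj_connected.
Qed.

Lemma par_ray w n : par (w n.+1) = w n.
Proof. by have /adjP[[_]|[]//] := adj_ray w n; rewrite !lvl_ray; lia. Qed.

Lemma anc_ray w k n : k <= n -> anc k (w n) = w k.
Proof.
move=> kn; rewrite /anc lvl_ray.
elim: n kn => [|n IH]; first by rewrite leqn0 => /eqP->.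
rewrite leq_eqVlt => /predU1P[->|]; first by rewrite subnn.
by rewrite ltnS => kn; rewrite subSn// iterSr par_ray IH.
Qed.

(* the length of the common part of the ray w and the geodesic from the root to x *)
Definition coal w x := cpl (w (lvl x)) x.

Lemma le_coal w k x : (k <= coal w x) = (k <= lvl x) && (w k == anc k x).
Proof.
rewrite le_cpl lvl_ray andbA andbb; case: leqP => //= kx.
by rewrite anc_ray.
Qed.

Lemma coal_le w x : coal w x <= lvl x.
Proof. exact: cpl_le2. Qed.

Lemma ray_coal w x : w (coal w x) = anc (coal w x) x.
Proof. by have := leqnn (coal w x); rewrite le_coal => /andP[_ /eqP]. Qed.

Lemma cpl_ray w n x : lvl x <= n -> cpl (w n) x = coal w x.
Proof.
move=> xn; apply: eq_by_le => k; rewrite le_coal le_cpl lvl_ray.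
have [kx|] := leqP k (lvl x); last by rewrite andbF.
by rewrite (leq_trans kx xn) anc_ray// (leq_trans kx xn).
Qed.

Lemma coal_ray_self w n : coal w (w n) = n.
Proof. by rewrite /coal lvl_ray cplxx lvl_ray. Qed.

(** Integer form of the Busemann function, linked to the limit by [busemannE]; comparing
    horofunctions becomes integer arithmetic. *)
Definition buse w x : int := (lvl x)%:Z - (coal w x).*2%:Z.

Lemma buse_ge w x : (- (lvl x)%:Z <= buse w x)%R.
Proof. by rewrite /buse; have := coal_le w x; lia. Qed.

Lemma buse_ray w n : buse w (w n) = (- n%:Z)%R.
Proof. by rewrite /buse lvl_ray coal_ray_self; lia. Qed.

Lemma coal_child w y : 0 < lvl y ->
  coal w y = if w (lvl y) == y then lvl y else coal w (par y).
Proof.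
move=> y0; case: ifP => wy.
  by apply: eq_by_le => k; rewrite le_coal; case: leqP => //= ky;
    rewrite -[in anc _ _](eqP wy) anc_ray// eqxx.
apply: eq_by_le => k; rewrite !le_coal lvl_par.
have [ky|yk|->] := ltngtP k (lvl y).
- by rewrite anc_par//; have -> : k <= (lvl y).-1 by lia.
- by have -> : (k <= (lvl y).-1) = false by lia.
- by rewrite anc_id// wy; have -> : (lvl y <= (lvl y).-1) = false by lia.
Qed.

Lemma coal_par_ray w y : 0 < lvl y -> w (lvl y) = y -> coal w (par y) = (lvl y).-1.
Proof.
move=> y0 wy; rewrite -{1}wy -(prednK y0) par_ray coal_ray_self prednK//.
Qed.

Lemma buse_child w y : 0 < lvl y ->
  buse w y = (buse w (par y) + (if w (lvl y) == y then -1 else 1))%R.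
Proof.
move=> y0; rewrite /buse coal_child//; case: eqP => [wy|_]; last by rewrite lvl_par; lia.
by rewrite coal_par_ray// lvl_par; lia.
Qed.

Lemma buse_adj w x y : adj T x y ->
  buse w y = (buse w x + 1)%R \/ buse w y = (buse w x - 1)%R.
Proof.
move=> /adjP[[<- xy]|[<- yx]].
  by rewrite (@buse_child w x); [case: ifP => _; lia|lia].
by rewrite (@buse_child w y); [case: ifP => _; lia|lia].
Qed.

Lemma buse_dist w x y : (buse w y <= buse w x + (dist T x y)%:Z)%R.
Proof.
have [s [xs <- <-]] := walk_gdist (@adj_connected _ T) x y.
elim: s x xs => [|z s IH] x /=; first by rewrite addr0.
by move=> /andP[xz /IH]; have := buse_adj w xz; lia.
Qed.

Lemma adj_toward w x : exists y, adj T x y /\ buse w y = (buse w x - 1)%R.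
Proof.
have [xw|xw] := eqVneq (w (lvl x)) x.
  exists (w (lvl x).+1); split; first by rewrite -{1}xw adj_ray.
  by rewrite buse_ray -[in RHS]xw buse_ray; lia.
have x0 : 0 < lvl x.
  rewrite lt0n; apply/eqP => x0; move: xw; rewrite x0 (lvl_eq0 x0).
  by rewrite (@lvl_eq0 _ _ (w 0)) ?lvl_ray// eqxx.
by exists (par x); rewrite adj_par// (buse_child w x0) (negbTE xw); split => //; lia.
Qed.

Lemma coal_min w w' c x : w c.+1 <> w' c.+1 ->
  coal w x <= c \/ coal w' x <= c.
Proof.
move=> ww'; case: (leqP (coal w x) c) => [|cw]; first by left.
case: (leqP (coal w' x) c) => [|cw']; first by right.
move: cw cw'; rewrite !le_coal => /andP[_ /eqP wx] /andP[_ /eqP wx'].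
by rewrite wx wx' in ww'.
Qed.

Lemma ray_neq_le w w' m n : w m <> w' m -> m <= n -> w n <> w' n.
Proof.
by move=> ww' mn wn; apply: ww'; rewrite -(anc_ray w mn) -(anc_ray w' mn) wn.
Qed.

Lemma coal_lt w n x : w n <> anc n x -> coal w x < n \/ lvl x < n.
Proof.
move=> wn; case: (ltnP (lvl x) n); [by right|left].
by rewrite ltnNge le_coal; apply/negP => /andP[_ /eqP].
Qed.

End Rays.

Section Busemann.
Context {d : nat} {T : marked_tree d}.
Implicit Types (x y z v : T) (w : end_of T).

Lemma end_nbhs_cone w n x :
  dist T (Defs.root T) x = (dist T (Defs.root T) (w n) + dist T (w n) x)%N ->
  (n <= lvl x)%N /\ anc n x = w n.
Proof.
rewrite -!/(lvl _) tree_dist lvl_ray => h.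
have c1 := cpl_le (w n) x; have c2 := cpl_le2 (w n) x.
have : (n <= cpl (w n) x)%N by rewrite lvl_ray in c1; lia.
rewrite le_cpl anc_ray// => /and3P[_ nx /eqP wn]; by split.
Qed.

Lemma cone_end_nbhs w n x : (n <= lvl x)%N -> anc n x = w n ->
  dist T (Defs.root T) x = (dist T (Defs.root T) (w n) + dist T (w n) x)%N.
Proof.
move=> nx wn; rewrite -!/(lvl _) tree_dist lvl_ray.
suff -> : cpl (w n) x = n by lia.
apply/eqP; rewrite eqn_leq -{2}(lvl_ray w n) cpl_le le_cpl lvl_ray nx leqnn/=.
by rewrite anc_ray// wn.
Qed.

#[local] Instance end_nbhs_proper w : ProperFilter (end_nbhs w).
Proof.
apply: filter_from_proper; last first.
  by move=> n _; exists (w n); apply: cone_end_nbhs; rewrite ?lvl_ray ?anc_ray.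
apply: filter_from_filter; first by exists 0%N.
move=> i j _ _; exists (maxn i j) => // x /= /end_nbhs_cone[ijx wij].
have anck k : (k <= maxn i j)%N -> anc k x = w k.
  by move=> kij; rewrite -(anc_anc x kij) wij anc_ray.
by split; apply: cone_end_nbhs; rewrite ?anck ?leq_maxl ?leq_maxr//;
  apply: leq_trans ijx; rewrite ?leq_maxl ?leq_maxr.
Qed.

Lemma busemannE (R : realType) w y : busemann R w y = (buse w y)%:~R.
Proof.
(* The difference of distances is constant once the geodesic from the root to [x] passes through
   [w (lvl y)]: it then shares with [y] exactly what the ray shares. *)
apply: lim_near_cst => //; exists (lvl y) => // x /= /end_nbhs_cone[yx wy].
rewrite -/(lvl x) tree_dist.
have -> : cpl y x = coal w y.
  apply: eq_by_le => k; rewrite le_cpl le_coal; case: leqP => //= ky.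
  by rewrite (leq_trans ky yx)/= -(anc_anc x ky) wy anc_ray// eq_sym.
have := coal_le w y; rewrite /buse => cy.
have -> : ((lvl y + lvl x - (coal w y).*2)%N)%:R
    = (((lvl y + lvl x)%N)%:Z - (coal w y).*2%:Z)%:~R :> R.
  by rewrite -[LHS]mulrz_nat; congr (_%:~R); lia.
by rewrite -[X in _ - X]mulrz_nat -intrB; congr (_%:~R); lia.
Qed.

(** The meet of [x] and the root is where the geodesic from the root to [x] leaves the base ray, so
    the two distances in [height] are |x| - c and c. *)
Lemma height_buse x : height x = buse base_end x.
Proof.
rewrite /height.
set c := coal base_end x; pose o := @base_end d T c.
have oE : o = base_end c by [].
clearbody o.
have ancx : anc c x = o by rewrite oE -ray_coal.
have oc : lvl o = c by rewrite oE lvl_ray.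
have co : coal base_end o = c by rewrite oE coal_ray_self.
have cx : (c <= lvl x)%N := coal_le _ _.
have geod z n : (lvl z <= n)%N -> dist T z (@base_end d T n) = (lvl z + n - (coal base_end z).*2)%N.
  by move=> zn; rewrite tree_dist lvl_ray cplC cpl_ray.
have xo : cpl x o = c.
  apply: eq_by_le => k; rewrite le_cpl oc; case: (leqP k c) => kc; last by rewrite andbF.
  by rewrite (leq_trans kc cx)/= -ancx anc_anc// eqxx.
have cplr z : cpl z (Defs.root T) = 0%N.
  by have := cpl_le2 z (Defs.root T); rewrite lvl_root; lia.
have cplr' z : cpl (Defs.root T) z = 0%N by rewrite cplC.
have -> : meet x (Defs.root T) = o.
  apply: xget_unique => [|z [zx zbx zbr]].
    split.
    - by rewrite /on_geodesic !tree_dist xo lvl_root cplr oc; rewrite cplr; lia.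
    - exists (maxn (lvl x) c) => // n /=; rewrite geq_max => /andP[xn cn].
      rewrite /on_geodesic !geod// ?oc//; rewrite tree_dist xo oc.
      by rewrite co -/c; lia.
    - exists c => // n /= cn.
      rewrite /on_geodesic !geod ?oc// ?lvl_root// tree_dist cplr' lvl_root oc co.
      by have := coal_le base_end (Defs.root T); rewrite lvl_root; lia.
  have [n1 _ n1P] := zbx; have [n2 _ n2P] := zbr.
  (* The ray conditions hold only eventually. At a level beyond [x] and [z] the distances are
     explicit and force [z] onto the base ray at level [c]. *)
  pose n := maxn (maxn n1 n2) (maxn (lvl x) (lvl z)).
  have /n1P : (n1 <= n)%N by rewrite /n; lia.
  have /n2P : (n2 <= n)%N by rewrite /n; lia.
  have xn : (lvl x <= n)%N by rewrite /n; lia.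
  have zn : (lvl z <= n)%N by rewrite /n; lia.
  move: zx; rewrite /on_geodesic !geod// ?lvl_root// !tree_dist lvl_root !cplr !cplr' -/c.
  have := coal_le base_end (Defs.root T); rewrite lvl_root.
  have := coal_le base_end z; have := cpl_le x z; have := cpl_le2 x z => h1 h2 h3 h4 h5 h6 h7.
  have zc : coal base_end z = lvl z by lia.
  have := ray_coal base_end z; rewrite zc anc_id// => <-; rewrite oE; congr (base_end _).
  by lia.
rewrite !tree_dist xo lvl_root cplr' oc /buse -/c; lia.
Qed.

End Busemann.

(** * Cells of generic delayed horofunctions *)

Section InfiniteSets.

Lemma finite_set_nat_bound (A : set nat) : finite_set A ->
  exists N, forall k, A k -> (k <= N)%N.
Proof.
move=> fA; exists (\max_(k <- finmap.enum_fset (fset_set A)) k)%N => k Ak.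
apply: (@leq_bigmax_seq _ _ xpredT id) => //.
by have := mem_set Ak; rewrite -(in_fset_set fA).
Qed.

Lemma eventually_finite {I : Type} (A : set I) (Q : I -> nat -> Prop) :
  finite_set A ->
  (forall k, A k -> exists N, forall n, (N <= n)%N -> Q k n) ->
  exists N, forall n, (N <= n)%N -> forall k, A k -> Q k n.
Proof.
move=> fA AQ; pose f k := xget 0%N [set N | forall n, (N <= n)%N -> Q k n].
have [N NP] := finite_set_nat_bound (finite_image f fA).
exists N => n Nn k Ak; apply: (xgetPex 0%N (AQ k Ak)).
by apply: leq_trans Nn; apply: NP; exists k.
Qed.

(** [Q] attaches at most one number to an element, such as a delay or the level where a ray branches
    off. A finite set would bound these numbers. *)
Lemma unbounded_infinite {I : Type} (A : set I) (Q : I -> nat -> Prop) :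
  (forall j m n, Q j m -> Q j n -> m = n) ->
  (forall n0, exists n, (n0 <= n)%N /\ exists j, A j /\ Q j n) ->
  infinite_set A.
Proof.
move=> Quniq Qunb fA.
pose f j := xget 0%N [set n | Q j n].
have [N NP] := finite_set_nat_bound (finite_image f fA).
have [n [Nn [j [Aj Qj]]]] := Qunb N.+1.
have /Quniq/(_ Qj) fn : Q j (f j).
  by apply: (@xgetPex _ 0%N [set k | Q j k]); exists n.
have : (f j <= N)%N by apply: NP; exists j.
by rewrite fn leqNgt Nn.
Qed.

Lemma infinite_image_inj {U V : Type} (f : U -> V) (g : V -> U) (A : set U) :
  cancel f g -> infinite_set A -> infinite_set (f @` A).
Proof.
move=> fK iA fA; apply: iA.
have -> : A = g @` (f @` A).
  apply/seteqP; split => [x Ax|_ [_ [y Ay <-] <-]]; last by rewrite fK.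
  by exists (f x); [exists x|rewrite fK].
exact: finite_image.
Qed.

Lemma infinite_superset {U : Type} (A B : set U) :
  A `<=` B -> infinite_set A -> infinite_set B.
Proof. by move=> AB iA /(sub_finite_set AB). Qed.

End InfiniteSets.

Section Branching.
Context {p : nat} {T : marked_tree p.+1}.
Implicit Types (x y z v : T) (w : end_of T).

(** Distinct ends share a bounded segment, so every vertex leaves one of the two rays early. Applied
    to a nucleus and the base end, this is what turns opposite heights into linear growth. *)
Lemma buse_ge_min w w' : (exists n, w n <> w' n) ->
  exists c : nat, forall x, (lvl x)%:Z - c%:Z <= buse w x \/ (lvl x)%:Z - c%:Z <= buse w' x.
Proof.
move=> [n wn]; exists n.*2 => y.
have /(coal_min y) := ray_neq_le wn (leqnSn n).
by rewrite /buse; lia.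
Qed.

Hypothesis p_ge2 : (2 <= p)%N.

Lemma kid_off x z : exists y, [/\ par y = x, lvl y = (lvl x).+1 & y != z].
Proof.
have : (1 < size (kids x))%N by rewrite size_kids; case: (0 < lvl x)%N; lia.
have := @uniq_kids _ _ x; have := @kid_par _ _ x; have := @lvl_kid _ _ x.
case: (kids x) => [//|a [//|b s]] kl kp /= /andP[ab _] _.
have ina : a \in [:: a, b & s] by rewrite inE eqxx.
have inb : b \in [:: a, b & s] by rewrite !inE eqxx orbT.
have [az|az] := eqVneq a z; last by exists a; rewrite kp// kl.
exists b; rewrite kp// kl//; split => //; rewrite -az eq_sym.
by apply: contraNN ab => /eqP->; rewrite inE eqxx.
Qed.

Lemma descendant v l : (lvl v <= l)%N -> exists x, lvl x = l /\ in_cone v x.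
Proof.
elim: l => [|l IH].
  by rewrite leqn0 => /eqP v0; exists v; split => //; exact: in_conexx.
rewrite leq_eqVlt => /predU1P[vl|]; first by exists v; split => //; exact: in_conexx.
rewrite ltnS => /IH[x [xl vx]]; have [y [yx ly _]] := kid_off x x.
exists y; rewrite ly xl; split => //.
rewrite -in_cone_par ?yx//; last by rewrite ly.
apply/negP => /eqP vy; have := in_cone_lvl vx; rewrite vy ly; lia.
Qed.

Lemma adj_away w x : exists y, adj T x y /\ buse w y = buse w x + 1.
Proof.
have [y [yx ly yw]] := kid_off x (w (lvl x).+1).
exists y; rewrite buse_child ly// yx eq_sym (negbTE yw); split => //.
by rewrite (@adj_sym _ T) -yx adj_par// ly.
Qed.

(** The first vertex of a side branch at [x], when [z] is the next vertex of a ray. *)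
Definition off x z : T := xget x [set y | [/\ par y = x, lvl y = (lvl x).+1 & y != z]].

Lemma offP x z : [/\ par (off x z) = x, lvl (off x z) = (lvl x).+1 & off x z != z].
Proof.
exact: (@xgetPex _ x [set y | [/\ par y = x, lvl y = (lvl x).+1 & y != z]] (kid_off x z)).
Qed.

(** A vertex leaving the base ray at level n has height |v| - 2n, so height m forces |v| = m + 2n;
    the hypothesis says that this exceeds n. The branch is recorded because branches for different n
    are disjoint. *)
Lemma horosphere_vertex (m : int) n : m + n%:Z > 0 -> exists v,
  [/\ coal base_end v = n, (n < lvl v)%N, (lvl v)%:Z = m + n%:Z + n%:Z
    & in_cone (off (base_end n) (base_end n.+1)) v].
Proof.
move=> mn; set b := off _ _; have [pb lb bn] := offP (base_end n) (base_end n.+1).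
rewrite lvl_ray in lb.
have [|v [lv bv]] := @descendant b (absz (m + n%:Z + n%:Z)); first by rewrite lb; lia.
have ancv l : (l <= n)%N -> anc l v = base_end l.
  move=> ln; have lb' : (l <= lvl b)%N by rewrite lb ltnW.
  by rewrite -(anc_anc v lb') (eqP bv) -anc_par ?lb// pb anc_ray.
have nv : (n < lvl v)%N by rewrite lv; lia.
exists v; split => //; last by rewrite lv; lia.
apply: eq_by_le => l; rewrite le_coal; have [ln|nl] := leqP l n.
  by rewrite ancv// eqxx andbT; apply: leq_trans ln (ltnW nv).
apply/negbTE/negP => /andP[lv' /eqP bl].
move/negP: bn; apply; apply/eqP.
by rewrite -/b -(eqP bv) lb -(anc_ray base_end nl) bl anc_anc.
Qed.

End Branching.

Section OneTree.
Context {p : nat} {T : marked_tree p.+1}.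
Context (S : set nat) (w : nat -> end_of T) (D : nat -> int).
Implicit Types (x y z v : T).

Definition delayed i x : int := D i + buse (w i) x.
Local Notation g := delayed.

Definition tree_cell i : set T := [set x | forall j, S j -> g i x <= g j x].

(* The almost sure properties of the points (w i, D i), i in S, of a Poisson
   process that the tessellation is deduced from. *)
Record generic_points : Prop := GenericPoints {
  generic_finite : forall K : int, finite_set [set i | S i /\ D i <= K] ;
  generic_base : forall i, S i -> exists n, w i n <> base_end n ;
  generic_separated : forall i k, S i -> S k -> D i <> D k ->
    exists n, w i n <> w k n ;
  generic_dense : forall B : int, exists L : nat, forall v, (L <= lvl v)%N ->
    exists j, [/\ S j, w j (lvl v) = v & D j = (lvl v).*2%:Z - B] ;
  generic_parity : forall i, S i -> forall n0 : nat, exists n y j,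
    [/\ (n0 <= n)%N, par y = w i n, lvl y = n.+1 & y <> w i n.+1] /\
    [/\ S j, w j n.+1 = y, exists s : int, D j = D i + s + s
      & forall k, S k -> w k n.+1 = y -> D j <= D k] }.

(** Only the points behind [anc n.+1 v] are constrained: this makes the events for different n
    independent. The other points are treated deterministically in [horosphere_cells]. *)
Definition horosphere_dense : Prop := forall (m k : int) (n0 : nat),
  exists n v j,
    [/\ (n0 <= n)%N, coal base_end v = n, (n < lvl v)%N & buse base_end v = m] /\
    [/\ S j, w j (lvl v) = v, D j = (lvl v)%:Z + k
      & forall i, S i -> w i n.+1 = anc n.+1 v -> k <= g i v].

Hypothesis gen : generic_points.

Lemma finite_below x (K : int) : finite_set [set i | S i /\ g i x <= K].
Proof.
apply: sub_finite_set (generic_finite gen (K + (lvl x)%:Z)) => i [Si].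
by rewrite /delayed; have := buse_ge (w i) x; split => //; lia.
Qed.

Lemma delayed_ge i x : D i - (lvl x)%:Z <= g i x.
Proof. by rewrite /delayed; have := buse_ge (w i) x; lia. Qed.

Lemma delayed_adj i x y : adj T x y -> g i y <= g i x + 1.
Proof. by rewrite /delayed => /(buse_adj (w i)); lia. Qed.

Lemma delayed_adj_ge i x y : adj T x y -> g i x - 1 <= g i y.
Proof. by rewrite /delayed => /(buse_adj (w i)); lia. Qed.

(** A step towards the nucleus lowers its own horofunction by one and every other one by at most
    one. This is how common vertices will produce adjacent pairs. *)
Lemma tree_cell_toward i x : tree_cell i x ->
  exists y, [/\ adj T x y, tree_cell i y & g i y = g i x - 1].
Proof.
move=> ix; have [y [xy wy]] := adj_toward (w i) x.
have gy : g i y = g i x - 1 by rewrite /delayed wy; lia.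
exists y; split => // j Sj; rewrite gy.
by have := ix j Sj; have := delayed_adj_ge j xy; lia.
Qed.

(** Finitely many points have a smaller delay, and each leaves the ray of [i]. From there on its
    horofunction increases along this ray while that of [i] decreases, which makes up for the
    smaller delay. *)
Lemma separated_eventually i : S i -> exists N, forall n, (N <= n)%N ->
  forall k, [set k | S k /\ D k < D i] k ->
    w k n <> w i n /\ D i - n%:Z <= g k (w i n).
Proof.
move=> Si; apply: eventually_finite.
  by apply: sub_finite_set (generic_finite gen (D i)) => k /= [Sk kD]; split => //; exact: ltW.
move=> k [Sk kD].
have [m wm] : exists n, w k n <> w i n.
  apply: (generic_separated gen Sk Si). lia.
exists (m + `|D i - D k|)%N => n mn.
have wn : w k n <> w i n by apply: ray_neq_le wm _; lia.
split => //; rewrite /delayed /buse lvl_ray.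
have /(coal_lt (x := w i n)) : w k m <> anc m (w i n).
  by rewrite anc_ray//; lia.
by rewrite lvl_ray; lia.
Qed.

Lemma ray_in_tree_cell i : S i ->
  exists N, forall n, (N <= n)%N -> tree_cell i (w i n).
Proof.
move=> Si; have [N NP] := separated_eventually Si.
exists N => n Nn k Sk; rewrite {1}/delayed buse_ray.
have [kD|kD] := ltP (D k) (D i); first by have [|_] := NP n Nn k.
by have := delayed_ge k (w i n); rewrite lvl_ray; lia.
Qed.

Lemma infinite_meeting i : S i ->
  infinite_set [set j | [/\ S j, j <> i & exists x, tree_cell i x /\ tree_cell j x]].
Proof.
move=> Si.
(* The number attached to [j] is the level at which its ray leaves that of [i]. *)
apply: (@unbounded_infinite _ _ (fun j n => w j n = w i n /\ w j n.+1 <> w i n.+1)).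
  move=> j m n [wm wm'] [wn wn']; have [mn|nm|//] := ltngtP m n; exfalso.
    by apply: wm'; rewrite -(anc_ray (w j) mn) -(anc_ray (w i) mn) wn.
  by apply: wn'; rewrite -(anc_ray (w j) nm) -(anc_ray (w i) nm) wm.
move=> n0; have [N1 N1P] := separated_eventually Si.
have [N2 N2P] := ray_in_tree_cell Si.
have [n [y [j [[nn yn ly ywi] [Sj wjy [s Ds] jmin]]]]] :=
  generic_parity gen Si (maxn n0 (maxn N1 N2)).
have wjn : w j n = w i n by rewrite -par_ray wjy.
exists n; split; first by lia.
exists j; split; last by split => //; rewrite wjy.
(* Beyond [N1] all points of smaller delay have left the ray of [i], but [j] is still on it at level
   [n]. *)
have Dij : D i <= D j.
  rewrite leNgt; apply/negP => Dji.
  have N1n : (N1 <= n)%N by lia.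
  by have [] := N1P n N1n j (conj Sj Dji).
split => //; first by move=> ji; apply: ywi; rewrite -wjy ji.
(* On the branch of j the horofunction of i increases and that of j decreases,
   and they meet halfway; the points outside this branch are beaten by i, the
   others by j since its delay is minimal. *)
pose l := (n + `|s|)%N; exists (w j l).
(* At level l of the branch the values are D i + l - 2n and D j - l. They agree at a vertex only if
   D j - D i is even, whence the parity condition. *)
have lE : l%:Z = n%:Z + s by move: Dij; rewrite Ds /l; lia.
have gj : g j (w j l) = D i - n%:Z + s by rewrite /delayed buse_ray /l; lia.
have ci : coal (w i) (w j l) = n.
  apply: eq_by_le => k; rewrite le_coal lvl_ray.
  have [kn|nk] := leqP k n.
    by rewrite anc_ray /l; [rewrite -(anc_ray (w i) kn) -(anc_ray (w j) kn) wjn eqxx|]; lia.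
  case: (leqP k l) => //= kl; apply/negbTE/eqP; rewrite anc_ray// => wk.
  by apply: ywi; rewrite -wjy -(anc_ray (w j) nk) -(anc_ray (w i) nk) wk.
have gi : g i (w j l) = D i - n%:Z + s by rewrite /delayed /buse ci lvl_ray /l; lia.
suff ge k : S k -> D i - n%:Z + s <= g k (w j l).
  by split => k /ge; [rewrite gi|rewrite gj].
move=> Sk; have [wk|wk] := pselect (w k n.+1 = y).
  have := jmin k Sk wk; have := delayed_ge k (w j l); rewrite lvl_ray.
  move: (g k _) => G. rewrite lE Ds; lia.
have ck : (coal (w k) (w j l) <= n)%N.
  have [l0|l0] := leqP l n; first by apply: leq_trans (coal_le _ _) _; rewrite lvl_ray.
  have /coal_lt : w k n.+1 <> anc n.+1 (w j l) by rewrite anc_ray// wjy.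
  by rewrite lvl_ray; lia.
have ckn : (coal (w k) (w j l) <= coal (w k) (w i n))%N.
  rewrite le_coal lvl_ray ck /= anc_ray// ray_coal anc_ray ?(leq_trans ck (leq_addr _ _))//.
  by rewrite -(anc_ray (w j) ck) -(anc_ray (w i) ck) wjn eqxx.
have N2n : (N2 <= n)%N by lia.
have := N2P n N2n k Sk; rewrite /delayed buse_ray /buse !lvl_ray; lia.
Qed.

(* All delayed horofunctions are 1-Lipschitz and that of i increases at unit
   speed beyond x, so a cell reaching beyond x as seen from its nucleus
   contains x. *)
Lemma tree_cell_separation i j x y :
  ~ tree_cell i x -> ~ tree_cell j x ->
  par y = x -> lvl y = (lvl x).+1 -> w i (lvl y) <> y -> w j (lvl y) = y ->
  (forall v, ~ (tree_cell i v /\ tree_cell j v)) /\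
  (forall u v, tree_cell i u -> tree_cell j v -> ~ adj T u v).
Proof.
move=> ix jx yx ly wi wj.
have out k v : g k v <= g k x + (dist T x v)%:Z.
  by rewrite /delayed; have := buse_dist (w k) x v; lia.
have far k v : ~ tree_cell k x -> g k v = g k x + (dist T x v)%:Z -> ~ tree_cell k v.
  move=> kx gv kv; apply: kx => m Sm.
  by have := kv m Sm; have := out m v; rewrite gv; lia.
have yv_i v : in_cone y v -> ~ tree_cell i v.
  move=> yv; apply: far => //; have lv := in_cone_lvl yv.
  have av k : (k <= lvl x)%N -> anc k v = anc k x.
    move=> kx; have ky : (k <= lvl y)%N by lia.
    by rewrite -(anc_anc v ky) (eqP yv) -yx anc_par//; lia.
  rewrite /delayed /buse tree_dist.
  have -> : cpl x v = lvl x.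
    by apply: eq_by_le => k; rewrite le_cpl; case: leqP => //= kx; rewrite av// eqxx andbT; lia.
  suff -> : coal (w i) v = coal (w i) x by lia.
  apply: eq_by_le => k; rewrite !le_coal.
  have [kx|xk] := leqP k (lvl x); first by rewrite av// (_ : (k <= lvl v)%N = true)//; lia.
  apply/negbTE/negP => /andP[kv /eqP wk]; apply: wi.
  have yk : (lvl y <= k)%N by lia.
  by rewrite -(anc_ray (w i) yk) wk anc_anc// (eqP yv).
have yv_j v : ~ in_cone y v -> ~ tree_cell j v.
  move=> yv; apply: far => //.
  have wx : w j (lvl x) = x by rewrite -par_ray -ly wj yx.
  rewrite /delayed /buse tree_dist.
  have -> : coal (w j) x = lvl x.
    by rewrite -{1}wx coal_ray_self.
  suff -> : coal (w j) v = cpl x v.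
    by have := cpl_le x v; have := cpl_le2 x v; lia.
  apply: eq_by_le => k; rewrite le_coal le_cpl.
  have [kx|xk] := leqP k (lvl x); first by rewrite -[in anc k x]wx anc_ray.
  apply/negbTE/negP => /andP[kv /eqP wk]; apply: yv.
  have yk : (lvl y <= k)%N by lia.
  by rewrite /in_cone -(anc_anc v yk) -wk anc_ray// wj.
split=> [v [iv jv]|u v iu jv uv].
  by have [yv|yv] := boolP (in_cone y v); [exact: (yv_i v)|apply: (yv_j v) => //; exact/negP].
have yu : ~ in_cone y u by move=> /yv_i.
have yv : in_cone y v by apply/negPn/negP => /negP/yv_j.
have [yv'|vy] := eqVneq y v.
  have [[uv' lu]|[vu lv]] := adjP uv.
    apply: yu; rewrite -in_cone_par ?uv' -?yv' ?in_conexx//; last by rewrite lu.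
    by apply/eqP => yu'; move: lu; rewrite -yv' yu'; lia.
  by apply: ix; rewrite -yx yv' vu.
have [[uv' lu]|[vu lv]] := adjP uv; apply: yu.
  rewrite -in_cone_par ?uv'//; last by rewrite lu.
  apply/eqP => yu'; have := in_cone_lvl yv; rewrite yu'; lia.
by rewrite -vu in_cone_par//; lia.
Qed.

(** Three kinds of points are compared with k at [v]: those behind [anc n.+1 v], by hypothesis; the
    finitely many with delay at most k - m, which leave the base ray early and so are large at [v]
    for large n; all others, whose ray shares with [v] no more than the base ray does, so that their
    value exceeds (k - m) + m. *)
Lemma horosphere_cells : horosphere_dense -> forall (m k : int) n0,
  exists n v j, [/\ (n0 <= n)%N, w j n = base_end n & w j n.+1 <> base_end n.+1] /\
    [/\ coal base_end v = n, buse base_end v = m, S j, g j v = k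
      & forall i, S i -> k <= g i v].
Proof.
move=> hd m k n0.
have : finite_set [set i | S i /\ D i <= k - m] by exact: generic_finite gen _.
move=> /(@eventually_finite _ _ (fun i n => forall v, coal base_end v = n ->
  buse base_end v = m -> k <= g i v)).
case=> [i [Si _]|N NP].
  have [c wc] := generic_base gen Si.
  exists (c.+1 + `|D i| + `|k| + `|m|)%N => n cn v vn vm.
  have /(coal_min v) := ray_neq_le wc (leqnSn c).
  by move: vm; rewrite /delayed /buse vn; lia.
have [n [v [j [[nn vn nv vm] [Sj wj Dj jmin]]]]] := hd m k (maxn n0 N).
exists n, v, j; split.
  split; first by lia.
    by rewrite -(anc_ray (w j) (ltnW nv)) wj -vn ray_coal.
  rewrite -(anc_ray (w j) nv) wj => vb.
  suff : (n < coal base_end v)%N by rewrite vn ltnn.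
  by rewrite le_coal nv vb eqxx.
split => // [|i Si]; first by rewrite /delayed Dj -{2}wj buse_ray; lia.
have [wi|wi] := pselect (w i n.+1 = anc n.+1 v); first exact: jmin.
have [Di|Di] := leP (D i) (k - m).
  by apply: (NP n) => //; lia.
have /coal_lt := wi; move: vm; rewrite /delayed /buse vn; lia.
Qed.

Hypothesis p_ge2 : (2 <= p)%N.

Lemma dense_unbounded v (K : int) : exists j, [/\ S j, w j (lvl v) = v & K <= D j].
Proof.
have [L LP] := generic_dense gen 0.
have [|x [xl vx]] := @descendant _ _ p_ge2 v (lvl v + L + `|K|)%N; first by lia.
have [|j [Sj wj Dj]] := LP x; first by lia.
exists j; split => //; last by lia.
by rewrite -(anc_ray (w j) (in_cone_lvl vx)) wj (eqP vx).
Qed.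

Lemma tree_cell_proper i : S i -> exists x, ~ tree_cell i x.
Proof.
move=> Si; have [y [yr ly wy]] := kid_off p_ge2 (Defs.root T) (w i 1%N).
rewrite lvl_root in ly.
(* At [x], in a branch at the root that avoids the ray of [i], the value of [i] is D i + |x|, while
   this constant provides [j] with the smaller value |x| - |D i| - 1. *)
have [L LP] := generic_dense gen (`|D i|%:Z + 1).
have [|x [xl yx]] := @descendant _ _ p_ge2 y L.+1; first by lia.
have [|j [Sj wj Dj]] := LP x; first by lia.
exists x => /(_ j Sj); rewrite /delayed Dj.
have -> : buse (w j) x = - (lvl x)%:Z by rewrite -{1}wj buse_ray.
have /coal_lt : w i 1%N <> anc 1%N x.
  by move=> wx; move: yx wy; rewrite /in_cone ly wx => /eqP ->; rewrite eqxx.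
by rewrite /buse; lia.
Qed.

(** The separating vertex [x] is chosen once, outside the cell of [i]. Infinitely many nuclei lie
    behind its child [y], and only finitely many cells contain [x]. *)
Lemma infinite_far i : S i ->
  infinite_set [set j | [/\ S j, j <> i, forall x, ~ (tree_cell i x /\ tree_cell j x)
    & forall u v, tree_cell i u -> tree_cell j v -> ~ adj T u v]].
Proof.
move=> Si; have [x ix] := tree_cell_proper Si.
have [y [yx ly wy]] := kid_off p_ge2 x (w i (lvl x).+1).
have fx : finite_set [set j | S j /\ tree_cell j x].
  by apply: sub_finite_set (finite_below x (g i x)) => j [Sj jx]; split => //; exact: jx.
apply: (@infinite_superset _ [set j | [/\ S j, w j (lvl y) = y & ~ tree_cell j x]]).
  move=> j [Sj wj jx].
  have wi : w i (lvl y) <> y by rewrite ly => wi; rewrite wi eqxx in wy.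
  have [sep1 sep2] := tree_cell_separation ix jx yx ly wi wj.
  by split => // ji; apply: wi; rewrite -ji.
move=> fA.
have : infinite_set [set j | S j /\ w j (lvl y) = y].
  apply: (@unbounded_infinite _ _ (fun j n => D j = n%:Z)) => [j m n|n0].
    by move=> -> [].
  have [j [Sj wj Dj]] := dense_unbounded y n0%:Z.
  by exists `|D j|%N; split; [lia|exists j; split => //; lia].
apply; apply: (@sub_finite_set _ _ ([set j | S j /\ tree_cell j x] `|`
    [set j | [/\ S j, w j (lvl y) = y & ~ tree_cell j x]])).
  by move=> j [Sj wj]; have [jx|jx] := pselect (tree_cell j x); [left|right].
by rewrite finite_setU.
Qed.

End OneTree.

(** * Cells of the product graph, seen from one of the two trees *)

Section TwoTrees.
Context {p q : nat} {T : marked_tree p.+1} {T' : marked_tree q.+1}.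
Hypotheses (p_ge2 : (2 <= p)%N) (q_ge2 : (2 <= q)%N).
(* V is T * T' with either order of the two factors *)
Context {V : Type} (pr1 : V -> T) (pr2 : V -> T') (mk : T -> T' -> V) (e : rel V).
Hypotheses (pr1_mk : forall v v', pr1 (mk v v') = v)
  (pr2_mk : forall v v', pr2 (mk v v') = v')
  (mk_pr : forall z, mk (pr1 z) (pr2 z) = z)
  (eE : forall y z, e y z = adj T (pr1 y) (pr1 z) && adj T' (pr2 y) (pr2 z)).
Context (S S' : set nat) (w : nat -> end_of T) (w' : nat -> end_of T') (D : nat -> int).
Implicit Types (y z : V) (C : set V).
Hypothesis gen : generic_points S w D.

Local Notation g := (delayed w D).
Local Notation g' := (delayed w' D).
Local Notation h := (buse base_end).

Definition side_cell i : set V := [set z | [/\ h (pr1 z) + h (pr2 z) = 0,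
  forall j, S j -> g i (pr1 z) <= g j (pr1 z)
  & forall j, S' j -> g i (pr1 z) <= g' j (pr2 z)]].

Definition other_side_cell i : set V := [set z | [/\ h (pr1 z) + h (pr2 z) = 0,
  forall j, S' j -> g' i (pr2 z) <= g' j (pr2 z)
  & forall j, S j -> g' i (pr2 z) <= g j (pr1 z)]].

Local Notation C1 := side_cell.
Local Notation C2 := other_side_cell.

Definition adj_pairs C C' : set (V * V) :=
  [set xy | [/\ C xy.1, C' xy.2 & e xy.1 xy.2]].

Lemma e_sym : symmetric e.
Proof. by move=> y z; rewrite !eE (@adj_sym _ T) (@adj_sym _ T'). Qed.

Lemma finite_adj_pairs (A : set V) C C' : finite_set A ->
  (forall y z, C y -> C' z -> e y z -> A y) -> finite_set (adj_pairs C C').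
Proof.
move=> fA CA.
apply: (@sub_finite_set _ _ (\bigcup_(y in A) [set yz | yz.1 = y /\ e y yz.2])).
  by move=> [y z] [/= Cy Cz yz]; exists y => //; exact: CA yz.
apply: bigcup_finite => // y _.
apply: (@sub_finite_set _ _ ((fun vv => (y, mk vv.1 vv.2)) @`
   ([set v | adj T (pr1 y) v] `*` [set v' | adj T' (pr2 y) v']))).
  move=> [y' z] [/= -> yz]; exists (pr1 z, pr2 z); rewrite /= ?mk_pr//.
  by move: yz; rewrite eE => /andP[].
by apply/finite_image/finite_setX; exact: finite_nbrs.
Qed.

Lemma delayed_parts_adj y z : e y z -> adj T (pr1 y) (pr1 z) /\ adj T' (pr2 y) (pr2 z).
Proof. by rewrite eE => /andP[]. Qed.

(** Heights change by one along an edge, and every vertex of the other tree has neighbours both one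
    lower and one higher. *)
Lemma opposite_height_adj (x y : T) (v' : T') (m : int) : adj T x y -> h x + h v' = m ->
  exists u', adj T' v' u' /\ h y + h u' = m.
Proof.
move=> /(buse_adj base_end)[hy|hy] hm.
  by have [u' [vu hu]] := adj_toward base_end v'; exists u'; split => //; rewrite hy hu; lia.
by have [u' [vu hu]] := adj_away q_ge2 base_end v'; exists u'; split => //; rewrite hy hu; lia.
Qed.

Section SameSide.
Hypothesis horospheres : forall m k : int,
  infinite_set [set v' | h v' = m /\ forall j, S' j -> k <= g' j v'].

(** The vertex [x] is kept and paired with the infinitely many vertices of the opposite horosphere
    at which no point of the other side falls below the common value. *)
Lemma tree_cells_inter i j x : tree_cell S w D i x -> tree_cell S w D j x ->
  S i -> S j -> infinite_set (C1 i `&` C1 j).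
Proof.
move=> ix jx Si Sj; have gij : g i x = g j x.
  by apply/eqP; rewrite eq_le ix ?jx.
have mkK : cancel (mk x) pr2 by move=> v'; exact: pr2_mk.
apply: (infinite_superset _ (infinite_image_inj mkK (@horospheres (- h x) (g i x)))).
move=> _ [v' [hv v'S] <-]; split; split; rewrite ?pr1_mk ?pr2_mk ?hv ?subrr//.
by rewrite -gij.
Qed.

Lemma tree_cells_adj i j (x y : T) : tree_cell S w D i x -> tree_cell S w D j y ->
  adj T x y -> infinite_set (adj_pairs (C1 i) (C1 j)).
Proof.
move=> ix jy xy.
(* The extra 1 pays for the move from [v'] to its neighbour [u'], where a horofunction of the other
   side may be smaller by one. *)
pose K := Num.max (g i x) (g j y) + 1.
(* The height condition is put under the existential so that [choice] yields a total function. *)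
have nb v' : exists u', h v' = - h x -> adj T' v' u' /\ h y + h u' = 0.
  have [hv|hv] := pselect (h v' = - h x); last by exists v'.
  have hx : h x + h v' = 0 by rewrite hv; lia.
  by have [u'] := opposite_height_adj xy hx; exists u'.
have [f fP] := choice nb.
have fK : cancel (fun v' => (mk x v', mk y (f v'))) (fun yz : V * V => pr2 yz.1).
  by move=> v' /=; rewrite pr2_mk.
apply: (infinite_superset _ (infinite_image_inj fK (@horospheres (- h x) K))).
move=> _ [v' [hv v'S] <-]; have [vf hf] := fP v' hv.
split; rewrite /= ?eE ?pr1_mk ?pr2_mk ?xy//; split; rewrite ?pr1_mk ?pr2_mk ?hv ?subrr//.
  by move=> k /v'S; rewrite /K; lia.
by move=> k /v'S; have := delayed_adj_ge w' D k vf; rewrite /K; lia.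
Qed.

Lemma same_side_inter i j : S i -> S j ->
  infinite_set (C1 i `&` C1 j) \/ C1 i `&` C1 j = set0.
Proof.
move=> Si Sj; have [[z [[_ iz _] [_ jz _]]]|] := pselect (C1 i `&` C1 j !=set0).
  by left; apply: (tree_cells_inter iz jz).
by move=> /set0P/negP/negPn/eqP; right.
Qed.

Lemma same_side_adj i j : S i -> S j ->
  infinite_set (adj_pairs (C1 i) (C1 j)) \/ adj_pairs (C1 i) (C1 j) = set0.
Proof.
move=> Si Sj; have [[[y z]]|] := pselect (adj_pairs (C1 i) (C1 j) !=set0).
  move=> [[_ iy _] [_ jz _] /delayed_parts_adj[yz _]].
  by left; apply: (tree_cells_adj iy jz).
by move=> /set0P/negP/negPn/eqP; right.
Qed.

Lemma side_cell_nonempty i : S i -> C1 i !=set0.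
Proof.
move=> Si; have [N /(_ N (leqnn N)) ix] := ray_in_tree_cell gen Si.
have [v' [hv v'S]] := infinite_setN0 (@horospheres (- h (w i N)) (g i (w i N))).
by exists (mk (w i N) v'); split; rewrite ?pr1_mk ?pr2_mk ?hv ?subrr.
Qed.

Lemma infinite_same_inter i : S i ->
  infinite_set [set j | [/\ j != i, S j & infinite_set (C1 i `&` C1 j)]].
Proof.
move=> Si; apply: (infinite_superset _ (infinite_meeting gen Si)).
by move=> j [Sj ji [x [ix jx]]]; split; [exact/eqP|by []|exact: (tree_cells_inter ix jx)].
Qed.

Lemma infinite_same_adj i : S i ->
  infinite_set [set j | [/\ j != i, S j & infinite_set (adj_pairs (C1 i) (C1 j))]].
Proof.
move=> Si; apply: (infinite_superset _ (infinite_meeting gen Si)).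
move=> j [Sj ji [x [ix jx]]]; split; [exact/eqP|by []|].
have [y [xy iy _]] := tree_cell_toward ix.
by apply: (tree_cells_adj iy jx); rewrite (@adj_sym _ T).
Qed.

Lemma infinite_same_far i : S i ->
  infinite_set [set j | [/\ j != i, S j, C1 i `&` C1 j = set0
    & adj_pairs (C1 i) (C1 j) = set0]].
Proof.
move=> Si; apply: (infinite_superset _ (infinite_far gen p_ge2 Si)).
move=> j [Sj ji dij aij]; split; [exact/eqP|by []| |].
  by apply/seteqP; split => // z [[_ iz _] [_ jz _]]; exact: (dij (pr1 z)).
apply/seteqP; split => // -[y z] [[_ iy _] [_ jz _] /delayed_parts_adj[yz _]].
exact: (aij _ _ iy jz).
Qed.

End SameSide.

Section DifferentSides.
Hypothesis gen' : generic_points S' w' D.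

(* If the delayed horofunctions of i and j are close at z in the cell of i,
   then they grow linearly with the distance of z from the origin, whereas the
   minimum of the delayed horofunctions of the first side does not. *)
Lemma close_horofunctions i (c K : nat) : S i -> exists M : nat, forall j,
  (forall x', (lvl x')%:Z - c%:Z <= buse (w' j) x' \/ (lvl x')%:Z - c%:Z <= h x') ->
  - K%:Z <= D j -> forall z, C1 i z -> g' j (pr2 z) <= g i (pr1 z) + 2 ->
  (lvl (pr1 z) <= M)%N /\ D j + (lvl (pr2 z))%:Z <= M%:Z.
Proof.
move=> Si; have [b bP] := buse_ge_min (generic_base gen Si).
pose B : nat := (`|D i| + K + b.*2 + c.*2 + 3)%N.
(* With 2B, a point through [x] takes the value |x| - 2B there, strictly below the bound |x| - B
   proved next. *)
have [L LP] := generic_dense gen B.*2%:Z.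
exists (3 * L + B.*2 + b + c)%N => j jc jK z [hz zi _] zj.
set x := pr1 z in hz zi zj *; set x' := pr2 z in hz zj *.
have lx := delayed_ge w D i x; have lx' := delayed_ge w' D j x'.
have lh' := buse_ge base_end x'.
(* If [x] leaves the ray of [i] early, the bound is immediate. Otherwise [h x] is at least |x| - b
   and [x'] has the opposite height: either [x'] leaves the ray of [j] early, and its value is about
   |x'|, which is at least |x| - b, or it leaves the base ray early and both levels are bounded. *)
have lin : (lvl x)%:Z - B%:Z <= g i x.
  have := bP x; have := jc x'; move: lx lx' zj hz lh'; rewrite /B /delayed; lia.
have xL : (lvl x <= L)%N.
  rewrite leqNgt; apply/negP => /ltnW/LP[k [Sk wk Dk]].
  have gk : g k x = (lvl x)%:Z - B.*2%:Z.
    by rewrite /delayed Dk -[in buse _ _]wk buse_ray; lia.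
  by have := zi k Sk; move: lin; rewrite gk /B; lia.
have lh := buse_ge base_end x.
have gub : g i x <= D i + (lvl x)%:Z by rewrite /delayed /buse; lia.
split; first by lia.
(* If [x'] leaves the base ray early, then |x'| is at most |x| + c, and passing from the value of
   [j] to D j + |x'| costs 2|x'|; this accounts for 3L in the bound. *)
by have := jc x'; move: zj gub lx' lh hz; rewrite /B /delayed; lia.
Qed.

(** Moving from [z] to [y] changes each of the two horofunctions by at most one, whence the slack
    2. *)
Lemma adj_cells_close i j y z : S i -> S' j -> C1 i y -> C2 j z -> e y z ->
  g' j (pr2 y) <= g i (pr1 y) + 2.
Proof.
move=> Si Sj [_ iy _] [_ _ jz] /delayed_parts_adj[yz1 yz2].
have := jz i Si; have := delayed_adj w D i yz1; have := delayed_adj_ge w' D j yz2; lia.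
Qed.

Lemma inter_cells_close i j z : S i -> S' j -> C1 i z -> C2 j z ->
  g' j (pr2 z) <= g i (pr1 z) + 2.
Proof. by move=> Si Sj _ [_ _ /(_ i Si)]; lia. Qed.

Lemma finite_close i j : S i -> S' j ->
  finite_set [set z | C1 i z /\ g' j (pr2 z) <= g i (pr1 z) + 2].
Proof.
move=> Si Sj; have [c cP] := buse_ge_min (generic_base gen' Sj).
have [M MP] := close_horofunctions c `|D j|%N Si.
apply: (@sub_finite_set _ _ ((fun vv => mk vv.1 vv.2) @`
  ([set v : T | (lvl v <= M)%N] `*` [set v' : T' | (lvl v' <= M + `|D j|)%N]))).
  move=> z [iz zj]; exists (pr1 z, pr2 z); rewrite /= ?mk_pr//.
  by have [] := MP j cP _ z iz zj; [lia|split => //; lia].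
by apply/finite_image/finite_setX; exact: finite_ball.
Qed.

Lemma different_sides_inter i j : S i -> S' j -> finite_set (C1 i `&` C2 j).
Proof.
move=> Si Sj; apply: sub_finite_set (finite_close Si Sj) => z [iz jz].
by split => //; exact: inter_cells_close.
Qed.

Lemma different_sides_adj i j : S i -> S' j -> finite_set (adj_pairs (C1 i) (C2 j)).
Proof.
move=> Si Sj; apply: (finite_adj_pairs (finite_close Si Sj)) => y z iy jz yz.
by split => //; exact: adj_cells_close jz yz.
Qed.

(** Nuclei behind a child of the root off the base ray all separate from the base end at level 1.
    With nonnegative delays they share one bound [M], and any delay above [M] excludes contact. *)
Lemma infinite_different_far i : S i ->
  infinite_set [set j | [/\ S' j, C1 i `&` C2 j = set0
    & adj_pairs (C1 i) (C2 j) = set0]].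
Proof.
move=> Si.
have [b [br lb bw]] := kid_off q_ge2 (Defs.root T') (@base_end _ T' 1%N).
rewrite lvl_root in lb.
have [M MP] := close_horofunctions 2 0 Si.
have far j : w' j 1%N = b -> (M : int) < D j ->
    forall z, C1 i z -> ~ g' j (pr2 z) <= g i (pr1 z) + 2.
  move=> wj Dj z iz zj.
  have [||] := MP j _ _ z iz zj; [|lia|lia].
  move=> x'; have /(coal_min x') : w' j 1%N <> @base_end _ T' 1%N.
    by rewrite wj => bb; rewrite bb eqxx in bw.
  by rewrite /buse; lia.
apply: (@infinite_superset _ [set j | [/\ S' j, w' j 1%N = b & (M : int) < D j]]).
  move=> j [Sj wj Dj]; split => //; apply/seteqP; split => //.
    by move=> z [iz jz]; apply: (far j wj Dj z iz); exact: inter_cells_close jz.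
  move=> [y z] [iy jz yz]; apply: (far j wj Dj y iy).
  exact: adj_cells_close jz yz.
apply: (@unbounded_infinite _ _ (fun j n => D j = n%:Z)) => [j m n|n0]; first by move=> -> [].
have [j [Sj wj Dj]] := dense_unbounded gen' q_ge2 b (n0 + M.+1)%:Z.
rewrite lb in wj.
by exists `|D j|%N; split; [lia|exists j; split; [split => //|]; lia].
Qed.

(** Fix [x] on the ray of [i] inside its tree cell. A vertex of opposite height at which the minimum
    of the other side equals [g i x] lies, paired with [x], in both cells. The minimizers found
    leave the base ray at unbounded levels, hence are infinitely many. *)
Lemma infinite_different_inter i : horosphere_dense S' w' D -> S i ->
  infinite_set [set j | S' j /\ C1 i `&` C2 j !=set0].
Proof.
move=> hd Si; have [N /(_ N (leqnn N)) ix] := ray_in_tree_cell gen Si.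
set x := w i N in ix.
apply: (@unbounded_infinite _ _ (fun j n => w' j n = @base_end _ T' n /\
  w' j n.+1 <> @base_end _ T' n.+1)).
  move=> j m n [wm wm'] [wn wn']; have [mn|nm|//] := ltngtP m n; exfalso.
    by apply: wm'; rewrite -(anc_ray (w' j) mn) -(anc_ray base_end mn) wn.
  by apply: wn'; rewrite -(anc_ray (w' j) nm) -(anc_ray base_end nm) wm.
move=> n0; have [n [v' [j [[nn wn wn'] [_ hv Sj gj jmin]]]]] :=
  horosphere_cells gen' hd (- h x) (g i x) n0.
exists n; split => //; exists j; split => //; split => //.
by exists (mk x v'); split; split; rewrite ?pr1_mk ?pr2_mk ?hv ?subrr// gj.
Qed.

(** A step towards the nucleus of [i], with the compensating step in the other tree, stays in the
    cell of [i] and is adjacent to the common vertex. *)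
Lemma different_sides_inter_adj i j : S i -> S' j -> C1 i `&` C2 j !=set0 ->
  adj_pairs (C1 i) (C2 j) !=set0.
Proof.
move=> Si Sj [z [iz jz]]; have [hz zi zj] := iz; have [_ _ jzi] := jz.
have [y [zy iy gy]] := tree_cell_toward zi.
have [u' [zu hu]] := opposite_height_adj zy hz.
exists (mk y u', z); split => //=; last by rewrite e_sym eE pr1_mk pr2_mk zy.
split; rewrite ?pr1_mk ?pr2_mk// => k /zj.
have := delayed_adj_ge w' D k zu; move: gy; lia.
Qed.

End DifferentSides.

End TwoTrees.

(** * The harmonic measure of a cylinder *)

Section FiniteUnions.
Context {d : measure_display} {X : measurableType d} {I : eqType}.
Implicit Types (s : seq I) (F : I -> set X).

Lemma exists_in_cons i s F :
  [set x | exists2 j, j \in i :: s & F j x] = F i `|` [set x | exists2 j, j \in s & F j x].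
Proof.
apply/seteqP; split => x.
  by move=> [j]; rewrite inE => /predU1P[->|js Fj]; [left|right; exists j].
by move=> [Fi|[j js Fj]]; [exists i; rewrite ?inE ?eqxx|exists j; rewrite ?inE ?js ?orbT].
Qed.

Lemma exists_in_nil F : [set x | exists2 j, j \in [::] & F j x] = set0.
Proof. by apply/seteqP; split => // x []. Qed.

Lemma measurable_exists s F : (forall i, measurable (F i)) ->
  measurable [set x | exists2 i, i \in s & F i x].
Proof.
move=> mF; elim: s => [|i s IH]; first by rewrite exists_in_nil.
by rewrite exists_in_cons; exact: measurableU.
Qed.

Lemma measure_exists_le {R : realType} (mu : {measure set X -> \bar R}) s F :
  (forall i, measurable (F i)) ->
  (mu [set x | exists2 i, i \in s & F i x] <= \sum_(i <- s) mu (F i))%E.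
Proof.
move=> mF; elim: s => [|i s IH]; first by rewrite exists_in_nil measure0 big_nil.
rewrite exists_in_cons big_cons; apply: le_trans (measureU2 mu (mF i) (measurable_exists s mF)) _.
by rewrite leeD2l.
Qed.

End FiniteUnions.

Section RealProbability.
Context {R : realType} {dO : measure_display} {Omega : measurableType dO}
  (P : probability Omega R).
Implicit Types A B : set Omega.

Definition pr A : R := fine (P A).

Lemma prE A : measurable A -> P A = (pr A)%:E.
Proof. by move=> mA; rewrite fineK// fin_num_measure. Qed.

Lemma pr_ge0 A : 0 <= pr A.
Proof. exact/fine_ge0/measure_ge0. Qed.

Lemma prT : pr setT = 1.
Proof. by rewrite /pr probability_setT. Qed.

Lemma pr0 : pr set0 = 0.
Proof. by rewrite /pr measure0. Qed.

Lemma pr_le A B : measurable A -> measurable B -> A `<=` B -> pr A <= pr B.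
Proof. by move=> mA mB AB; rewrite -lee_fin -!prE// le_measure ?inE. Qed.

Lemma pr_le1 A : measurable A -> pr A <= 1.
Proof. by move=> mA; rewrite -prT pr_le. Qed.

Lemma prDI A B : measurable A -> measurable B -> pr A = pr (A `\` B) + pr (A `&` B).
Proof.
move=> mA mB; apply: EFin_inj; rewrite EFinD -!prE//; first exact: measureDI.
  exact: measurableI.
exact: measurableD.
Qed.

Lemma prU A B : measurable A -> measurable B -> A `&` B = set0 ->
  pr (A `|` B) = pr A + pr B.
Proof.
move=> mA mB AB; apply: EFin_inj; rewrite EFinD -!prE//; first exact: measureU.
exact: measurableU.
Qed.

Lemma pr_exists_le {I : eqType} (s : seq I) (F : I -> set Omega) :
  (forall i, measurable (F i)) ->
  pr [set o | exists2 i, i \in s & F i o] <= \sum_(i <- s) pr (F i).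
Proof.
move=> mF; rewrite -lee_fin -prE; last exact: measurable_exists.
apply: le_trans (measure_exists_le P s mF) _.
rewrite -sumEFin le_eqVlt; apply/orP; left; apply/eqP.
by apply: eq_bigr => i _; exact: prE.
Qed.

Lemma pr_seq_split {I : eqType} (s : seq I) (f : Omega -> I) A :
  uniq s -> measurable A -> (forall i, measurable [set o | f o = i]) ->
  pr (A `&` [set o | f o \in s]) = \sum_(i <- s) pr (A `&` [set o | f o = i]).
Proof.
move=> + mA mf; elim: s => [|i s IH].
  by move=> _; rewrite big_nil -pr0; congr pr; apply/seteqP; split => // o [].
move=> /= /andP[iNs us]; rewrite big_cons -IH// -prU.
- rewrite -setIUr; congr (pr (_ `&` _)); apply/seteqP; split => o /=.
    by rewrite inE => /predU1P.
  by rewrite inE => h; apply/predU1P.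
- exact: measurableI.
- apply: measurableI => //.
  rewrite (_ : [set _ | _] = [set o | exists2 j, j \in s & f o = j]).
    exact: measurable_exists.
  by apply/seteqP; split => o /=; [exists (f o)|move=> [j js ->]].
- apply/seteqP; split => // o [[_ /= fi] [_ /=]].
  by rewrite fi (negbTE iNs).
Qed.

(** Covering by measurable events spares a proof that the exceptional sets, which quantify over
    rays, are measurable. *)
Lemma negligible_small A :
  (forall eps : R, 0 < eps -> exists2 B, measurable B & A `<=` B /\ pr B <= eps) ->
  P.-negligible A.
Proof.
move=> small.
have small' n : exists B, [/\ measurable B, A `<=` B & pr B <= n.+1%:R^-1].
  have [|B mB [AB Bn]] := small n.+1%:R^-1; first by rewrite invr_gt0.
  by exists B.
have [B BP] := choice small'.
have mB : measurable (\bigcap_n B n).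
  by apply: bigcapT_measurable => n; have [] := BP n.
exists (\bigcap_n B n); split => //; last by move=> o Ao n _; have [_ AB _] := BP n; exact: AB.
rewrite prE//; congr (_%:E); apply/eqP; rewrite eq_le pr_ge0 andbT.
apply/ler_addgt0Pl => e e0; rewrite addr0.
have [n ne] : exists n : nat, n.+1%:R^-1 <= e.
  exists (Num.truncn e^-1); rewrite invf_ple ?posrE//.
  exact/ltW/truncnS_gt.
have [mBn _ Bn] := BP n.
by apply: le_trans ne; apply: le_trans Bn; apply: pr_le => // o; exact.
Qed.

End RealProbability.

(** * Counting walks from the root *)

Section WalkSums.
Context {R : realType} {p : nat} {T : marked_tree p.+1}.
Implicit Types (x y z v : T) (phi : T -> R).
Local Notation d := (p.+1).

(** The sum of [phi] over the endpoints of all walks of length [n] from [x]. *)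
Fixpoint walk_sum n phi x : R :=
  if n is m.+1 then \sum_(y <- nbrs x) walk_sum m phi y else phi x.

Lemma walk_sumS n phi x :
  walk_sum n.+1 phi x = walk_sum n (fun z => \sum_(y <- nbrs z) phi y) x.
Proof.
by elim: n x => //= n IH x; apply: eq_bigr => y _; exact: IH.
Qed.

Lemma eq_walk_sum n phi psi x : phi =1 psi -> walk_sum n phi x = walk_sum n psi x.
Proof. by move=> e; elim: n x => //= n IH x; apply: eq_bigr. Qed.

Lemma walk_sumD n phi psi x :
  walk_sum n (fun z => phi z + psi z) x = walk_sum n phi x + walk_sum n psi x.
Proof.
by elim: n x => //= n IH x; rewrite -big_split; apply: eq_bigr.
Qed.

Lemma walk_sumZ n c phi x : walk_sum n (fun z => c * phi z) x = c * walk_sum n phi x.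
Proof. by elim: n x => //= n IH x; rewrite big_distrr; apply: eq_bigr. Qed.

Lemma walk_sum_sum n (s : seq T) (F : T -> T -> R) x :
  walk_sum n (fun z => \sum_(y <- s) F y z) x = \sum_(y <- s) walk_sum n (F y) x.
Proof.
elim: s => [|y s IH].
  rewrite big_nil; rewrite (@eq_walk_sum _ _ (fun z => 0 * 0)).
    by rewrite walk_sumZ mul0r.
  by move=> z; rewrite big_nil mul0r.
rewrite big_cons -IH -walk_sumD; apply: eq_walk_sum => z; by rewrite big_cons.
Qed.

Lemma sum_nbrs_lvl (G : nat -> R) x :
  \sum_(y <- nbrs x) G (lvl y)
  = G (lvl x).+1 *+ (d - (0 < lvl x)%N) + G (lvl x).-1 *+ (0 < lvl x)%N.
Proof.
rewrite (bigID (fun y => (lvl x < lvl y)%N)) /= -big_filter -/(kids x).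
congr (_ + _).
  rewrite -size_kids (eq_big_seq (fun=> G (lvl x).+1)).
    by rewrite big_const_seq count_predT iter_addr_0.
  by move=> y /lvl_kid->.
rewrite -big_filter (eq_big_seq (fun=> G (lvl x).-1)).
  rewrite big_const_seq count_predT iter_addr_0; congr (_ *+ _).
  have := count_predC (fun y => lvl x < lvl y)%N (nbrs x).
  rewrite size_nbrs -!size_filter -/(kids x) size_kids.
  rewrite (eq_filter (a2 := fun y => ~~ (lvl x < lvl y)%N)) // => h.
  apply/eqP; rewrite -(eqn_add2l (p.+1 - (0 < lvl x))%N) [X in X == _]h; apply/eqP.
  by case: (0 < _)%N; lia.
move=> y; rewrite mem_filter mem_nbrs => /andP[yx /adjP[[_ ->]//|[_ ly]]].
by rewrite ly ltnSn in yx.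
Qed.

Lemma sum_nbrs_delta z v : \sum_(y <- nbrs z) (y == v)%:R = (adj T z v)%:R :> R.
Proof.
rewrite -mem_nbrs; have := uniq_nbrs z; elim: (nbrs z) => [|a s IH] /=.
  by rewrite big_nil.
move=> /andP[aNs /IH]; rewrite big_cons inE => ->.
rewrite [v == a]eq_sym; have [av|_] := eqVneq a v; last by rewrite add0r.
by rewrite -av (negbTE aNs) addr0.
Qed.

(** An induction in place of automorphisms of the tree: removing the last step gives a sum over the
    neighbours of [v], whose levels occur with multiplicities that depend only on the level of
    [v]. *)
Lemma walk_sum_point n : exists G : nat -> R,
  forall v, walk_sum n (fun z => (z == v)%:R) (Defs.root T) = G (lvl v).
Proof.
elim: n => [|n [G GP]].
  exists (fun l => (l == 0)%:R) => v /=; congr ((_ : bool)%:R).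
  by apply/eqP/eqP => [<-|/lvl_eq0//]; exact: lvl_root.
exists (fun l => G l.+1 *+ (d - (0 < l)%N) + G l.-1 *+ (0 < l)%N) => v.
rewrite walk_sumS -sum_nbrs_lvl.
rewrite (@eq_walk_sum _ _ (fun z => \sum_(y <- nbrs v) (z == y)%:R)); last first.
  move=> z; rewrite sum_nbrs_delta (@adj_sym _ T) -sum_nbrs_delta.
  by apply: eq_bigr => y _; rewrite eq_sym.
by rewrite walk_sum_sum; apply: eq_bigr => y _.
Qed.

(* Only the edge from par v to v leads into the cone of v. *)
Lemma sum_nbrs_cone v z : (0 < lvl v)%N ->
  \sum_(y <- nbrs z) (in_cone v y)%:R
  = d%:R * (in_cone v z)%:R + ((z == par v)%:R - (z == v)%:R) :> R.
Proof.
move=> v0.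
have pv : adj T v (par v) by exact: adj_par.
have vNp : v != par v by exact: adj_neq.
have edge y : y \in nbrs z -> (in_cone v y)%:R = (in_cone v z)%:R
    + ((z == par v)%:R * (y == v)%:R - (z == v)%:R * (y == par v)%:R) :> R.
  rewrite mem_nbrs => /adjP[[zy lz]|[yz ly]].
    have [zv|zv] := eqVneq z v.
      rewrite zv in zy *; rewrite (negbTE vNp) zy eqxx in_conexx.
      have -> : in_cone v y = false.
        apply/negP => /in_cone_lvl; move: lz; rewrite zv; lia.
      by rewrite mul0r mulr1 add0r subrr.
    have vz : v != z by rewrite eq_sym.
    rewrite -zy in_cone_par ?lz// mul0r subr0 zy.
    have [yv|] := eqVneq y v; last by rewrite mulr0 addr0.
    have -> : (z == par v) = false.
      apply/eqP => zp; have := lvl_par v; move: lz; rewrite yv zp; lia.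
    by rewrite mul0r addr0.
  have [yv|yv] := eqVneq y v.
    rewrite yv in yz *; rewrite (negbTE vNp) -yz eqxx in_conexx.
    have -> : in_cone v (par v) = false.
      apply/negP => /in_cone_lvl; rewrite lvl_par; lia.
    by rewrite mulr1 mulr0 subr0 add0r.
  have vy : v != y by rewrite eq_sym.
  rewrite -yz in_cone_par ?ly// yz mulr0 add0r.
  have [zv|] := eqVneq z v; last by rewrite mul0r oppr0 addr0.
  have -> : (y == par v) = false.
    apply/eqP => yp; have := lvl_par v; move: ly; rewrite zv yp; lia.
  by rewrite mulr0 oppr0 addr0.
rewrite (eq_big_seq _ edge) !big_split /= sumrN -!big_distrr /= !sum_nbrs_delta.
rewrite big_const_seq count_predT size_nbrs iter_addr_0 mulr_natl; congr (_ + (_ - _)).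
  by have [->|] := eqVneq z (par v); rewrite ?mul0r// (@adj_sym _ T) pv mulr1.
by have [->|] := eqVneq z v; rewrite ?mul0r// pv mulr1.
Qed.

(** One more step multiplies the count by the degree and adds the net flow through the edge from
    [par v] to [v], which by [walk_sum_point] depends only on the level. *)
Lemma walk_sum_cone n v v' : (0 < lvl v)%N -> lvl v = lvl v' ->
  walk_sum n (fun z => (in_cone v z)%:R) (Defs.root T)
  = walk_sum n (fun z => (in_cone v' z)%:R) (Defs.root T).
Proof.
move=> + vv'; elim: n => [|n IH] v0.
  congr ((_ : bool)%:R); transitivity false; last symmetry;
    apply/negP => /in_cone_lvl; rewrite lvl_root; lia.
have [G GP] := walk_sum_point n.
have step u : (0 < lvl u)%N -> walk_sum n.+1 (fun z => (in_cone u z)%:R) (Defs.root T)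
    = d%:R * walk_sum n (fun z => (in_cone u z)%:R) (Defs.root T)
      + (G (lvl u).-1 + -1 * G (lvl u)).
  move=> u0; rewrite walk_sumS (eq_walk_sum _ _ (fun z => sum_nbrs_cone z u0)).
  rewrite walk_sumD walk_sumZ; congr (_ + _).
  rewrite -lvl_par -!GP -walk_sumZ -walk_sumD; apply: eq_walk_sum => z.
  by rewrite mulN1r.
by rewrite !step -?vv'// IH.
Qed.

End WalkSums.

Section HarmonicMeasure.
Context {R : realType} {p : nat} {T : marked_tree p.+1}.
Implicit Types (y z v : T) (w : end_of T).
Local Notation d := (p.+1).

Hypothesis p_gt0 : (0 < p)%N.

Lemma cylinderE v w : cylinder v w <-> w (lvl v) = v.
Proof.
split=> [[n wn]|wv]; last by exists (lvl v).
by rewrite -[in LHS]wn lvl_ray.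
Qed.

Lemma measurable_cylinder v : measurable (cylinder v).
Proof. by apply: sub_sigma_algebra; exists v. Qed.

Section Walk.
Context {dO : measure_display} {Omega : measurableType dO}
  (P : probability Omega R) (X : nat -> Omega -> T).
Hypothesis XP : simple_random_walk P X.
Local Notation pr := (pr P).

Lemma measurable_step n (A : set T) : measurable [set o | A (X n o)].
Proof.
have [mX _ _] := XP.
rewrite (_ : [set _ | _] = \bigcup_v ([set o | X n o = v] `&` [set o | A v])).
  apply: countable_bigcupT_measurable; first exact: countable_tree.
  move=> v; have [Av|Av] := pselect (A v).
    by rewrite (_ : [set o | A v] = setT) ?setIT//; apply/seteqP; split.
  by rewrite (_ : [set o | A v] = set0) ?setI0//; apply/seteqP; split.
apply/seteqP; split => o; first by exists (X n o).
by move=> [v _ [/= -> ]].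
Qed.

Let pre n (x : nat -> T) := [set o | forall k, (k <= n)%N -> X k o = x k].

Let measurable_pre n x : measurable (pre n x).
Proof.
rewrite (_ : pre n x = \bigcap_(k in [set k | (k <= n)%N]) [set o | X k o = x k]).
  apply: bigcap_measurable; first by exists 0%N.
  by move=> k _; have [mX _ _] := XP; exact: mX.
by apply/seteqP; split.
Qed.

Let pre_step n x y : pr (pre n x `&` [set o | X n.+1 o = y])
  = pr (pre n x) * ((adj T (x n) y)%:R / d%:R).
Proof.
have [_ _ step] := XP.
pose x' k := if k == n.+1 then y else x k.
have x'x k : (k <= n)%N -> x' k = x k.
  by move=> kn; rewrite /x'; case: eqP => // e; rewrite e ltnn in kn.
have -> : pre n x `&` [set o | X n.+1 o = y] = pre n.+1 x'.
  apply/seteqP; split => o /=.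
    move=> [on oy] k; rewrite leq_eqVlt => /predU1P[->|kn]; first by rewrite /x' eqxx.
    by rewrite x'x//; exact: on.
  move=> on; split; last by rewrite on// /x' eqxx.
  by move=> k kn; rewrite on 1?x'x// leqW.
have prex : pre n x' = pre n x.
  by apply/seteqP; split => o on k kn; rewrite on// x'x.
apply: EFin_inj; rewrite EFinM -!prE// step -/(pre n x') prex.
rewrite (x'x n)// {1}/x' eqxx; congr (_ * _%:E)%E.
by case: ifP; rewrite ?mul1r ?mul0r.
Qed.

Lemma walk_probability m n (x : nat -> T) (A : pred T) :
  pr (pre n x `&` [set o | A (X (n + m) o)])
  = pr (pre n x) * (walk_sum m (fun z => (A z)%:R) (x n) / d%:R ^+ m).
Proof.
elim: m n x => [|m IH] n x.
  rewrite addn0 /= expr0 divr1.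
  have [An|An] := boolP (A (x n)); rewrite (mulr1, mulr0) -?(pr0 P); congr pr.
    by apply/seteqP; split => [t [] //|t on]; split => //=; rewrite on.
  by apply/seteqP; split => // o [/= on]; rewrite on// (negbTE An).
pose s := nbrs (x n); pose B := [set o | X n.+1 o \in s].
have mB : measurable B by exact: (measurable_step n.+1 [set y | y \in s]).
have mf y : measurable [set o | X n.+1 o = y] by have [mX _ _] := XP; exact: mX.
(* Each of the d neighbours receives a share 1/d of the mass of the prefix, so nothing is left for
   other targets. *)
have leave : pr (pre n x `\` B) = 0.
  have := prDI P (measurable_pre n x) mB.
  rewrite (@pr_seq_split _ _ _ P _ s (X n.+1))//; last exact: uniq_nbrs.
  rewrite (eq_big_seq (fun=> pr (pre n x) / d%:R)); last first.
    by move=> y; rewrite mem_nbrs pre_step => ->; rewrite mul1r.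
  rewrite big_const_seq count_predT size_nbrs iter_addr_0 -[X in _ + X]mulr_natr divfK//.
  by move/eqP; rewrite -subr_eq subrr => /eqP.
have mE : measurable [set o | A (X (n + m.+1) o)].
  exact: (measurable_step (n + m.+1) (fun z => A z)).
rewrite (prDI P _ mB); last exact: measurableI.
rewrite [X in X + _](_ : _ = 0) ?add0r; last first.
  apply/eqP; rewrite eq_le pr_ge0 andbT -leave pr_le//.
  - by apply: measurableD => //; exact: measurableI.
  - exact: measurableD.
  - by move=> o [[]].
rewrite (@pr_seq_split _ _ _ P _ s (X n.+1))//; last 2 first.
  exact: uniq_nbrs.
  exact: measurableI.
rewrite [walk_sum _ _ _]/= mulr_suml mulr_sumr; apply: eq_big_seq => y sy.
pose x' k := if k == n.+1 then y else x k.
have x'x k : (k <= n)%N -> x' k = x k.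
  by move=> kn; rewrite /x'; case: eqP => // e; rewrite e ltnn in kn.
have pre' : pre n.+1 x' = pre n x `&` [set o | X n.+1 o = y].
  apply/seteqP; split => o /=.
    move=> on; split; last by rewrite on// /x' eqxx.
    by move=> k kn; rewrite on 1?x'x// leqW.
  move=> [on oy] k; rewrite leq_eqVlt => /predU1P[->|kn]; first by rewrite /x' eqxx.
  by rewrite x'x//; exact: on.
rewrite setIAC -pre' addnS -addSn IH pre' pre_step /x' eqxx.
move: sy; rewrite mem_nbrs => ->.
by rewrite mul1r exprS invfM -!mulrA; congr (_ * _); rewrite mulrCA.
Qed.

Lemma position_probability n (A : pred T) :
  pr [set o | A (X n o)] = walk_sum n (fun z => (A z)%:R) (Defs.root T) / d%:R ^+ n.
Proof.
have [mX X0 _] := XP.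
have := walk_probability n 0 (fun=> Defs.root T) A.
have -> : pre 0 (fun=> Defs.root T) = [set o | X 0%N o = Defs.root T].
  apply/seteqP; split => o; first by apply.
  by move=> o0 k; rewrite leqn0 => /eqP->.
have mA : measurable [set o | A (X n o)] by exact: (measurable_step n (fun z => A z)).
rewrite {2}/pr X0 mul1r add0n => <-.
rewrite (prDI P mA (mX 0%N (Defs.root T))) setIC.
rewrite [X in X + _](_ : _ = 0) ?add0r//.
have := prDI P measurableT (mX 0%N (Defs.root T)).
rewrite setTI prT {2}/pr X0 => /eqP; rewrite -subr_eq subrr => /eqP h.
apply/eqP; rewrite eq_le pr_ge0 andbT h pr_le//.
- exact: measurableD.
- exact: measurableD.
- by move=> o [_].
Qed.

Lemma cone_probability n v : (0 < lvl v)%N ->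
  pr [set o | in_cone v (X n o)] <= (d * p ^ (lvl v).-1)%:R^-1.
Proof.
move=> v0.
pose s : seq T := sphere (lvl v).
have size_s : size s = (d * p ^ (lvl v).-1)%N.
  by rewrite /s -{1}(prednK v0) size_sphereS.
have : \sum_(u <- s) pr [set o | in_cone u (X n o)] <= 1.
  rewrite (eq_big_seq (fun u => pr (setT `&` [set o | anc (lvl v) (X n o) = u]))).
    rewrite -pr_seq_split//.
    - apply: pr_le1; rewrite setTI.
      exact: (measurable_step n [set y | anc (lvl v) y \in s]).
    - exact: uniq_sphere.
    - by move=> u; exact: (measurable_step n [set y | anc (lvl v) y = u]).
  move=> u; rewrite mem_sphere => /eqP uv; rewrite setTI; congr pr.
  by apply/seteqP; split => o; rewrite /= /in_cone uv => /eqP.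
rewrite (eq_big_seq (fun=> pr [set o | in_cone v (X n o)])).
  rewrite big_const_seq count_predT iter_addr_0 size_s -[X in X <= _ -> _]mulr_natr => h.
  by rewrite -[leRHS]div1r ler_pdivlMr// ltr0n muln_gt0 expn_gt0 p_gt0.
move=> u; rewrite mem_sphere => /eqP uv.
by rewrite !position_probability (walk_sum_cone _ _ uv)// uv.
Qed.

End Walk.

Lemma harmonic_cylinder (eta : probability (end_of T) R) v : harmonic_measure eta ->
  (0 < lvl v)%N -> eta (cylinder v) = ((d * p ^ (lvl v).-1)%:R^-1)%:E.
Proof.
case=> dO [] Omega [] P [] X [] Xoo [] XP mXoo conv etaE v0.
set l := lvl v in v0 *; set c : R := _^-1.
have mcyl u : measurable (Xoo @^-1` cylinder u).
  by rewrite -[_ @^-1` _]setTI; apply: mXoo => //; exact: measurable_cylinder.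
have bound u : lvl u = l -> pr P (Xoo @^-1` cylinder u) <= c.
  (* In [W N] the walk stays in the cone from time [N] on, which is no likelier than being there at
     time [N]. Convergence to an end of the cylinder puts the walk in some [W N], up to a null
     set. *)
  move=> ul; pose W N := \bigcap_(n in [set n | (N <= n)%N]) [set o | in_cone u (X n o)].
  have mW N : measurable (W N).
    apply: bigcap_measurable; first by exists N => /=.
    by move=> n _; exact: (measurable_step XP n (fun y => in_cone u y)).
  have mWU : measurable (\bigcup_N W N) by exact: bigcupT_measurable.
  have WU : (P (\bigcup_N W N) <= c%:E)%E.
    have cvgW : P \o W @ \oo --> P (\bigcup_N W N).
      apply: nondecreasing_cvg_mu => // m n mn; apply/subsetPset => o Wo k /= nk.
      by apply: Wo => /=; exact: leq_trans nk.
    apply: (cvge_le _ cvgW); near=> N => /=.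
    have u0 : (0 < lvl u)%N by rewrite ul.
    have := cone_probability XP N u0; rewrite ul prE// lee_fin; apply: le_trans.
    apply: pr_le => //; last by move=> o; apply => /=.
    exact: (measurable_step XP N (fun y => in_cone u y)).
  rewrite -lee_fin -prE//; apply: le_trans WU.
  have [N [mN PN0 limN]] := conv.
  have -> : P (\bigcup_N W N) = P ((\bigcup_N W N) `|` N).
    by rewrite measureU0.
  apply: le_measure; rewrite ?inE//; first exact: measurableU.
  move=> o /cylinderE ou; have [oN|oN] := pselect (N o); [by right|left].
  have nbhs_o : end_nbhs (Xoo o) `<=` X^~ o @ \oo.
    by apply: contrapT => h; apply: oN; exact: limN.
  have [|M _ MP] := nbhs_o [set y | in_cone u y].
    exists (lvl u) => // y /= /end_nbhs_cone[_ yu].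
    by rewrite /in_cone yu ou.
  by exists M => // n /= Mn; exact: MP.
have total : \sum_(u <- sphere l) pr P (Xoo @^-1` cylinder u) = 1.
  rewrite (eq_big_seq (fun u => pr P (setT `&` [set o | Xoo o l = u]))).
    rewrite -pr_seq_split//.
    - rewrite setTI (_ : [set _ | _] = setT) ?prT//.
      by apply/seteqP; split => // o _ /=; rewrite mem_sphere lvl_ray.
    - exact: uniq_sphere.
    - move=> u; have [ul|ul] := eqVneq (lvl u) l.
        rewrite (_ : [set _ | _] = Xoo @^-1` cylinder u)//.
        by apply/seteqP; split => o /=; rewrite cylinderE ul.
      rewrite (_ : [set _ | _] = set0)//.
      by apply/seteqP; split => // o /= ou; move: ul; rewrite -ou lvl_ray eqxx.
  move=> u; rewrite mem_sphere => /eqP ul; rewrite setTI; congr pr.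
  by apply/seteqP; split => o /=; rewrite cylinderE ul.
have size_l : size (sphere l : seq T) = (d * p ^ l.-1)%N.
  by rewrite -{1}(prednK v0) size_sphereS.
have c_total : \sum_(u <- sphere l : seq T) c = 1.
  rewrite big_const_seq count_predT iter_addr_0 size_l -[LHS]mulr_natr mulVf//.
  by rewrite pnatr_eq0 -lt0n muln_gt0 expn_gt0 p_gt0.
rewrite etaE; last exact: measurable_cylinder.
rewrite prE//; congr (_%:E); apply/eqP; rewrite eq_le bound//= -subr_le0.
have : \sum_(u <- sphere l) (c - pr P (Xoo @^-1` cylinder u)) = 0.
  by rewrite sumrB total c_total subrr.
rewrite (big_rem v)/= ?mem_sphere// => /eqP; rewrite addr_eq0 => /eqP ->.
rewrite oppr_le0 big_seq sumr_ge0// => u /mem_rem; rewrite mem_sphere => /eqP /bound.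
by rewrite subr_ge0.
Unshelve. all: by end_near.
Qed.

End HarmonicMeasure.

(** * Occupied and empty sets of a Poisson process *)

Section PatternSupports.
Context {X : Type}.
Local Notation apart := (fun A B : set X => `[< A `&` B = set0 >]).

Definition supports (es : seq (set X * set X)) : seq (set X) :=
  flatten [seq [:: e.1; e.2] | e <- es].

(** [U k] encloses the k-th pattern: disjoint enclosures and disjointness inside each pattern
    suffice for independence. *)
Lemma apart_supports (E : nat -> set X * set X) (U : nat -> set X) n m :
  (forall k, (n <= k < n + m)%N -> [/\ (E k).1 `<=` U k, (E k).2 `<=` U k
    & (E k).1 `&` (E k).2 = set0]) ->
  (forall j k, (n <= j)%N -> (j < k)%N -> (k < n + m)%N -> U j `&` U k = set0) ->
  pairwise apart (supports [seq E k | k <- iota n m]).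
Proof.
elim: m n => // m IH n EU UU.
have [|n1 n2 n12] := EU n; first by rewrite leqnn addnS ltnS leq_addr.
have rest A : A `<=` U n ->
    all (fun B => `[< A `&` B = set0 >]) (supports [seq E k | k <- iota n.+1 m]).
  move=> AU.
  have : forall k, k \in iota n.+1 m -> (n < k < n + m.+1)%N.
    by move=> k; rewrite mem_iota addSnnS.
  elim: (iota n.+1 m) => // k l IHl lk; rewrite /supports /= -/(supports _).
  have /andP[nk kn] : (n < k < n + m.+1)%N by apply: lk; rewrite mem_head.
  have [|k1 k2 _] := EU k; first by rewrite kn ltnW.
  have nkU := UU _ _ (leqnn n) nk kn.
  apply/and3P; split; [apply/asboolP|apply/asboolP|].
  - exact: subsetI_eq0 AU k1 nkU.
  - exact: subsetI_eq0 AU k2 nkU.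
  - by apply: IHl => j jl; apply: lk; rewrite inE jl orbT.
rewrite /supports /= -/(supports _); apply/and3P; split.
- by rewrite rest//= andbT; apply/asboolP.
- exact: rest.
- apply: IH => [k /andP[nk kn]|j k nj jk kn].
    by apply: EU; rewrite ltnW//= -addSnnS.
  by apply: UU; rewrite -?addSnnS// ltnW.
Qed.

Lemma apart_supports_cons (A : set X) (E : nat -> set X * set X) (U : nat -> set X) n m :
  (forall k, (n <= k < n + m)%N -> [/\ (E k).1 `<=` U k, (E k).2 `<=` U k
    & (E k).1 `&` (E k).2 = set0]) ->
  (forall j k, (n <= j)%N -> (j < k)%N -> (k < n + m)%N -> U j `&` U k = set0) ->
  (forall k, (n <= k < n + m)%N -> A `&` U k = set0) ->
  pairwise apart (A :: supports [seq E k | k <- iota n m]).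
Proof.
move=> EU UU AU; rewrite /= (apart_supports EU UU) andbT.
have : forall k, k \in iota n m -> (n <= k < n + m)%N by move=> k; rewrite mem_iota.
elim: (iota n m) => // k l IH lk; rewrite /supports /= -/(supports _).
have nk : (n <= k < n + m)%N by apply: lk; rewrite mem_head.
have [k1 k2 _] := EU k nk.
apply/and3P; split; [apply/asboolP|apply/asboolP|].
- exact: subsetI_eq0 (@subset_refl _ A) k1 (AU k nk).
- exact: subsetI_eq0 (@subset_refl _ A) k2 (AU k nk).
- by apply: IH => j jl; apply: lk; rewrite inE jl orbT.
Qed.

End PatternSupports.

Section PoissonEvents.
Context {R : realType} {dO : measure_display} {Omega : measurableType dO}
  {dX : measure_display} {X : measurableType dX} (P : probability Omega R)
  (Phi : nat -> Omega -> X) (mu : set X -> \bar R).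
Hypothesis PhiP : poisson_point_process P Phi mu.
Implicit Types (A : set X) (a : R).
Local Notation pr := (pr P).

Definition hit A : set Omega := [set o | exists i, A (Phi i o)].

Lemma measurable_hit A : measurable A -> measurable (hit A).
Proof.
move=> mA; rewrite (_ : hit A = \bigcup_i (Phi i @^-1` A)).
  apply: bigcupT_measurable => i; rewrite -[_ @^-1` _]setTI.
  by have [mPhi _ _ _] := PhiP; exact: mPhi.
by apply/seteqP; split => [t [i]|t [i _]]; exists i.
Qed.

Definition constrained (c : set X * bool) : set Omega :=
  if c.2 then hit c.1 else ~` hit c.1.

Lemma measurable_constrained c : measurable c.1 -> measurable (constrained c).
Proof.
by case: c => A [] /measurable_hit mA //; exact: measurableC.
Qed.

Lemma npoints_eq0 A o : npoints Phi A o = 0%E :> \bar R <-> ~ hit A o.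
Proof.
rewrite /npoints /counting; split.
  case: ifPn => // /asboolP fA [] /eqP; rewrite pnatr_eq0 finmap.cardfs_eq0 => /eqP A0.
  have AE := fset_set_set0 fA A0.
  by move=> [i Ai]; have : [set i | A (Phi i o)] i by []; rewrite AE.
move=> nA; rewrite (_ : [set i | _] = set0).
  by rewrite asboolT// fset_set0 finmap.cardfs0.
by apply/seteqP; split => // i Ai; apply: nA; exists i.
Qed.

Lemma pr_void A a : measurable A -> mu A = a%:E -> pr (~` hit A) = expR (- a).
Proof.
move=> mA muA; have [_ pmf _ _] := PhiP.
have := pmf A mA; rewrite muA => /(_ isT 0%N).
rewrite expr0 fact0 divr1 mul1r /= => e.
rewrite /pr -[RHS]/(fine (expR (- a))%:E) -e; congr (fine (P _)).
by apply/seteqP; split => o; rewrite /= npoints_eq0.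
Qed.

Lemma pr_hit A a : measurable A -> mu A = a%:E -> pr (hit A) = 1 - expR (- a).
Proof.
move=> mA muA; have := prDI P measurableT (measurable_hit mA).
by rewrite prT setTD setTI (pr_void mA muA); lra.
Qed.

Lemma pr_hit_le A a : measurable A -> mu A = a%:E -> pr (hit A) <= a.
Proof.
move=> mA muA; rewrite (pr_hit mA muA); have := expR_ge1Dx (- a); lra.
Qed.

Local Notation apart := (fun A B : set X => `[< A `&` B = set0 >]).

Definition constraints (s : seq (set X * bool)) : set Omega :=
  [set o | forall c, List.In c s -> constrained c o].

Lemma constraints_nil : constraints [::] = setT.
Proof. by apply/seteqP; split => // t _ c []. Qed.

Lemma constraints_cons c s :
  constraints (c :: s) = constrained c `&` constraints s.
Proof.
apply/seteqP; split => [t h|t [h1 h2] c' [<-//|]]; last exact: h2.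
by split=> [|c' c's]; apply: h => /=; [left|right].
Qed.

Definition measurables (s : seq (set X * bool)) :=
  forall c, List.In c s -> measurable c.1.

Lemma measurable_constraints s : measurables s -> measurable (constraints s).
Proof.
elim: s => [|c s IH] ms; first by rewrite constraints_nil.
rewrite constraints_cons; apply: measurableI.
  by apply/measurable_constrained/ms; left.
by apply: IH => c' c's; apply: ms; right.
Qed.

(** Being empty or occupied is a condition on the number of points, so independence of the counts
    applies with {0} and its complement. *)
Lemma pr_constraints s : measurables s -> pairwise apart [seq c.1 | c <- s] ->
  pr (constraints s) = \prod_(c <- s) pr (constrained c).
Proof.
move=> ms ds; have [_ _ _ indep] := PhiP.
pose c0 : set X * bool := (set0, false).
pose n := size s.
pose A (i : 'I_n) := (nth c0 s i).1.
pose b (i : 'I_n) := (nth c0 s i).2.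
pose B (i : 'I_n) : set (\bar R) := if b i then ~` [set 0%E] else [set 0%E].
have inth (i : 'I_n) : List.In (nth c0 s i) s.
  have := ltn_ord i; rewrite /n; elim: (s) (val i) => [//|c s' IH] [|k] /=; first by left.
  by rewrite ltnS => /IH; right.
have mA i : measurable (A i) by exact/ms/inth.
have mB i : measurable (B i).
  by rewrite /B; case: (b i); [apply: measurableC|]; exact: emeasurable_set1.
have tA : trivIset setT A.
  have lt (i j : 'I_n) : (i < j)%N -> A i `&` A j = set0.
    move=> ij; move/(pairwiseP set0): ds => /(_ i j).
    have szs (k : 'I_n) : (k : nat) \in gtn (size [seq c.1 | c <- s]).
      by rewrite size_map; exact: ltn_ord.
    move=> /(_ (szs i) (szs j) ij) /asboolP.
    by rewrite !(nth_map c0) ?ltn_ord.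
  apply/trivIsetP => i j _ _ ij; have [/lt//|ji|/val_inj e] := ltngtP i j.
    by rewrite setIC; exact: lt.
  by rewrite e eqxx in ij.
have BE i : [set o | B i (npoints Phi (A i) o)] = constrained (nth c0 s i).
  rewrite /B /constrained /b /A; apply/seteqP; split => o /=; case: ifP => _ /=.
  - by move=> h; apply: contrapT => /npoints_eq0.
  - by move/npoints_eq0.
  - by move=> h /npoints_eq0.
  - by move/npoints_eq0.
have := indep n A B mA tA mB.
rewrite (eq_bigr (fun i : 'I_n => (pr (constrained (nth c0 s i)))%:E)); last first.
  by move=> i _; rewrite BE prE//; apply: measurable_constrained; exact: mA.
rewrite (_ : \bigcap_(i in setT) _ = constraints s); last first.
  apply/seteqP; split => o.
    move=> h c cs.
    have [i ->] : exists i : 'I_n, c = nth c0 s i.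
      have : exists2 k, (k < n)%N & c = nth c0 s k.
        rewrite /n; elim: (s) cs => //= c' s' IH [->|/IH[k ks ->]]; first by exists 0%N.
        by exists k.+1.
      by move=> [k kn ->]; exists (Ordinal kn).
    by rewrite -BE; exact: h.
  by move=> h i _; rewrite BE; apply: h; exact: inth.
rewrite prE; last exact: measurable_constraints.
rewrite (big_nth c0) big_mkord => e; apply: EFin_inj; rewrite e.
by elim/big_rec2 : _ => // i x y _ ->.
Qed.

Definition pattern (e : set X * set X) : set Omega := ~` hit e.1 `&` hit e.2.

Definition no_pattern (es : seq (set X * set X)) : set Omega :=
  [set o | forall e, List.In e es -> ~ pattern e o].

Lemma measurable_pattern e : measurable e.1 -> measurable e.2 ->
  measurable (pattern e).
Proof.
by move=> m1 m2; apply: measurableI; [apply: measurableC|]; exact: measurable_hit.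
Qed.

Lemma no_pattern_cons e es : no_pattern (e :: es) = no_pattern es `\` pattern e.
Proof.
apply/seteqP; split => [t h|t [h1 h2] e' /= [<-//|]]; last exact: h1.
by split=> [e' e's|]; apply: h; [right|left].
Qed.

Lemma measurable_no_pattern es :
  (forall e, List.In e es -> measurable e.1 /\ measurable e.2) ->
  measurable (no_pattern es).
Proof.
elim: es => [|e es IH] mes.
  by have -> : no_pattern [::] = setT by apply/seteqP; split => // t _ e [].
rewrite no_pattern_cons; apply: measurableD; first by apply: IH => e' ?; apply: mes; right.
by have [|? ?] := mes e; [left|exact: measurable_pattern].
Qed.

(** Independence is given for conditions on single sets, while a pattern couples two. Subtracting
    the event where the pattern occurs, which only lengthens the list of constraints by two, reduces
    the failures to that case. *)
Lemma pr_no_pattern s es :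
  measurables s -> (forall e, List.In e es -> measurable e.1 /\ measurable e.2) ->
  pairwise apart ([seq c.1 | c <- s] ++ supports es) ->
  pr (constraints s `&` no_pattern es)
  = pr (constraints s) * \prod_(e <- es) (1 - pr (~` hit e.1) * pr (hit e.2)).
Proof.
elim: es s => [|e es IH] s ms mes.
  rewrite /supports /= cats0 => ds.
  have -> : no_pattern [::] = setT by apply/seteqP; split => // t _ e [].
  by rewrite setIT big_nil mulr1.
have [|me1 me2] := mes e; first by left.
have mes' e' : List.In e' es -> measurable e'.1 /\ measurable e'.2.
  by move=> ?; apply: mes; right.
rewrite /supports /= -/(supports es) pairwise_cat allrel_consr allrel_consr /=.
move=> /and3P[/and3P[s1 s2 ses] ps /and3P[/andP[e12 e1es] e2es pes]].
have flip A (l : seq (set X)) :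
    all (fun B => `[< B `&` A = set0 >]) l = all (fun B => `[< A `&` B = set0 >]) l.
  by apply: eq_all => B; rewrite setIC.
rewrite !flip in s1 s2.
pose s' := [:: (e.1, false), (e.2, true) & s].
have ms' : measurables s' by move=> c /= [<-//|[<-//|]]; exact: ms.
have mno := measurable_no_pattern mes'.
have ds' : pairwise apart ([seq c.1 | c <- s] ++ supports es).
  by rewrite pairwise_cat ses ps.
have eq1 := IH s ms mes' ds'.
have ds'' : pairwise apart ([seq c.1 | c <- s'] ++ supports es).
  rewrite pairwise_cat /= !allrel_consl.
  by rewrite ses e1es e2es ps pes e12 s1 s2.
have eq2 := IH s' ms' mes' ds''.
have mcn : measurable (constraints s `&` no_pattern es).
  by apply: measurableI => //; exact: measurable_constraints.
have := prDI P mcn (measurable_pattern me1 me2).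
rewrite no_pattern_cons setIDA => e3.
have cs' : constraints s `&` no_pattern es `&` pattern e = constraints s' `&` no_pattern es.
  rewrite /s' !constraints_cons; apply/seteqP; split => t.
    by move=> [[cs no] [n1 n2]].
  by move=> [[n1 [n2 cs]] no].
move: e3; rewrite cs' eq1 eq2 big_cons.
rewrite (pr_constraints ms') ?(pr_constraints ms)//; last first.
  by rewrite /= e12 ps s1 s2.
rewrite /s' !big_cons {1 2}/constrained /= => /eqP; rewrite -subr_eq => /eqP <-.
by ring.
Qed.

Lemma pr_no_pattern_le s es (c : R) :
  measurables s -> (forall e, List.In e es -> measurable e.1 /\ measurable e.2) ->
  pairwise apart ([seq c.1 | c <- s] ++ supports es) ->
  (forall e, List.In e es -> c <= pr (~` hit e.1) * pr (hit e.2)) ->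
  pr (constraints s `&` no_pattern es) <= pr (constraints s) * (1 - c) ^+ size es.
Proof.
move=> ms mes ds ces; rewrite (pr_no_pattern ms mes ds) ler_wpM2l ?pr_ge0//.
elim: es mes ces {ds} => [|e es IH] mes ces; first by rewrite big_nil.
rewrite big_cons exprS; have [|me1 me2] := mes e; first by left.
have ce : c <= pr (~` hit e.1) * pr (hit e.2) by apply: ces; left.
have mh1 := measurable_hit me1; have mh2 := measurable_hit me2.
have ge0 e' : List.In e' (e :: es) -> 0 <= 1 - pr (~` hit e'.1) * pr (hit e'.2).
  move=> /mes[m1 m2]; rewrite subr_ge0.
  apply: mulr_ile1; rewrite ?pr_ge0 ?pr_le1//; last exact: measurable_hit.
  exact/measurableC/measurable_hit.
apply: ler_pM => //.
- by apply: ge0; left.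
- have : forall e', List.In e' es -> 0 <= 1 - pr (~` hit e'.1) * pr (hit e'.2).
    by move=> e' ?; apply: ge0; right.
  elim: es {IH mes ces ge0} => [|e' es IH] h; first by rewrite big_nil.
  by rewrite big_cons mulr_ge0 ?IH// => [|e'' ?]; apply: h; [left|right].
- by rewrite lerD2l lerN2.
- by apply: IH => e' ?; [apply: mes|apply: ces]; right.
Qed.

(** [None] stands for infinitely many points; values in an [eqType] allow summation with
    [pr_seq_split]. *)
Definition point_count A (o : Omega) : option nat :=
  if `[< finite_set [set i | A (Phi i o)] >]
  then Some (size (finmap.enum_fset (fset_set [set i | A (Phi i o)]))) else None.

Lemma point_countP A o (k : nat) :
  point_count A o = Some k <-> npoints Phi A o = k%:R%:E :> \bar R.
Proof.
rewrite /point_count /npoints /counting; case: ifP => _; last by split.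
split=> [[->]//|[] /eqP]; rewrite eqr_nat => /eqP -> //.
Qed.

Lemma measurable_point_count A k : measurable A ->
  measurable [set o | point_count A o = k].
Proof.
move=> mA; have mPhi i : measurable (Phi i @^-1` A).
  by have [mPhi _ _ _] := PhiP; rewrite -[_ @^-1` _]setTI; exact: mPhi.
have mSome (n : nat) : measurable [set o | point_count A o = Some n].
  (* There are countably many candidates [s] for the finite set of indices falling in [A]. *)
  pose F (s : seq nat) := if size (finmap.enum_fset (fset_set [set` s])) == n
    then \bigcap_i (if i \in s then Phi i @^-1` A else ~` (Phi i @^-1` A)) else set0.
  rewrite (_ : [set o | _] = \bigcup_s F s).
    apply: countable_bigcupT_measurable => // s; rewrite /F; case: ifP => // _.
    by apply: bigcapT_measurable => i; case: ifP => _ //; exact: measurableC.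
  apply/seteqP; split => t /=.
    rewrite /point_count; case: ifPn => // /asboolP fA [cA].
    have [s sE] := (finite_seqP _).1 fA.
    exists s => //; rewrite /F -sE cA eqxx => i _.
    case: ifPn => [si|/negP iA Ai]; first by have : [set` s] i by []; rewrite -sE.
    by apply: iA; have : [set i | A (Phi i t)] i by []; rewrite sE.
  move=> [s _]; rewrite /F; case: eqP => // <- h.
  rewrite /point_count; have -> : [set i | A (Phi i t)] = [set` s].
    by apply/seteqP; split => i /=; have := h i I; case: ifP.
  by rewrite asboolT//; exact: finite_seq.
case: k => [n|]; first exact: mSome.
rewrite (_ : [set o | _] = ~` \bigcup_n [set o | point_count A o = Some n]).
  by apply/measurableC/bigcupT_measurable.
apply/seteqP; split => t /= h; first by move=> [n _ /=]; rewrite h.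
by case e : (point_count A t) => [n|//]; case: h; exists n.
Qed.

(** The Poisson weights sum to one: the partial sums of the exponential series, times expR (- a),
    leave arbitrarily little mass for an infinite count. *)
Lemma finite_points A a : measurable A -> mu A = a%:E ->
  {ae P, forall o, finite_set [set i | A (Phi i o)]}.
Proof.
move=> mA muA; apply: negligible_small => eps eps0.
have mN k := measurable_point_count k mA.
pose s n : seq (option nat) := [seq Some k | k <- iota 0 n].
have sum_s n : pr [set o | point_count A o \in s n]
    = series (exp_coeff a) n * expR (- a).
  have us : uniq (s n) by rewrite map_inj_uniq ?iota_uniq// => ? ? [].
  have := pr_seq_split P us measurableT mN; rewrite setTI => ->.
  rewrite big_map /series /= mulr_suml /index_iota subn0; apply: eq_bigr => k _.
  have -> : [set o | point_count A o = Some k] = [set o | npoints Phi A o = k%:R%:E :> \bar R].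
    by apply/seteqP; split => t /= /point_countP.
  rewrite setTI.
  have [_ pmf _ _] := PhiP.
  by rewrite /pr pmf ?muA.
have := is_cvg_series_exp_coeff a; rewrite -/(expR a) => /cvgrPdist_le.
have e0 : 0 < eps * expR a by rewrite mulr_gt0 ?expR_gt0.
move=> /(_ _ e0)[n _ /(_ n (leqnn n))]; rewrite ler_norml => /andP[_ ne].
have ms : measurable [set o | point_count A o \in s n].
  rewrite (_ : [set o | _] = [set o | exists2 k, k \in s n & point_count A o = k]).
    exact: measurable_exists.
  by apply/seteqP; split => t /=; [exists (point_count A t)|move=> [k ks ->]].
exists (~` [set o | point_count A o \in s n]); first exact: measurableC.
split.
  move=> t /= inf; rewrite /point_count; case: ifPn => [/asboolP//|_].
  by move=> /mapP[].
have := prDI P measurableT ms; rewrite setTD setTI prT sum_s.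
have h : expR a * expR (- a) = 1 by rewrite -expRD subrr expR0.
have := ler_wpM2r (expR_ge0 (- a)) ne.
by rewrite mulrBl -mulrA h mulr1; lra.
Qed.

End PoissonEvents.

Lemma geometric_small (R : realType) (x C eps : R) : 0 <= x -> x < 1 -> 0 < eps ->
  exists N : nat, C * x ^+ N <= eps.
Proof.
move=> x0 x1 e0.
have : geometric C x @ \oo --> (0 : R) by apply: cvg_geometric; rewrite ger0_norm.
move=> /cvgrPdist_le /(_ _ e0)[N _ /(_ N (leqnn N))].
by rewrite /= sub0r normrN => /(le_trans (ler_norm _)) h; exists N.
Qed.

(** * Almost sure properties of the Poisson points of one tree *)

Section TreeProcess.
Context {R : realType} {p : nat} {T : marked_tree p.+1}.
Hypothesis p_ge2 : (2 <= p)%N.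
Context {dO : measure_display} {Omega : measurableType dO} (P : probability Omega R)
  {dB : measure_display} {B : measurableType dB} (mu : {measure set (B * int) -> \bar R})
  (Phi : nat -> Omega -> B * int).
Hypothesis PhiP : poisson_point_process P Phi mu.
Variable nucleus : B -> option (end_of T).

Definition box (v : T) (J : set int) : set (B * int) :=
  [set y | (exists2 w, nucleus y.1 = Some w & w (lvl v) = v) /\ J y.2].

Hypothesis measurable_box : forall v J, measurable (box v J).
Variable c0 : R.
Hypothesis c0_gt0 : 0 < c0.
Local Notation r := (p%:R : R).
Hypothesis mu_box1 : forall v i, (0 < lvl v)%N ->
  mu (box v [set i]) = (c0 * r ^ (i - (lvl v)%:Z))%:E.
Hypothesis mu_box_lt : forall v t, (0 < lvl v)%N ->
  exists2 a, mu (box v [set i | i < t]) = a%:E & a <= c0 * r ^ (t - (lvl v)%:Z).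

(** [nucleus] is partial, so points whose end lies in the other tree are left out and the same
    argument serves both trees. *)
Definition points o : set nat := [set i | exists w, nucleus (Phi i o).1 = Some w].
Definition point_end o i : end_of T := odflt base_end (nucleus (Phi i o).1).
Definition point_delay o i : int := (Phi i o).2.

Local Notation S := points.
Local Notation w := point_end.
Local Notation D := point_delay.
Local Notation pr := (pr P).
Local Notation hit := (hit Phi).
Implicit Types (v x y z : T) (i j k : nat) (o : Omega).

Lemma boxP v J i o : box v J (Phi i o) <-> [/\ S o i, w o i (lvl v) = v & J (D o i)].
Proof.
rewrite /box /points /point_end /point_delay /=; split.
  by move=> [[u -> uv] J']; split => //; exists u.
by move=> [[u ->] uv J']; split => //; exists u.
Qed.

Lemma hit_boxP v J o : hit (box v J) o <->
  exists i, [/\ S o i, w o i (lvl v) = v & J (D o i)].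
Proof. by split=> [[i /boxP]|[i /boxP]]; exists i. Qed.

Let r_ge2 : 2 <= r. Proof. by rewrite ler_nat. Qed.
Let r_gt0 : 0 < r. Proof. by apply: lt_le_trans r_ge2; rewrite ltr0n. Qed.
Let r_ge1 : 1 <= r. Proof. by apply: le_trans r_ge2; rewrite ler1n. Qed.
Let r_neq0 : r != 0. Proof. by rewrite gt_eqF. Qed.

Let expD (a b : int) : r ^ (a + b) = r ^ a * r ^ b.
Proof. exact: expfzDr. Qed.

Let expB (a : int) (n : nat) : r ^ (a - n%:Z) = r ^ a / r ^+ n.
Proof. by rewrite expD -invr_expz. Qed.

Let measurable_hit_box v J : measurable (hit (box v J)).
Proof. exact: (measurable_hit PhiP). Qed.

Lemma pr_hit_box v (t : int) : (0 < lvl v)%N ->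
  pr (hit (box v [set t])) <= c0 * r ^ t / r ^+ lvl v.
Proof.
move=> v0; rewrite -mulrA -expB.
exact: (pr_hit_le PhiP (measurable_box _ _) (mu_box1 _ v0)).
Qed.

Lemma sum_sphere_le (F : T -> R) (c : R) n : 0 <= c -> (0 < n)%N ->
  (forall v, lvl v = n -> F v <= c) -> \sum_(v <- sphere n) F v <= 2 * r ^+ n * c.
Proof.
move=> c_ge0 n0 Fc; apply: (@le_trans _ _ (\sum_(v <- sphere n : seq T) c)).
  by rewrite big_seq [leRHS]big_seq ler_sum// => v; rewrite mem_sphere => /eqP /Fc.
rewrite big_const_seq count_predT iter_addr_0 -{1}(prednK n0) size_sphereS.
rewrite -[leLHS]mulr_natr mulrC ler_wpM2r// -natrX -natrM ler_nat.
by rewrite -{2}(prednK n0) expnS mulnA leq_mul2r; apply/orP; right; lia.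
Qed.

Lemma ae_nucleus_not_base (D0 : int) : {ae P, forall o, forall i, S o i -> D o i = D0 ->
  exists n, w o i n <> base_end n}.
Proof.
apply: negligible_small => eps e0.
have [|||N Nle] := @geometric_small R r^-1 (c0 * r ^ D0 / r) eps.
- by rewrite invr_ge0 ltW.
- by rewrite invf_lt1//; apply: lt_le_trans r_ge2; rewrite ltr1n.
- by [].
exists (hit (box (base_end N.+1) [set D0])); first exact: measurable_hit_box.
split.
  move=> o /existsNP[i] /not_implyP[Si] /not_implyP[Di wi].
  apply/hit_boxP; exists i; split => //; rewrite lvl_ray.
  by apply: contrapT => wN; apply: wi; exists N.+1.
apply: le_trans (pr_hit_box _ _) _; rewrite ?lvl_ray//.
by apply: le_trans Nle; rewrite exprS invfM exprVn !mulrA.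
Qed.

(** Different delays make the two boxes over a vertex disjoint, hence independent. A union bound
    over level N costs about r^N against r^(-2N). *)
Lemma ae_separated (D1 D2 : int) : D1 <> D2 ->
  {ae P, forall o, forall i k, S o i -> S o k -> D o i = D1 -> D o k = D2 ->
    exists n, w o i n <> w o k n}.
Proof.
move=> D12; apply: negligible_small => eps e0.
have [|||N Nle] := @geometric_small R r^-1 (2 * (c0 * r ^ D1) * (c0 * r ^ D2) / r) eps.
- by rewrite invr_ge0 ltW.
- by rewrite invf_lt1//; apply: lt_le_trans r_ge2; rewrite ltr1n.
- by [].
pose cs v := [:: (box v [set D1], true); (box v [set D2], true)].
have mcs v : measurables (cs v) by move=> c /= [<-|[<-|//]]; exact: measurable_box.
exists [set o | exists2 v, v \in sphere N.+1 & constraints Phi (cs v) o].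
  by apply: measurable_exists => v; exact: (measurable_constraints PhiP).
split.
  move=> o /existsNP[i] /existsNP[k] /not_implyP[Si] /not_implyP[Sk].
  move=> /not_implyP[Di] /not_implyP[Dk wik].
  have {}wik n : w o i n = w o k n by apply: contrapT => h; apply: wik; exists n.
  exists (w o i N.+1); first by rewrite mem_sphere lvl_ray.
  move=> c [<-|[<-|//]]; apply/hit_boxP; rewrite lvl_ray; first by exists i.
  by exists k.
apply: le_trans (pr_exists_le _ _ _) _.
  by move=> v; exact: (measurable_constraints PhiP).
apply: le_trans
  (sum_sphere_le (c := c0 * r ^ D1 / r ^+ N.+1 * (c0 * r ^ D2 / r ^+ N.+1)) _ _ _) _ => //.
- by rewrite !mulr_ge0 ?invr_ge0 ?exprz_ge0 ?exprn_ge0// ltW.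
- move=> v vN; rewrite (pr_constraints PhiP (mcs v)); last first.
    rewrite /= !andbT; apply/asboolP/seteqP; split => // y [[_ y1] [_ y2]].
    by apply: D12; rewrite -y1 -y2.
  rewrite !big_cons big_nil mulr1 /constrained /=.
  by apply: ler_pM; rewrite ?pr_ge0// -vN; apply: pr_hit_box; rewrite vN.
apply: le_trans Nle; rewrite le_eqVlt; apply/orP; left; apply/eqP.
rewrite exprVn exprS; field.
by rewrite expf_neq0 r_neq0.
Qed.

Lemma expRN_le (x : R) : 0 < x -> expR (- x) <= 2 / x ^+ 2.
Proof.
move=> x0; rewrite expRN -[leRHS]invrK lef_pV2 ?posrE ?expR_gt0//; last first.
  by rewrite invr_gt0 divr_gt0 ?exprn_gt0.
rewrite invfM invrK mulrC.
have := @expR_ge1Dxn _ x 1 (ltW x0); have -> : 2`!%:R = 2 :> R by []; lra.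
Qed.

Lemma ae_dense (b : int) : {ae P, forall o, exists L : nat, forall v, (L <= lvl v)%N ->
  exists j, [/\ S o j, w o j (lvl v) = v & D o j = (lvl v).*2%:Z - b]}.
Proof.
pose Fv v := ~` hit (box v [set ((lvl v).*2%:Z - b : int)]).
have mFv v : measurable (Fv v) by exact: measurableC.
pose F n := [set o | exists2 v, v \in sphere n.+1 & Fv v o].
have mF n : measurable (F n) by exact: measurable_exists.
(* The box over a vertex of level n with delay 2n - b has mean K r^n. The quadratic bound [expRN_le]
   on its void probability already beats the number of vertices of the level. *)
pose K := c0 * r ^ (- b); have K0 : 0 < K by rewrite mulr_gt0// exprz_gt0.
have F_le n : pr (F n) <= 4 / K ^+ 2 / 2 ^+ n.
  apply: le_trans (pr_exists_le _ _ mFv) _.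
  apply: le_trans (sum_sphere_le (c := 2 / (K * r ^+ n.+1) ^+ 2) _ _ _) _ => //.
  - by rewrite divr_ge0// exprn_ge0// mulr_ge0 ?exprn_ge0// ltW.
  - move=> v vn; rewrite /Fv.
    rewrite (pr_void PhiP (measurable_box _ _) (mu_box1 _ _)); last by rewrite vn.
    have -> : c0 * r ^ ((lvl v).*2%:Z - b - (lvl v)%:Z) = K * r ^+ n.+1.
      rewrite vn (_ : _ - _ - _ = - b + n.+1%:Z); last by lia.
      by rewrite expD mulrA.
    by apply: expRN_le; rewrite mulr_gt0 ?exprn_gt0.
  apply: (@le_trans _ _ (4 / K ^+ 2 / r ^+ n.+1)).
    rewrite le_eqVlt; apply/orP; left; apply/eqP; field.
    by rewrite expf_neq0//= gt_eqF.
  rewrite ler_pM2l ?divr_gt0 ?exprn_gt0// lef_pV2 ?posrE ?exprn_gt0//.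
  rewrite exprS; apply: le_trans (ler_peMl _ r_ge1); last by rewrite exprn_ge0// ltW.
  by rewrite lerXn2r// nnegrE// ltW.
have sum_le n : \sum_(0 <= k < n) pr (F k) <= 8 / K ^+ 2 * (1 - (2^-1) ^+ n).
  elim: n => [|n IH]; first by rewrite big_nil expr0 subrr mulr0.
  rewrite big_nat_recr//=; apply: le_trans (lerD IH (F_le n)) _.
  rewrite le_eqVlt; apply/orP; left; apply/eqP.
  rewrite [2^-1 ^+ n.+1]exprS -[(2 ^+ n)^-1]exprVn; move: (2^-1 ^+ n) => u.
  by field; rewrite gt_eqF.
have sum_lt : (\sum_(n <oo) P (F n) < +oo)%E.
  apply: (@le_lt_trans _ _ (8 / K ^+ 2)%:E); last by rewrite ltry.
  apply: lime_le; first by apply: is_cvg_nneseries => n _ _; exact: measure_ge0.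
  near=> n.
  have -> : (\sum_(0 <= k < n) P (F k) = (\sum_(0 <= k < n) pr (F k))%:E)%E.
    by rewrite -sumEFin; apply: eq_bigr => k _; rewrite prE.
  rewrite lee_fin; apply: le_trans (sum_le n) _.
  have u0 : 0 <= 2^-1 ^+ n :> R by rewrite exprn_ge0// invr_ge0.
  have k0 : 0 <= 8 / K ^+ 2 by rewrite divr_ge0// exprn_ge0// ltW.
  by rewrite ler_piMr//; lra.
exists (lim_sup_set F); split.
- apply: bigcapT_measurable => n; exact: bigcup_measurable.
- exact: lim_sup_set_cvg0.
move=> o nL n _; apply: contrapT => nF; apply: nL; exists n.+1 => v nv.
have lv : (lvl v).-1.+1 = lvl v by rewrite prednK//; exact: leq_trans nv.
apply: contrapT => nj; apply: nF; exists (lvl v).-1; first by rewrite /= -ltnS lv.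
exists v; first by rewrite lv mem_sphere.
by move=> /hit_boxP[i [Si wi Di]]; apply: nj; exists i.
Unshelve. all: by end_near.
Qed.

Lemma box_sub v v' J : in_cone v v' -> box v' J `<=` box v setT.
Proof.
move=> vv' y [[u yu uv] _]; split => //; exists u => //.
by rewrite -(anc_ray u (in_cone_lvl vv')) uv (eqP vv').
Qed.

Lemma box_apart v v' J J' : ~~ in_cone v v' -> ~~ in_cone v' v ->
  box v J `&` box v' J' = set0.
Proof.
move=> nv nv'; apply/seteqP; split => // y [[[u yu uv] _] [[u' yu' uv'] _]].
have uu : u' = u by move: yu; rewrite yu' => -[].
have [vv'|v'v] := leqP (lvl v) (lvl v').
  by move/negP: nv; apply; rewrite /in_cone -uv' uu anc_ray// uv.
by move/negP: nv'; apply; rewrite /in_cone -uv -uu anc_ray ?uv'// ltnW.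
Qed.

Lemma off_apart x z v J J' : par z = x -> lvl z = (lvl x).+1 -> in_cone z v ->
  box v J `&` box (off x z) J' = set0.
Proof.
move=> zx lz zv; have [px lx oz] := offP p_ge2 x z.
have zo : ~~ in_cone (off x z) z.
  by rewrite /in_cone lx -lz anc_id// eq_sym.
have oz' : ~~ in_cone z (off x z) by rewrite /in_cone lz -lx anc_id.
apply: subsetI_eq0 (box_sub zv) (@subset_refl _ _) _.
exact: box_apart.
Qed.

Lemma pr_void_ge A a (b : R) : measurable A -> mu A = a%:E -> a <= b ->
  expR (- b) <= pr (~` hit A).
Proof. by move=> mA muA ab; rewrite (pr_void PhiP mA muA) ler_expR lerN2. Qed.

Lemma pr_hit_ge A a (b : R) : measurable A -> mu A = a%:E -> b <= a ->
  1 - expR (- b) <= pr (hit A).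
Proof.
by move=> mA muA ab; rewrite (pr_hit PhiP mA muA) lerD2l lerN2 ler_expR lerN2.
Qed.

Lemma expR_product_itv (a b : R) : 0 <= a -> 0 < b ->
  0 < expR (- a) * (1 - expR (- b)) <= 1.
Proof.
move=> a0 b0; have b1 : expR (- b) < 1 by rewrite expR_lt1 oppr_lt0.
have a1 : expR (- a) <= 1 by rewrite expR_le1 oppr_le0.
have := expR_gt0 (- b); have := expR_gt0 (- a) => h1 h2.
rewrite mulr_gt0 ?subr_gt0//=; apply: mulr_ile1 => //; lra.
Qed.

Section Parity.
Variables (D0 : int) (n0 : nat).

(* the largest integer at most k with the parity of D0 *)
Let t k : int := D0 + ((k%:Z - D0) %/ 2)%Z + ((k%:Z - D0) %/ 2)%Z.

Let t_itv k : k%:Z - 1 <= t k <= k%:Z.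
Proof. by rewrite /t; lia. Qed.

(** When it occurs, the least delay in the side branch is [t k], which has the parity of D0. *)
Definition parity_pattern k x z :=
  (box (off x z) [set i | i < t k], box (off x z) [set t k]).

Let es v m := [seq parity_pattern k (anc k v) (anc k.+1 v) | k <- iota n0 m].

(** Since k - 1 <= t k <= k and the branch starts at level k + 1, the set to be void has mean at
    most c0 and the one to be hit has mean at least c0 / r^2. *)
Let c := expR (- c0) * (1 - expR (- (c0 / r ^+ 2))).

Let c_itv : 0 < c <= 1.
Proof. by apply: expR_product_itv; rewrite ?ltW// divr_gt0// exprn_gt0. Qed.

Let pattern_ge k x z : lvl x = k ->
  c <= pr (~` hit (parity_pattern k x z).1) * pr (hit (parity_pattern k x z).2).
Proof.
move=> xk; have [_ lo _] := offP p_ge2 x z; have lo0 : (0 < lvl (off x z))%N by rewrite lo.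
have [a mua ale] := mu_box_lt (t k) lo0; have /andP[t1 t2] := t_itv k.
apply: ler_pM; rewrite ?expR_ge0//.
- by rewrite subr_ge0 expR_le1 oppr_le0 divr_ge0// ?exprn_ge0 ltW.
- apply: (pr_void_ge (measurable_box _ _) mua); apply: le_trans ale _.
  apply: ler_piMr; first exact: ltW.
  rewrite -[leRHS](expr0z r); apply: ler_weXz2l => //.
  by rewrite lo xk; clear - t1 t2; lia.
- apply: (pr_hit_ge (measurable_box _ _) (mu_box1 _ lo0)).
  rewrite ler_pM2l// exprnN; apply: ler_weXz2l => //.
  by rewrite lo xk; clear - t1 t2; lia.
Qed.

Lemma ae_parity_pattern : {ae P, forall o, forall i, S o i -> D o i = D0 ->
  exists n, (n0 <= n)%N /\ pattern Phi (parity_pattern n (w o i n) (w o i n.+1)) o}.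
Proof.
apply: negligible_small => eps e0.
have /andP[cgt0 cle1] := c_itv.
have [|||m Mle] := @geometric_small R (1 - c) (2 * c0 * r ^ D0) eps; [lra|lra|by []|].
pose N := (n0 + m).+1.
have mes v e : List.In e (es v m.+1) -> measurable e.1 /\ measurable e.2.
  rewrite /es; elim: (iota n0 m.+1) => //= k l IH [<-|/IH//].
  by split; exact: measurable_box.
pose s v := [:: (box v [set D0], true)].
have ms v : measurables (s v) by move=> e /= [<-|//]; exact: measurable_box.
(* A point of delay D0 passes through [v] and all side branches at levels n0, ..., n0 + m fail.
   These branches are disjoint from the cone of [v], so the two requirements are independent. *)
pose bad v := constraints Phi (s v) `&` no_pattern Phi (es v m.+1).
have mbad v : measurable (bad v).
  apply: measurableI; first exact: (measurable_constraints PhiP (ms v)).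
  exact: (measurable_no_pattern PhiP (mes v)).
exists [set o | exists2 v, v \in sphere N & bad v o]; first exact: measurable_exists.
split.
  move=> o /existsNP[i] /not_implyP[Si] /not_implyP[Di ni].
  exists (w o i N); first by rewrite mem_sphere lvl_ray.
  split; first by move=> e /= [<-|//]; apply/hit_boxP; exists i; rewrite lvl_ray.
  move=> e; rewrite /es => ein pe.
  have [k [nk kN ek]] : exists k, [/\ (n0 <= k)%N, (k < N)%N
      & e = parity_pattern k (anc k (w o i N)) (anc k.+1 (w o i N))].
    have : forall k, k \in iota n0 m.+1 -> (n0 <= k < N)%N.
      by move=> k; rewrite mem_iota /N addnS.
    elim: (iota n0 m.+1) ein => //= k l IH [<-|el] kl.
      by exists k; have /andP[] := kl k (mem_head _ _).
    by apply: IH => // j jl; apply: kl; rewrite inE jl orbT.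
  by apply: ni; exists k; split => //; rewrite ek (anc_ray _ (ltnW kN)) (anc_ray _ kN) in pe.
apply: le_trans (pr_exists_le _ _ mbad) _.
have bound v : lvl v = N -> pr (bad v) <= c0 * r ^ D0 / r ^+ N * (1 - c) ^+ m.+1.
  move=> vN; have Nv k : (k < n0 + m.+1)%N -> (k < lvl v)%N by rewrite vN /N -addnS.
  have ds : pairwise (fun A B => `[< A `&` B = set0 >])
      (box v [set D0] :: supports (es v m.+1)).
    have kidv k : (n0 <= k < n0 + m.+1)%N -> [/\ par (anc k.+1 v) = anc k v,
        lvl (anc k.+1 v) = (lvl (anc k v)).+1 & lvl (anc k v) = k].
      by move=> /andP[_ /Nv kv]; have kv' := ltnW kv; rewrite par_anc// !lvl_anc.
    apply: (@apart_supports_cons _ _ (fun k => parity_pattern k (anc k v) (anc k.+1 v))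
      (fun k => box (off (anc k v) (anc k.+1 v)) setT)).
    + move=> k _; split; try by move=> y [].
      apply/seteqP; split => // y [[_ /= y1] [_ /= y2]].
      by rewrite y2 ltxx in y1.
    + move=> j k nj jk km.
      have jnm : (n0 <= j < n0 + m.+1)%N by rewrite nj (ltn_trans jk km).
      have knm : (n0 <= k < n0 + m.+1)%N by rewrite km (leq_trans nj (ltnW jk)).
      have [pj lj lj'] := kidv j jnm; have [pk lk lk'] := kidv k knm.
      rewrite setIC; apply: off_apart => //.
      have [po lo _] := offP p_ge2 (anc k v) (anc k.+1 v).
      rewrite /in_cone lj lj'.
      have kv := Nv k km.
      by rewrite -(anc_par (x := off _ _)) ?lo ?lk'// po anc_anc.
    + move=> k nk; have [pk lk lk'] := kidv k nk.
      by apply: off_apart => //; exact: in_cone_anc.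
  have ces e : List.In e (es v m.+1) -> c <= pr (~` hit e.1) * pr (hit e.2).
    rewrite /es.
    have : forall k, k \in iota n0 m.+1 -> (k < n0 + m.+1)%N.
      by move=> k; rewrite mem_iota => /andP[].
    elim: (iota n0 m.+1) => //= k l IH kl [<-|el]; last first.
      by apply: IH el => j jl; apply: kl; rewrite inE jl orbT.
    by apply: pattern_ge; rewrite lvl_anc// ltnW// Nv// kl// mem_head.
  apply: le_trans (pr_no_pattern_le PhiP (ms v) (mes v) ds ces) _.
  rewrite /es size_map size_iota ler_wpM2r ?exprn_ge0 ?subr_ge0//.
  rewrite (pr_constraints PhiP (ms v))// big_seq1 /constrained /= -vN.
  by apply: pr_hit_box; rewrite vN.
apply: le_trans (sum_sphere_le _ _ bound) _ => //.
  by rewrite !mulr_ge0 ?invr_ge0 ?exprz_ge0 ?exprn_ge0 ?subr_ge0// ltW.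
rewrite [leLHS](_ : _ = 2 * c0 * r ^ D0 * (1 - c) ^+ m * (1 - c)); last first.
  by rewrite exprSr; field; rewrite expf_neq0.
apply: le_trans _ Mle; rewrite ler_piMr//; last by rewrite lerBlDr lerDl ltW.
by rewrite !mulr_ge0 ?exprz_ge0 ?exprn_ge0 ?subr_ge0// ltW.
Qed.

End Parity.

Lemma sum_powers_le a n : \sum_(l <- iota a n) r ^+ l <= r ^+ (a + n).
Proof.
suff : \sum_(l <- iota a n) r ^+ l <= r ^+ (a + n) - r ^+ a.
  by move=> /le_trans; apply; rewrite lerBlDr lerDl exprn_ge0// ltW.
elim: n a => [|n IH] a; first by rewrite big_nil addn0 subrr.
rewrite big_cons -addSnnS; apply: le_trans (lerD (lexx _) (IH a.+1)) _.
have : 2 * r ^+ a <= r ^+ a.+1 by rewrite exprS ler_pM2r ?exprn_gt0.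
lra.
Qed.

Section Horosphere.
Variables (m t : int).

(** A ray sharing l edges with the geodesic to [v] gives the value D + |v| - 2l at [v]. The union
    over n < l <= |v| collects the points behind [anc n.+1 v] whose value is below t. *)
Let below v n : set (B * int) :=
  [set y | exists2 l, l \in iota n.+1 (lvl v - n)
    & box (anc l v) [set i | i < t - (lvl v)%:Z + l%:Z + l%:Z] y].

(* the delayed horofunctions of the points behind the n-th vertex of the base
   ray are minimal at v, with value t *)
Definition horosphere_pattern n v :=
  (below v n, box v [set (lvl v)%:Z + t]).

Let measurable_below v n : measurable (below v n).
Proof. exact: measurable_exists. Qed.

(** The l-th box has mean at most c0 r^(t - |v| + l): the geometric sum is dominated by l = |v|,
    uniformly in n and v. *)
Let mu_below v n : exists2 a, mu (below v n) = a%:E & a <= c0 * r ^ (t + 1).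
Proof.
have bound : (mu (below v n) <= (c0 * r ^ (t + 1))%:E)%E.
  apply: le_trans (measure_exists_le mu _ _) _; first by move=> l; exact: measurable_box.
  apply: (@le_trans _ _ (\sum_(l <- iota n.+1 (lvl v - n))
      (c0 * r ^ (t - (lvl v)%:Z) * r ^+ l)%:E)%E).
    rewrite big_seq [leRHS]big_seq; apply: lee_sum => l; rewrite mem_iota => /andP[nl ln].
    have lv : (l <= lvl v)%N by lia.
    have l0 : (0 < lvl (anc l v))%N by rewrite lvl_anc//; lia.
    have [a -> ale] := mu_box_lt (t - (lvl v)%:Z + l%:Z + l%:Z) l0.
    rewrite lee_fin; apply: le_trans ale _; rewrite lvl_anc// -mulrA ler_pM2l//.
    by rewrite exprnP -expD addrK.
  rewrite sumEFin lee_fin -mulr_sumr -mulrA ler_pM2l//.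
  have [vn|nv] := leqP (lvl v) n.
    have -> : (lvl v - n)%N = 0%N by lia.
    by rewrite big_nil mulr0 exprz_ge0// ltW.
  apply: (@le_trans _ _ (r ^ (t - (lvl v)%:Z) * r ^+ (n.+1 + (lvl v - n)))).
    by rewrite ler_pM2l ?exprz_gt0// sum_powers_le.
  rewrite exprnP -expD; apply: ler_weXz2l => //; lia.
have fin : mu (below v n) \is a fin_num.
  by rewrite ge0_fin_numE ?measure_ge0//; apply: le_lt_trans bound _; rewrite ltry.
exists (fine (mu (below v n))); first by rewrite fineK.
by rewrite -lee_fin fineK.
Qed.

Let c := expR (- (c0 * r ^ (t + 1))) * (1 - expR (- (c0 * r ^ t))).

Let c_itv : 0 < c <= 1.
Proof. by apply: expR_product_itv; [apply: ltW|]; rewrite mulr_gt0 ?exprz_gt0. Qed.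

Let pattern_ge n v : (0 < lvl v)%N ->
  c <= pr (~` hit (horosphere_pattern n v).1) * pr (hit (horosphere_pattern n v).2).
Proof.
move=> v0; have [a mua ale] := mu_below v n.
apply: ler_pM; rewrite ?expR_ge0//.
- by rewrite subr_ge0 expR_le1 oppr_le0 ltW// mulr_gt0 ?exprz_gt0.
- exact: (pr_void_ge (measurable_below v n) mua).
- apply: (pr_hit_ge (measurable_box _ _) (mu_box1 _ v0)).
  by have -> : (lvl v)%:Z + t - (lvl v)%:Z = t by lia.
Qed.

Lemma ae_horosphere_pattern n0 : {ae P, forall o, exists n v,
  [/\ (n0 <= n)%N, coal base_end v = n, (n < lvl v)%N, buse base_end v = m
    & pattern Phi (horosphere_pattern n v) o]}.
Proof.
apply: negligible_small => eps e0.
have /andP[cgt0 cle1] := c_itv.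
have [|||M Mle] := @geometric_small R (1 - c) 1 eps; [lra|lra|by []|].
(* Makes m + n positive for n >= n1, as [horosphere_vertex] requires. *)
pose n1 := (n0 + absz m).+1%N.
have [f fP] : exists f : nat -> T, forall n, (n1 <= n)%N ->
  [/\ coal base_end (f n) = n, (n < lvl (f n))%N, (lvl (f n))%:Z = m + n%:Z + n%:Z
    & in_cone (off (base_end n) (base_end n.+1)) (f n)].
  have ex n : exists v, (n1 <= n)%N -> [/\ coal base_end v = n, (n < lvl v)%N,
      (lvl v)%:Z = m + n%:Z + n%:Z & in_cone (off (base_end n) (base_end n.+1)) v].
    have [nn|nn] := leqP n1 n; last by exists (Defs.root T).
    have [|v vP] := @horosphere_vertex p T p_ge2 m n; first by rewrite /n1 in nn; clear - nn; lia.
    by exists v.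
  by have [f fP] := choice ex; exists f.
pose es := [seq horosphere_pattern n (f n) | n <- iota n1 M].
have mes e : List.In e es -> measurable e.1 /\ measurable e.2.
  rewrite /es; elim: (iota n1 M) => //= n l IH [<-|/IH//].
  by split; [exact: measurable_below|exact: measurable_box].
exists (no_pattern Phi es); first exact: (measurable_no_pattern PhiP mes).
split.
  move=> o h; rewrite /= in h => e.
  have : forall n, n \in iota n1 M -> (n1 <= n)%N by move=> n; rewrite mem_iota => /andP[].
  rewrite /es; elim: (iota n1 M) => //= n l IH nl [<- pe|el]; last first.
    by apply: IH => // j jl; apply: nl; rewrite inE jl orbT.
  have n1n := nl n (mem_head _ _); have [cn nv lv _] := fP n n1n.
  apply: h; exists n, (f n); split => //; first by rewrite /n1 in n1n; clear - n1n; lia.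
  by rewrite /buse cn lv; clear; lia.
have ds : pairwise (fun A A' : set (B * int) => `[< A `&` A' = set0 >]) (supports es).
  apply: (@apart_supports _ (fun n => horosphere_pattern n (f n))
    (fun n => box (off (base_end n) (base_end n.+1)) setT)).
  - move=> n /andP[n1n _]; have [cn nv lv bv] := fP n n1n.
    have [pb lb _] := offP p_ge2 (@base_end _ T n) (@base_end _ T n.+1); rewrite lvl_ray in lb.
    split.
    + move=> y [l]; rewrite mem_iota => /andP[nl lv'] /box_sub; apply.
      by rewrite /in_cone anc_anc// lb.
    + by apply: box_sub.
    + apply/seteqP; split => // y [[l]]; rewrite mem_iota => /andP[nl ln].
      move=> [_ /= y1] [_ /= y2]; rewrite y2 in y1.
      by clear - y1 ln nv; lia.
  - move=> j n n1j jn nM; rewrite setIC; apply: off_apart.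
    + exact: par_ray.
    + by rewrite !lvl_ray.
    + have [pb lb _] := offP p_ge2 (@base_end _ T n) (@base_end _ T n.+1).
      by rewrite /in_cone lvl_ray -anc_par ?lb ?lvl_ray// pb anc_ray.
have ces e : List.In e es -> c <= pr (~` hit e.1) * pr (hit e.2).
  have : forall n, n \in iota n1 M -> (n1 <= n)%N by move=> n; rewrite mem_iota => /andP[].
  rewrite /es; elim: (iota n1 M) => //= n l IH nl [<-|el]; last first.
    by apply: IH => // j jl; apply: nl; rewrite inE jl orbT.
  have [_ nv _ _] := fP n (nl n (mem_head _ _)).
  by apply: pattern_ge; apply: leq_ltn_trans nv.
have ms0 : measurables ([::] : seq (set (B * int) * bool)) by [].
have := pr_no_pattern_le PhiP ms0 mes ds ces.
rewrite constraints_nil setTI prT /es size_map size_iota => /le_trans; apply.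
exact: Mle.
Qed.

End Horosphere.

End TreeProcess.

Section GenericPoints.
Context {R : realType} {p : nat} {T : marked_tree p.+1}.
Hypothesis p_ge2 : (2 <= p)%N.
Context {dO : measure_display} {Omega : measurableType dO} (P : probability Omega R)
  {dB : measure_display} {B : measurableType dB} (mu : {measure set (B * int) -> \bar R})
  (Phi : nat -> Omega -> B * int).
Hypothesis PhiP : poisson_point_process P Phi mu.
Variable nucleus : B -> option (end_of T).
Hypothesis measurable_box : forall v J, measurable (box nucleus v J).
Variable c0 : R.
Hypothesis c0_gt0 : 0 < c0.
Hypothesis mu_box1 : forall (v : T) i, (0 < lvl v)%N ->
  mu (box nucleus v [set i]) = (c0 * p%:R ^ (i - (lvl v)%:Z))%:E.
Hypothesis mu_box_lt : forall (v : T) t, (0 < lvl v)%N ->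
  exists2 a, mu (box nucleus v [set i | i < t]) = a%:E
    & a <= c0 * p%:R ^ (t - (lvl v)%:Z).
Hypothesis finite_delays : {ae P, forall o, forall t : int,
  finite_set [set i | point_delay Phi o i <= t]}.

Lemma ae_forall_int (Q : int -> set Omega) :
  (forall z, {ae P, forall o, Q z o}) -> {ae P, forall o, forall z, Q z o}.
Proof.
move=> aeQ; have pos := ae_foralln (fun n => aeQ (Posz n)).
have neg := ae_foralln (fun n => aeQ (Negz n)).
by move: pos neg; apply: filterS2 => o pos neg [n|n].
Qed.

Lemma ae_and (Q Q' : set Omega) : {ae P, forall o, Q o} -> {ae P, forall o, Q' o} ->
  {ae P, forall o, Q o /\ Q' o}.
Proof. by apply: filterS2. Qed.

Lemma ae_generic_points : {ae P, forall o,
  generic_points (points Phi nucleus o) (point_end Phi nucleus o) (point_delay Phi o)}.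
Proof.
have base := ae_forall_int (ae_nucleus_not_base p_ge2 PhiP measurable_box mu_box1).
have sep : {ae P, forall o, forall D1 D2 : int, D1 <> D2 -> forall i k,
    points Phi nucleus o i -> points Phi nucleus o k ->
    point_delay Phi o i = D1 -> point_delay Phi o k = D2 ->
    exists n, point_end Phi nucleus o i n <> point_end Phi nucleus o k n}.
  apply: ae_forall_int => D1; apply: ae_forall_int => D2.
  have [->|/eqP D12] := eqVneq D1 D2; first exact: aeW.
  have := ae_separated p_ge2 PhiP measurable_box c0_gt0 mu_box1 D12.
  by apply: filterS => o h _.
have dense := ae_forall_int (ae_dense p_ge2 PhiP measurable_box c0_gt0 mu_box1).
have parity := ae_forall_int (fun D0 => ae_foralln
  (ae_parity_pattern p_ge2 PhiP measurable_box c0_gt0 mu_box1 mu_box_lt D0)).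
have all := ae_and parity (ae_and (ae_and finite_delays base) (ae_and sep dense)).
move: all; apply: filterS => o [{}parity [[fin {}base] [{}sep {}dense]]]; split.
- by move=> K; apply: sub_finite_set (fin K) => i [].
- by move=> i Si; exact: base Si erefl.
- by move=> i k Si Sk Dik; exact: sep Dik i k Si Sk erefl erefl.
- exact: dense.
- move=> i Si n0; have [n [n0n [void hity]]] := parity _ n0 i Si erefl.
  set x := point_end Phi nucleus o i n in void hity.
  set z := point_end Phi nucleus o i n.+1 in void hity.
  have [py ly yz] := offP p_ge2 x z.
  rewrite lvl_ray in ly.
  have [j [Sj wj Dj]] := (hit_boxP _ _ _ _ _).1 hity.
  rewrite ly in wj.
  exists n, (off x z), j; split; first by split => //; exact/eqP.
  split => //; first by eexists; exact: Dj.
  move=> k Sk wk; rewrite Dj leNgt; apply/negP => Dk.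
  by apply: void; apply/hit_boxP; exists k; rewrite ly.
Qed.

Lemma ae_horosphere_dense : {ae P, forall o,
  horosphere_dense (points Phi nucleus o) (point_end Phi nucleus o) (point_delay Phi o)}.
Proof.
have h := ae_forall_int (fun m => ae_forall_int (fun t => ae_foralln
  (ae_horosphere_pattern p_ge2 PhiP measurable_box c0_gt0 mu_box1 mu_box_lt m t))).
move: h; apply: filterS => o h m k n0.
have [n [v [n0n cn nv hm [void hitv]]]] := h m k n0.
have [j [Sj wj Dj]] := (hit_boxP _ _ _ _ _).1 hitv.
exists n, v, j; split => //; split => // i Si wi.
rewrite leNgt; apply/negP => gi; apply: void.
set l := coal (point_end Phi nucleus o i) v.
have lv : (l <= lvl v)%N := coal_le _ _.
have nl : (n < l)%N by rewrite le_coal nv wi eqxx.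
exists i; exists l; first by rewrite mem_iota; lia.
apply/boxP; split => //; first by rewrite lvl_anc// ray_coal.
by move: gi; rewrite /delayed /buse -/l /=; lia.
Qed.

End GenericPoints.

Section Horospheres.
Context {p : nat} {T : marked_tree p.+1}.

Lemma horosphere_infinite (m : int) : (2 <= p)%N ->
  infinite_set [set v : T | buse base_end v = m].
Proof.
move=> p_ge2.
apply: (@unbounded_infinite _ _ (fun (v : T) n => coal base_end v = n)).
  by move=> v a b <- <-.
move=> n0; pose n := (n0 + absz m).+1%N.
have [|v [cn _ lv _]] := @horosphere_vertex p T p_ge2 m n; first by rewrite /n; lia.
exists n; split; first by rewrite /n; lia.
by exists v; split => //=; rewrite /buse cn lv; lia.
Qed.

Lemma horosphere_cells_infinite (S : set nat) w D (m k : int) :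
  generic_points S w D -> horosphere_dense S w D ->
  infinite_set [set v : T | buse base_end v = m /\
    forall j, S j -> k <= delayed w D j v].
Proof.
move=> gen hd.
apply: (@unbounded_infinite _ _ (fun (v : T) n => coal base_end v = n)).
  by move=> v a b <- <-.
move=> n0; have [n [v [j [[n0n _ _] [cn hv _ _ vS]]]]] := horosphere_cells gen hd m k n0.
by exists n; split => //; exists v.
Qed.

End Horospheres.

(** * From indices of points to sets of cells *)

Section Conclusion.
Context {p q : nat} {T : marked_tree p.+1} {T' : marked_tree q.+1}.
Hypotheses (p_ge2 : (2 <= p)%N) (q_ge2 : (2 <= q)%N).
Context {V : Type} (pr1 : V -> T) (pr2 : V -> T') (mk : T -> T' -> V) (e : rel V).
Hypotheses (pr1_mk : forall v v', pr1 (mk v v') = v)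
  (pr2_mk : forall v v', pr2 (mk v v') = v')
  (mk_pr : forall z, mk (pr1 z) (pr2 z) = z)
  (eE : forall y z, e y z = adj T (pr1 y) (pr1 z) && adj T' (pr2 y) (pr2 z)).
Context (S S' : set nat) (w : nat -> end_of T) (w' : nat -> end_of T') (D : nat -> int).
Hypothesis gen : generic_points S w D.
Hypothesis gen' : p = q -> generic_points S' w' D /\ horosphere_dense S' w' D.
Hypothesis empty' : p <> q -> S' = set0.
Context (C : nat -> set V) (same : rel nat).
Hypotheses (C_side : forall j, S j -> C j = side_cell pr1 pr2 S S' w w' D j)
  (C_other : forall j, S' j -> C j = other_side_cell pr1 pr2 S S' w w' D j)
  (C_finite : forall z, finite_set [set j | C j z])
  (sameP : forall i j, S i -> if same i j then S j else S' j)
  (S_same : forall i j, S i -> S j -> same i j)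
  (S_nsame : forall i j, S i -> S' j -> ~~ same i j).
Local Notation adjC i j := (adj_pairs e (C i) (C j)).

(** Indices with the same nonempty cell all own a common vertex, hence are finite in number. *)
Lemma infinite_cells (J : set nat) : infinite_set J -> (forall j, J j -> C j !=set0) ->
  infinite_set [set C j | j in J].
Proof.
move=> iJ ne fC; apply: iJ.
apply: (@sub_finite_set _ _ (\bigcup_(A in C @` J) [set j | J j /\ C j = A])).
  by move=> j Jj; exists (C j) => //; exists j.
apply: bigcup_finite => // _ [j0 Jj0 <-]; have [z zj0] := ne j0 Jj0.
apply: sub_finite_set (C_finite z) => j [_ jE].
by rewrite /= jE.
Qed.

Lemma side_horospheres m k : infinite_set [set v' : T' | buse base_end v' = m /\
  forall j, S' j -> k <= delayed w' D j v'].
Proof.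
have [pq|pq] := pselect (p = q).
  by have [g h] := gen' pq; exact: horosphere_cells_infinite.
apply: infinite_superset (horosphere_infinite (T := T') (m := m) q_ge2).
by move=> v hv; split => // j; rewrite (empty' pq).
Qed.

Lemma side_nonempty i : S i -> C i !=set0.
Proof.
move=> Si; rewrite C_side//.
by apply: (side_cell_nonempty pr1_mk pr2_mk gen _ Si) => m k; exact: side_horospheres.
Qed.

Hypothesis C_nonempty : forall j, C j !=set0.

(** Nonemptiness is assumed for all cells: on the other side it comes from [side_nonempty] with the
    factors exchanged. *)
Lemma side_conclusion i : S i ->
  [/\ forall j, ~~ same i j -> finite_set (C i `&` C j) /\ finite_set (adjC i j),
    forall j, i != j -> same i j ->
      (infinite_set (C i `&` C j) \/ C i `&` C j = set0) /\
      (infinite_set (adjC i j) \/ adjC i j = set0),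
    [/\ infinite_set [set C j | j in [set j |
          [/\ j != i, same i j & infinite_set (C i `&` C j)]]],
        infinite_set [set C j | j in [set j |
          [/\ j != i, same i j & C i `&` C j = set0]]],
        p = q -> infinite_set [set C j | j in [set j |
          [/\ ~~ same i j, finite_set (C i `&` C j) & C i `&` C j !=set0]]]
      & p = q -> infinite_set [set C j | j in [set j |
          ~~ same i j /\ C i `&` C j = set0]]]
    & [/\ infinite_set [set C j | j in [set j |
          [/\ j != i, same i j & infinite_set (adjC i j)]]],
        infinite_set [set C j | j in [set j |
          [/\ j != i, same i j & adjC i j = set0]]],
        p = q -> infinite_set [set C j | j in [set j |
          [/\ ~~ same i j, finite_set (adjC i j) & adjC i j !=set0]]]
      & p = q -> infinite_set [set C j | j in [set j |
          ~~ same i j /\ adjC i j = set0]]]].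
Proof.
move=> Si; have hs := side_horospheres.
have nsameS' j : ~~ same i j -> S' j by move=> /negbTE ij; have := sameP j Si; rewrite ij.
have sameS j : same i j -> S j by move=> ij; have := sameP j Si; rewrite ij.
have diff j : ~~ same i j -> finite_set (C i `&` C j) /\ finite_set (adjC i j).
  move=> /nsameS' Sj; have pq : p = q.
    by apply: contrapT => pq; move: Sj; rewrite (empty' pq).
  have [g _] := gen' pq; rewrite (C_side Si) (C_other Sj); split.
    exact: (different_sides_inter p_ge2 q_ge2 mk_pr gen g).
  exact: (different_sides_adj p_ge2 q_ge2 mk_pr eE gen g).
have same_far := infinite_same_far p_ge2 eE gen (S' := S') (w' := w') Si.
split => //.
- move=> j _ /sameS Sj; rewrite (C_side Si) (C_side Sj); split.
    exact: (same_side_inter pr1_mk pr2_mk).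
  exact: (same_side_adj p_ge2 q_ge2 pr1_mk pr2_mk eE).
- split.
  + apply: infinite_cells => //.
    apply: infinite_superset (infinite_same_inter pr1_mk pr2_mk gen hs Si).
    by move=> j [ji Sj ij]; split; rewrite ?(C_side Si) ?(C_side Sj) ?S_same.
  + apply: infinite_cells => //; apply: infinite_superset same_far.
    by move=> j [ji Sj ij _]; split; rewrite ?(C_side Si) ?(C_side Sj) ?S_same.
  + move=> pq; have [g h] := gen' pq; apply: infinite_cells => //.
    apply: infinite_superset (infinite_different_inter pr1_mk pr2_mk gen g h Si).
    move=> j [Sj ij]; have nij := S_nsame Si Sj; split => //; first by have [] := diff j nij.
    by rewrite (C_side Si) (C_other Sj).
  + move=> pq; have [g h] := gen' pq; apply: infinite_cells => //.
    apply: infinite_superset (infinite_different_far p_ge2 q_ge2 eE gen g Si).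
    by move=> j [Sj ij _]; rewrite /= (C_side Si) (C_other Sj) S_nsame.
- split.
  + apply: infinite_cells => //.
    apply: infinite_superset (infinite_same_adj p_ge2 q_ge2 pr1_mk pr2_mk eE gen hs Si).
    by move=> j [ji Sj ij]; split; rewrite ?(C_side Si) ?(C_side Sj) ?S_same.
  + apply: infinite_cells => //; apply: infinite_superset same_far.
    by move=> j [ji Sj _ ij]; split; rewrite ?(C_side Si) ?(C_side Sj) ?S_same.
  + move=> pq; have [g h] := gen' pq; apply: infinite_cells => //.
    apply: infinite_superset (infinite_different_inter pr1_mk pr2_mk gen g h Si).
    move=> j [Sj ij]; have nij := S_nsame Si Sj; split => //; first by have [] := diff j nij.
    rewrite (C_side Si) (C_other Sj).
    exact: (different_sides_inter_adj p_ge2 q_ge2 pr1_mk pr2_mk eE).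
  + move=> pq; have [g h] := gen' pq; apply: infinite_cells => //.
    apply: infinite_superset (infinite_different_far p_ge2 q_ge2 eE gen g Si).
    by move=> j [Sj _ ij]; rewrite /= (C_side Si) (C_other Sj) S_nsame.
Qed.

End Conclusion.

(** * The tessellation *)

Section BetaMass.
Context {R : realType} (p : nat) (xi : R).
Hypothesis p_ge2 : (2 <= p)%N.
Local Notation r := (p%:R : R).

Let r_ge2 : 2 <= r. Proof. by rewrite ler_nat. Qed.
Let r_gt0 : 0 < r. Proof. by apply: lt_le_trans r_ge2; rewrite ltr0n. Qed.

Definition beta_const : R := p.-1%:R * r `^ (xi - 1).

Lemma beta_const_gt0 : 0 < beta_const.
Proof. by rewrite mulr_gt0 ?powR_gt0// ltr0n; lia. Qed.

Lemma beta_weightE i : beta_weight p xi i = beta_const * r ^ i.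
Proof.
rewrite /beta_weight /beta_const -mulrA; congr (_ * _).
have -> : i%:~R - 1 + xi = (xi - 1) + i%:~R by ring.
rewrite powRD; last by apply/implyP => _; rewrite gt_eqF.
by rewrite powR_intmul ?ltW.
Qed.

Lemma beta_set1 i : beta p xi [set i] = (beta_const * r ^ i)%:E.
Proof.
rewrite /beta esum_set1 ?beta_weightE// lee_fin.
by rewrite mulr_ge0 ?exprz_ge0// ltW ?beta_const_gt0.
Qed.

(** As r >= 2, the partial sums of the geometric tail are bounded by the telescoping r^t - r^(t -
    n). *)
Lemma beta_lt (t : int) : exists2 a, beta p xi [set i | i < t] = a%:E & a <= beta_const * r ^ t.
Proof.
have b0 := beta_const_gt0.
have bound : (beta p xi [set i | (i < t)%R] <= (beta_const * r ^ t)%:E)%E.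
  pose F (n : nat) : set int := [set (t - n.+1%:Z : int)].
  have -> : [set i : int | i < t] = \bigcup_n F n.
    apply/seteqP; split => i /=; last by move=> [n _ ->]; lia.
    by move=> it; exists (absz (t - i - 1)%R) => //=; rewrite /F /=; lia.
  rewrite measure_bigcup//; last first.
    by move=> m n _ _ [i []]; rewrite /F /= => -> h; clear - h; lia.
  apply: lime_le; first by apply: is_cvg_nneseries => n _ _; exact: measure_ge0.
  apply: nearW => n.
  rewrite [leLHS](_ : _ = (\sum_(0 <= k < n) beta p xi (F k))%E); last first.
    by apply: eq_bigl => k; rewrite in_setT.
  suff : (\sum_(0 <= k < n) beta p xi (F k) <=
      (beta_const * (r ^ t - r ^ (t - n%:Z)))%:E)%E.
    move/le_trans; apply; rewrite lee_fin ler_pM2l// lerBlDr lerDl.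
    by rewrite exprz_ge0// ltW.
  elim: n => [|n IH]; first by rewrite big_nil subr0 subrr mulr0.
  rewrite big_nat_recr//=; apply: le_trans (leeD2r _ IH) _.
  rewrite beta_set1 -EFinD lee_fin -mulrDr ler_pM2l//.
  have -> : r ^ (t - n%:Z) = r * r ^ (t - n.+1%:Z).
    rewrite -[X in X * _]expr1z -expfzDr ?gt_eqF//; congr (r ^ _); lia.
  have : 2 * r ^ (t - n.+1%:Z) <= r * r ^ (t - n.+1%:Z).
    by rewrite ler_pM2r// exprz_gt0.
  lra.
have fin : beta p xi [set i | i < t] \is a fin_num.
  by rewrite ge0_fin_numE ?measure_ge0//; apply: le_lt_trans bound _; rewrite ltry.
exists (fine (beta p xi [set i | i < t])); first by rewrite fineK.
by rewrite -lee_fin fineK.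
Qed.

Variable kappa : R.
Hypothesis kappa_gt0 : 0 < kappa.
Local Notation sphere_mass l := (kappa / (p.+1 * p ^ l.-1)%:R).

(** Collects kappa, the share of [nu0] given to the tree, the constant of [beta], and the ratio
    between p^l and the size (p+1) p^(l-1) of a sphere. *)
Definition box_const : R := kappa * beta_const * (r / p.+1%:R).

Lemma box_const_gt0 : 0 < box_const.
Proof.
apply: mulr_gt0; first by apply: mulr_gt0 => //; exact: beta_const_gt0.
by apply: divr_gt0 => //; rewrite ltr0n.
Qed.

Lemma sphere_massE (l : nat) (t : int) : (0 < l)%N ->
  sphere_mass l * (beta_const * r ^ t) = box_const * r ^ (t - l%:Z).
Proof.
move=> l0; rewrite expfzDr ?gt_eqF// -invr_expz -exprnP -{2}(prednK l0) exprS.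
rewrite natrM natrX /box_const; field.
by rewrite !gt_eqF ?exprn_gt0// ?ltr0n.
Qed.

Lemma box_mass1 (l : nat) i : (0 < l)%N ->
  ((sphere_mass l)%:E * beta p xi [set i])%E = (box_const * r ^ (i - l%:Z))%:E.
Proof. by move=> l0; rewrite beta_set1 -EFinM sphere_massE. Qed.

Lemma box_mass_lt (l : nat) (t : int) : (0 < l)%N ->
  exists2 a, ((sphere_mass l)%:E * beta p xi [set i | (i < t)%R])%E = a%:E
    & a <= box_const * r ^ (t - l%:Z).
Proof.
move=> l0; have [a -> ale] := beta_lt t.
exists (sphere_mass l * a) => //; rewrite -sphere_massE// ler_wpM2l//.
by rewrite divr_ge0// ltW.
Qed.

End BetaMass.

Section Sides.
Context {R : realType} {p q : nat} {T : marked_tree p.+1} {T' : marked_tree q.+1}.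
Local Notation bdry := (dl_boundary T T').

Definition nucleus_l (b : bdry) : option (end_of T) := if b is inl w then Some w else None.
Definition nucleus_r (b : bdry) : option (end_of T') := if b is inr w then Some w else None.

Definition bdry_box {d} {U : marked_tree d} (nucleus : bdry -> option (end_of U)) v : set bdry :=
  [set b | exists2 w, nucleus b = Some w & w (lvl v) = v].

Lemma box_setX {d} {U : marked_tree d.+1} (nucleus : bdry -> option (end_of U)) v J :
  box nucleus v J = bdry_box nucleus v `*` J.
Proof. by []. Qed.

Lemma preimage_box_l v : bdry_inl @^-1` (bdry_box nucleus_l v) = cylinder v.
Proof.
apply/seteqP; split => u /=; first by move=> [_ [<-]] /cylinderE.
by move=> /cylinderE uv; exists u.
Qed.

Lemma preimage_box_r v : bdry_inr @^-1` (bdry_box nucleus_r v) = cylinder v.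
Proof.
apply/seteqP; split => u /=; first by move=> [_ [<-]] /cylinderE.
by move=> /cylinderE uv; exists u.
Qed.

Lemma preimage_box_lr v : bdry_inr @^-1` (bdry_box nucleus_l v) = set0.
Proof. by apply/seteqP; split => // u []. Qed.

Lemma preimage_box_rl v : bdry_inl @^-1` (bdry_box nucleus_r v) = set0.
Proof. by apply/seteqP; split => // u []. Qed.

Lemma measurable_bdry_box_l v : measurable (bdry_box nucleus_l v).
Proof. by split; rewrite ?preimage_box_l ?preimage_box_lr//; exact: measurable_cylinder. Qed.

Lemma measurable_bdry_box_r v : measurable (bdry_box nucleus_r v).
Proof. by split; rewrite ?preimage_box_r ?preimage_box_rl//; exact: measurable_cylinder. Qed.

Lemma measurable_box_l v J : measurable (box nucleus_l v J).
Proof. by rewrite box_setX; apply: measurableX => //; exact: measurable_bdry_box_l. Qed.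

Lemma measurable_box_r v J : measurable (box nucleus_r v J).
Proof. by rewrite box_setX; apply: measurableX => //; exact: measurable_bdry_box_r. Qed.

Section Cells.
Context {dO : measure_display} {Omega : measurableType dO}
  (Phi : nat -> Omega -> bdry * int) (o : Omega).
Local Notation S := (points Phi nucleus_l o).
Local Notation S' := (points Phi nucleus_r o).
Local Notation w := (point_end Phi nucleus_l o).
Local Notation w' := (point_end Phi nucleus_r o).
Local Notation D := (point_delay Phi o).
Local Notation f := (fun j z => (Phi j o).2%:~R + horofunction R (Phi j o).1 z : R).


Lemma delay_l j z : S j -> f j z = (delayed w D j z.1)%:~R.
Proof.
rewrite /points /delayed /point_end /point_delay /=.
case: (Phi j o).1 => [u _|u []//].
by rewrite /= busemannE intrD.
Qed.

Lemma delay_r j z : S' j -> f j z = (delayed w' D j z.2)%:~R.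
Proof.
rewrite /points /delayed /point_end /point_delay /=.
case: (Phi j o).1 => [u []//|u _].
by rewrite /= busemannE intrD.
Qed.

Lemma points_lr j : S j \/ S' j.
Proof. by rewrite /points /=; case: (Phi j o).1 => u; [left|right]; exists u. Qed.

Lemma points_l_type j : S j <-> of_first_type (Phi j o).1.
Proof.
rewrite /points /=; case: (Phi j o).1 => u; split => //; first by exists u.
by move=> [].
Qed.

Lemma points_r_type j : S' j <-> ~~ of_first_type (Phi j o).1.
Proof.
rewrite /points /=; case: (Phi j o).1 => u; split => //; last by exists u.
by move=> [].
Qed.

Lemma voronoi_cellP i z (F : int) : f i z = F%:~R ->
  voronoi_cell R (Phi ^~ o) i z <->
  [/\ buse base_end z.1 + buse base_end z.2 = 0, forall j, S j -> F <= delayed w D j z.1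
    & forall j, S' j -> F <= delayed w' D j z.2].
Proof.
move=> fi; rewrite /voronoi_cell /dl_vertex /= !height_buse fi; split.
  move=> [hz zi]; split => // j Sj; have := zi j.
    by rewrite (delay_l _ Sj) ler_int.
  by rewrite (delay_r _ Sj) ler_int.
move=> [hz zS zS']; split => // j; have [Sj|Sj] := points_lr j.
  by rewrite (delay_l _ Sj) ler_int; exact: zS.
by rewrite (delay_r _ Sj) ler_int; exact: zS'.
Qed.

Lemma voronoi_side_l i : S i ->
  voronoi_cell R (Phi ^~ o) i = side_cell fst snd S S' w w' D i.
Proof.
by move=> Si; apply/seteqP; split => z /(voronoi_cellP (delay_l z Si)).
Qed.

Lemma voronoi_other_l i : S' i ->
  voronoi_cell R (Phi ^~ o) i = other_side_cell fst snd S S' w w' D i.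
Proof.
move=> Si; apply/seteqP; split => z.
  by move=> /(voronoi_cellP (delay_r z Si))[].
by move=> [hz zS zS']; apply/(voronoi_cellP (delay_r z Si)).
Qed.

Lemma voronoi_side_r i : S' i ->
  voronoi_cell R (Phi ^~ o) i = side_cell snd fst S' S w' w D i.
Proof.
move=> Si; rewrite voronoi_other_l//; apply/seteqP.
by split => z [hz zS zS']; split => //; rewrite addrC.
Qed.

Lemma voronoi_other_r i : S i ->
  voronoi_cell R (Phi ^~ o) i = other_side_cell snd fst S' S w' w D i.
Proof.
move=> Si; rewrite voronoi_side_l//; apply/seteqP.
by split => z [hz zS zS']; split => //; rewrite addrC.
Qed.

(** If one cell contains [z], the value of its point there bounds all competing values, hence the
    delays of all points whose cell contains [z]. *)
Lemma finite_voronoi z : (forall t, finite_set [set i | D i <= t]) ->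
  finite_set [set j | voronoi_cell R (Phi ^~ o) j z].
Proof.
move=> fD; have [[j [_ jz]]|nz] := pselect (exists j, voronoi_cell R (Phi ^~ o) j z); last first.
  by apply: (@sub_finite_set _ _ set0) => // i ?; apply: nz; exists i.
have [F Fj] : exists F : int, f j z = F%:~R.
  by have [Sj|Sj] := points_lr j; [rewrite (delay_l _ Sj)|rewrite (delay_r _ Sj)]; eexists.
apply: sub_finite_set (fD (F + (lvl z.1)%:Z + (lvl z.2)%:Z)) => i [_ /(_ j)].
rewrite Fj /=; have [Si|Si] := points_lr i.
  by rewrite (delay_l _ Si) ler_int; have := delayed_ge w D i z.1; lia.
by rewrite (delay_r _ Si) ler_int; have := delayed_ge w' D i z.2; lia.
Qed.

End Cells.
End Sides.

Section Intensity.
Context {R : realType} {p q : nat} {T : marked_tree p.+1} {T' : marked_tree q.+1}.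
Hypothesis p_ge2 : (2 <= p)%N.
Context (eta : probability (end_of T) R) (eta' : probability (end_of T') R) (xi : R).
Hypotheses (etaP : harmonic_measure eta) (eta'P : harmonic_measure eta').
Context {dO : measure_display} {Omega : measurableType dO} (P : probability Omega R)
  (Phi : nat -> Omega -> dl_boundary T T' * int).
Hypothesis PhiP : poisson_point_process P Phi (ipvt_intensity eta eta' xi).
Local Notation mu := (ipvt_intensity eta eta' xi).

Lemma intensityX (A : set (dl_boundary T T')) (J : set int) :
  measurable A -> mu (A `*` J) = (nu0 eta eta' A * beta p xi J)%E.
Proof. by move=> mA; rewrite /ipvt_intensity product_measure1E. Qed.

Lemma intensity_l (v : T) J : (0 < lvl v)%N -> mu (box nucleus_l v J)
  = (((if (q < p)%N then 1 else 2^-1) / (p.+1 * p ^ (lvl v).-1)%:R)%:E * beta p xi J)%E.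
Proof.
move=> v0; rewrite box_setX intensityX; last exact: measurable_bdry_box_l.
congr (_ * _)%E; rewrite /nu0 preimage_box_l preimage_box_lr measure0 adde0.
have p_gt0 : (0 < p)%N by apply: leq_trans p_ge2.
have := harmonic_cylinder p_gt0 etaP v0.
move: (cylinder v) => A etaA.
suff : (if (q < p)%N then eta A else (2^-1)%:E * eta A)%E
    = ((if (q < p)%N then 1 else 2^-1) / (p.+1 * p ^ (lvl v).-1)%:R)%:E by [].
by rewrite etaA; case: ifP => _; rewrite ?mul1r// EFinM.
Qed.

Lemma ae_finite_delays : {ae P, forall o, forall t : int,
  finite_set [set i | point_delay Phi o i <= t]}.
Proof.
apply: ae_forall_int => t.
have [a betaE _] := beta_lt xi p_ge2 (t + 1).
pose A : set (dl_boundary T T' * int) := setT `*` [set i | i < t + 1].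
have nuT : nu0 eta eta' setT = 1%E.
  rewrite /nu0 !preimage_setT.
  suff : (if (q < p)%N then eta setT else (2^-1)%:E * (eta setT + eta' setT))%E = 1%E by [].
  rewrite !probability_setT; case: ifP => // _.
  by rewrite -EFinD -EFinM; congr (_%:E); field.
have muA : mu A = a%:E.
  by rewrite /A intensityX// nuT betaE mul1e.
have := finite_points PhiP (measurableX measurableT (I : measurable [set i | i < t + 1])) muA.
apply: filterS => o; apply: sub_finite_set => i /= it; split => //=.
by rewrite ltzD1.
Qed.

Lemma ae_generic_l : {ae P, forall o, generic_points
  (points Phi nucleus_l o) (point_end Phi nucleus_l o) (point_delay Phi o)}.
Proof.
pose kappa : R := if (q < p)%N then 1 else 2^-1.
have k0 : 0 < kappa by rewrite /kappa; case: ifP.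
apply: (ae_generic_points p_ge2 PhiP measurable_box_l (box_const_gt0 xi p_ge2 k0)).
- by move=> v i v0; rewrite -box_mass1//; exact: intensity_l.
- move=> v t v0; have [a aE ale] := box_mass_lt xi p_ge2 k0 t v0.
  by exists a => //; rewrite -aE; exact: intensity_l.
- exact: ae_finite_delays.
Qed.

Lemma ae_horosphere_l : {ae P, forall o, horosphere_dense
  (points Phi nucleus_l o) (point_end Phi nucleus_l o) (point_delay Phi o)}.
Proof.
pose kappa : R := if (q < p)%N then 1 else 2^-1.
have k0 : 0 < kappa by rewrite /kappa; case: ifP.
apply: (ae_horosphere_dense p_ge2 PhiP measurable_box_l (box_const_gt0 xi p_ge2 k0)).
- by move=> v i v0; rewrite -box_mass1//; exact: intensity_l.
- move=> v t v0; have [a aE ale] := box_mass_lt xi p_ge2 k0 t v0.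
  by exists a => //; rewrite -aE; exact: intensity_l.
Qed.

Lemma ae_no_second_type : (q < p)%N -> {ae P, forall o, points Phi nucleus_r o = set0}.
Proof.
move=> qp.
pose A : set (dl_boundary T T') := [set b | exists w, nucleus_r b = Some w].
have Al : bdry_inl @^-1` A = set0 by apply/seteqP; split => // u [].
have mA : measurable A.
  split; first by rewrite Al.
  rewrite (_ : _ @^-1` A = setT)//.
  by apply/seteqP; split => // u _; exists u.
have muA : mu (A `*` setT) = 0%:E.
  by rewrite intensityX// /nu0 qp Al measure0 mul0e.
have mAT : measurable (A `*` [set: int]) by exact: measurableX.
exists (hit Phi (A `*` setT)); split.
- exact: (measurable_hit PhiP).
- have := pr_hit_le PhiP mAT muA; rewrite -lee_fin -prE; last exact: (measurable_hit PhiP).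
  by rewrite measure_le0 => /eqP.
- move=> o /eqP/set0P[i Si].
  by exists i.
Qed.

End Intensity.

Section SecondType.
Context {R : realType} {p : nat} {T T' : marked_tree p.+1}.
Hypothesis p_ge2 : (2 <= p)%N.
Context (eta : probability (end_of T) R) (eta' : probability (end_of T') R) (xi : R).
Hypothesis eta'P : harmonic_measure eta'.
Context {dO : measure_display} {Omega : measurableType dO} (P : probability Omega R)
  (Phi : nat -> Omega -> dl_boundary T T' * int).
Hypothesis PhiP : poisson_point_process P Phi (ipvt_intensity eta eta' xi).
Local Notation mu := (ipvt_intensity eta eta' xi).

(** Both trees have the same degree here, so the weights p^i of [beta] match the growth of T'. *)
Lemma intensity_r (v : T') J : (0 < lvl v)%N -> mu (box nucleus_r v J)
  = ((2^-1 / (p.+1 * p ^ (lvl v).-1)%:R)%:E * beta p xi J)%E.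
Proof.
move=> v0; rewrite box_setX intensityX; last exact: measurable_bdry_box_r.
congr (_ * _)%E; rewrite /nu0 ltnn preimage_box_r preimage_box_rl measure0 add0e.
have p_gt0 : (0 < p)%N by apply: leq_trans p_ge2.
have := harmonic_cylinder p_gt0 eta'P v0.
move: (cylinder v) => A etaA.
suff : ((2^-1)%:E * eta' A)%E = (2^-1 / (p.+1 * p ^ (lvl v).-1)%:R)%:E by [].
by rewrite etaA EFinM.
Qed.

Let half_gt0 : 0 < 2^-1 :> R. Proof. by rewrite invr_gt0. Qed.

Let mu_r1 (v : T') i : (0 < lvl v)%N -> mu (box nucleus_r v [set i])
  = (box_const p xi 2^-1 * p%:R ^ (i - (lvl v)%:Z))%:E.
Proof. by move=> v0; rewrite -box_mass1//; exact: intensity_r. Qed.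

Let mu_r_lt (v : T') (t : int) : (0 < lvl v)%N ->
  exists2 a, mu (box nucleus_r v [set i | i < t]) = a%:E
    & a <= box_const p xi 2^-1 * p%:R ^ (t - (lvl v)%:Z).
Proof.
move=> v0; have [a aE ale] := box_mass_lt xi p_ge2 half_gt0 t v0.
by exists a => //; rewrite -aE; exact: intensity_r.
Qed.

Lemma ae_generic_r : {ae P, forall o, generic_points
  (points Phi nucleus_r o) (point_end Phi nucleus_r o) (point_delay Phi o)}.
Proof.
apply: (ae_generic_points p_ge2 PhiP measurable_box_r (box_const_gt0 xi p_ge2 half_gt0)).
- exact: mu_r1.
- exact: mu_r_lt.
- exact: (ae_finite_delays p_ge2 PhiP).
Qed.

Lemma ae_horosphere_r : {ae P, forall o, horosphere_dense
  (points Phi nucleus_r o) (point_end Phi nucleus_r o) (point_delay Phi o)}.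
Proof.
apply: (ae_horosphere_dense p_ge2 PhiP measurable_box_r (box_const_gt0 xi p_ge2 half_gt0)).
- exact: mu_r1.
- exact: mu_r_lt.
Qed.

End SecondType.


Section FixedConfiguration.
Context {R : realType} {p q : nat} {T : marked_tree p.+1} {T' : marked_tree q.+1}.
Context {dO : measure_display} {Omega : measurableType dO}
  (Phi : nat -> Omega -> dl_boundary T T' * int) (o : Omega).
Local Notation S := (points Phi nucleus_l o).
Local Notation S' := (points Phi nucleus_r o).
Let same : rel nat := fun i j => same_type (Phi i o).1 (Phi j o).1.

Lemma same_points_l i j : S i -> if same i j then S j else S' j.
Proof.
rewrite /same /same_type => /points_l_type ->.
by case: ifPn => /eqP ij; [apply/points_l_type|apply/points_r_type; apply/negP => /esym].
Qed.

Lemma same_points_r i j : S' i -> if same i j then S' j else S j.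
Proof.
rewrite /same /same_type => /points_r_type/negbTE ->.
case: ifPn => /eqP ij; [apply/points_r_type|apply/points_l_type].
  by rewrite -ij.
by case: of_first_type ij.
Qed.

Lemma points_l_same i j : S i -> S j -> same i j.
Proof. by rewrite /same /same_type => /points_l_type -> /points_l_type ->. Qed.

Lemma points_r_same i j : S' i -> S' j -> same i j.
Proof.
by rewrite /same /same_type => /points_r_type/negbTE -> /points_r_type/negbTE ->.
Qed.

Lemma points_lr_nsame i j : S i -> S' j -> ~~ same i j.
Proof. by rewrite /same /same_type => /points_l_type -> /points_r_type/negbTE ->. Qed.

Lemma points_rl_nsame i j : S' i -> S j -> ~~ same i j.
Proof. by rewrite /same /same_type => /points_r_type/negbTE -> /points_l_type ->. Qed.

End FixedConfiguration.

Theorem proposition6p9 (R : realType) (p q : nat)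
  (q_ge2 : (2 <= q)%N) (q_le_p : (q <= p)%N)
  (T : marked_tree p.+1) (T' : marked_tree q.+1)
  (eta : probability (end_of T) R) (etaP : harmonic_measure eta)
  (eta' : probability (end_of T') R) (eta'P : harmonic_measure eta')
  (xi : R)
  (dO : measure_display) (Omega : measurableType dO) (P : probability Omega R)
  (Phi : nat -> Omega -> dl_boundary T T' * int)
  (PhiP : poisson_point_process P Phi (ipvt_intensity eta eta' xi)) :
  {ae P, forall o : Omega,
    let C : nat -> set (T * T') := voronoi_cell R (Phi ^~ o) in
    let same i j := same_type (Phi i o).1 (Phi j o).1 in
    [/\ forall i j, ~~ same i j ->
          finite_set (C i `&` C j) /\ finite_set (adjacency (C i) (C j)),
        forall i j, i != j -> same i j ->
          (infinite_set (C i `&` C j) \/ C i `&` C j = set0) /\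
          (infinite_set (adjacency (C i) (C j)) \/
             adjacency (C i) (C j) = set0),
        forall i,
          [/\ infinite_set [set C j | j in [set j |
                [/\ j != i, same i j & infinite_set (C i `&` C j)]]],
              infinite_set [set C j | j in [set j |
                [/\ j != i, same i j & C i `&` C j = set0]]],
              p = q -> infinite_set [set C j | j in [set j |
                [/\ ~~ same i j, finite_set (C i `&` C j)
                  & C i `&` C j !=set0]]]
            & p = q -> infinite_set [set C j | j in [set j |
                ~~ same i j /\ C i `&` C j = set0]]]
      & forall i,
          [/\ infinite_set [set C j | j in [set j |
                [/\ j != i, same i j
                  & infinite_set (adjacency (C i) (C j))]]],
              infinite_set [set C j | j in [set j |
                [/\ j != i, same i j & adjacency (C i) (C j) = set0]]],
              p = q -> infinite_set [set C j | j in [set j |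
                [/\ ~~ same i j, finite_set (adjacency (C i) (C j))
                  & adjacency (C i) (C j) !=set0]]]
            & p = q -> infinite_set [set C j | j in [set j |
                ~~ same i j /\ adjacency (C i) (C j) = set0]]]]}.
Proof.
have p_ge2 : (2 <= p)%N by exact: leq_trans q_le_p.
have mk_pr1 (z : T * T') : (z.1, z.2) = z by case: z.
have fin := ae_finite_delays p_ge2 PhiP.
have gen := ae_generic_l p_ge2 etaP PhiP.
have [qp|pq] := ltnP q p.
  have none := ae_no_second_type PhiP qp.
  have all := ae_and (ae_and fin gen) none.
  move: all; apply: filterS => o [[{}fin {}gen] {}none].
  pose C := voronoi_cell R (Phi ^~ o).
  have pq : p <> q by move=> pq; rewrite pq ltnn in qp.
  have all_l i : points Phi nucleus_l o i.
    by have [//|] := points_lr Phi o i; rewrite none.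
  have ne i : C i !=set0.
    exact: (side_nonempty q_ge2 (mk := pair) (pr1 := fst) (pr2 := snd) (fun _ _ => erefl)
      (fun _ _ => erefl) gen (fun e => False_ind _ (pq e)) (fun _ => none)
      (@voronoi_side_l R _ _ _ _ _ _ Phi o) (all_l i)).
  have concl i := side_conclusion p_ge2 q_ge2 (mk := pair) (pr1 := fst) (pr2 := snd)
    (e := @dl_adj _ _ T T') (fun _ _ => erefl) (fun _ _ => erefl) mk_pr1
    (fun _ _ => erefl) gen (fun e => False_ind _ (pq e)) (fun _ => none)
    (@voronoi_side_l R _ _ _ _ _ _ Phi o) (@voronoi_other_l R _ _ _ _ _ _ Phi o)
    (fun z => finite_voronoi z fin) (same_points_l (Phi := Phi) (o := o))
    (points_l_same (Phi := Phi) (o := o)) (points_lr_nsame (Phi := Phi) (o := o)) ne (all_l i).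
  by split => [i j|i j|i|i]; have [h1 h2 h3 h4] := concl i; [exact: h1|exact: h2| |].
have {q_le_p}pq : q = p by apply/eqP; rewrite eqn_leq q_le_p.
(* From here on both trees have the same degree, so the second type is obtained by exchanging the
   factors. *)
subst q.
have gen_r := ae_generic_r p_ge2 eta'P PhiP.
have hor := ae_and (ae_horosphere_l p_ge2 etaP PhiP) (ae_horosphere_r p_ge2 eta'P PhiP).
have all := ae_and (ae_and fin gen) (ae_and gen_r hor).
move: all; apply: filterS => o [[{}fin {}gen] [{}gen_r [hor_l hor_r]]].
pose C := voronoi_cell R (Phi ^~ o).
have absurd (A : set nat) : p <> p -> A = set0 by [].
have eE2 (y z : T * T') : dl_adj y z = adj T' y.2 z.2 && adj T y.1 z.1 by rewrite andbC.
have ne i : C i !=set0.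
  have [Si|Si] := points_lr Phi o i.
    exact: (side_nonempty p_ge2 (mk := pair) (pr1 := fst) (pr2 := snd) (fun _ _ => erefl)
      (fun _ _ => erefl) gen (fun=> conj gen_r hor_r) (@absurd _)
      (@voronoi_side_l R _ _ _ _ _ _ Phi o) Si).
  exact: (side_nonempty p_ge2 (mk := fun v v' => (v', v)) (pr1 := snd) (pr2 := fst)
    (fun _ _ => erefl) (fun _ _ => erefl) gen_r (fun=> conj gen hor_l) (@absurd _)
    (@voronoi_side_r R _ _ _ _ _ _ Phi o) Si).
have concl_l i (Si : points Phi nucleus_l o i) := side_conclusion p_ge2 p_ge2
  (mk := pair) (pr1 := fst) (pr2 := snd)
  (e := @dl_adj _ _ T T') (fun _ _ => erefl) (fun _ _ => erefl) mk_pr1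
  (fun _ _ => erefl) gen (fun=> conj gen_r hor_r) (@absurd _)
  (@voronoi_side_l R _ _ _ _ _ _ Phi o) (@voronoi_other_l R _ _ _ _ _ _ Phi o)
  (fun z => finite_voronoi z fin) (same_points_l (Phi := Phi) (o := o))
  (points_l_same (Phi := Phi) (o := o)) (points_lr_nsame (Phi := Phi) (o := o)) ne Si.
have concl_r i (Si : points Phi nucleus_r o i) := side_conclusion p_ge2 p_ge2
  (mk := fun v v' => (v', v)) (pr1 := snd) (pr2 := fst)
  (e := @dl_adj _ _ T T') (fun _ _ => erefl) (fun _ _ => erefl) mk_pr1
  eE2 gen_r (fun=> conj gen hor_l) (@absurd _)
  (@voronoi_side_r R _ _ _ _ _ _ Phi o) (@voronoi_other_r R _ _ _ _ _ _ Phi o)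
  (fun z => finite_voronoi z fin) (same_points_r (Phi := Phi) (o := o))
  (points_r_same (Phi := Phi) (o := o)) (points_rl_nsame (Phi := Phi) (o := o)) ne Si.
split => [i j|i j|i|i]; have [/concl_l|/concl_r] := points_lr Phi o i;
  by move=> [h1 h2 h3 h4]; first [exact: h1|exact: h2|exact: h3|exact: h4].
Qed.
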